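(* Let $m\in\{1,2\}$ and let $A\subset \mathbb{P}^2=\mathbb{R}^2\times\mathbb{R}$ be a Borel set. (1) If $\dim A\le m+1$, then $\dim P_V(A)\ge \dim A$ for almost all $V\in G(3,m)$. (2) If $\dim A> m+1$, then $\mathcal{L}^m(P_V(A))>0$ for almost all $V\in G(3,m)$.
   Context: For $n\ge 1$, $\mathbb{P}^n=\mathbb{R}^n\times\mathbb{R}$ (as a vector space, $\mathbb{R}^{n+1}$) equipped with the parabolic metric $d(p,q)=\|p-q\|$, where $\|(x,t)\|=\sqrt{|x|^2+|t|}$ for $x\in\mathbb{R}^n$, $t\in\mathbb{R}$, and $|x|$ is the Euclidean norm. For $B\subset\mathbb{P}^n$, $d(B)$ denotes the diameter of $B$ with respect to the metric $d$. The parabolic Hausdorff dimension $\dim A$ of $A\subset\mathbb{P}^n$ is the Hausdorff dimension with respect to $d$: $$\dim A=\inf\{s>0:\forall \varepsilon>0\ \exists B_i\subset\mathbb{P}^n\ (i\ge1)\text{ with } A\subset\bigcup_{i=1}^\infty B_i\text{ and }\sum_{i=1}^\infty d(B_i)^s<\varepsilon\}.$$ $G(n+1,m)$ is the Grassmannian of linear $m$-dimensional subspaces of $\mathbb{R}^{n+1}=\mathbb{R}^n\times\mathbb{R}$, equipped with its unique rotationally invariant Borel probability measure $\gamma_{n+1,m}$; ''almost all $V$'' is with respect to this measure. $P_V:\mathbb{R}^{n+1}\to V$ is the Euclidean orthogonal projection onto $V$; $P_V(A)$ is regarded as a subset of $\mathbb{P}^n$ when taking $\dim$. $\mathcal{L}^m$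 is the $m$-dimensional Lebesgue measure on the $m$-dimensional subspace $V$. *)

(* Defs.v *)
From HB Require Import structures.
From mathcomp Require Import all_boot all_order all_algebra.
From mathcomp Require Import all_classical all_reals all_analysis.

Set Implicit Arguments.
Unset Strict Implicit.
Unset Printing Implicit Defensive.

Import Order.TTheory GRing.Theory Num.Theory.
Import numFieldNormedType.Exports.

Local Open Scope classical_set_scope.
Local Open Scope ring_scope.

Definition borel_set (T : topologicalType) (A : set T) : Prop := <<s @open T >> A.

Section Hausdorff.
Variables (R : realType) (T : Type) (d : T -> T -> R).

(* The supremum of the empty family is -oo, hence the maximum with 0. *)
Definition diam (B : set T) : \bar R :=
  maxe 0%E (ereal_sup [set (d p q)%:E | p in B & q in B]).

Definition hausdorff_dim (A : set T) : \bar R :=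
  ereal_inf [set s%:E | s in [set s : R | 0 < s /\
    forall e : R, 0 < e -> exists B : nat -> set T,
      A `<=` \bigcup_k B k /\
      (\sum_(k <oo) poweR (diam (B k)) s < e%:E)%E]].

End Hausdorff.

Section Parabolic.
Variables (R : realType) (n : nat).

(* A point (x, t) of R^n x R is a row vector of length n + 1 whose last
   coordinate is t. *)
Definition parabolic_norm (p : 'rV[R]_n.+1) : R :=
  Num.sqrt (\sum_(i < n) p 0 (widen_ord (leqnSn n) i) ^+ 2 + `|p 0 ord_max|).

Definition parabolic_dist (p q : 'rV[R]_n.+1) : R := parabolic_norm (p - q).

Definition parabolic_dim (A : set 'rV[R]_n.+1) : \bar R :=
  hausdorff_dim parabolic_dist A.

End Parabolic.

Section OrthogonalProjection.
Variables (R : realType) (d : nat).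
Implicit Types (V : {vspace 'rV[R]_d}) (p v : 'rV[R]_d).

Definition basis_mx V : 'M[R]_(\dim V, d) := \matrix_(i < \dim V) (vbasis V)`_i.

(* As for spectral.proj_ortho, but over R: the matrix (acting on the right) of
   the projection onto V along the Euclidean orthogonal complement of V. *)
Definition orth_proj_mx V : 'M[R]_d :=
  proj_mx <<basis_mx V>>%MS (orthomx idfun 1%:M (basis_mx V)).

Definition orth_proj V p : 'rV[R]_d := p *m orth_proj_mx V.

Lemma mem_basis_mx V p : (p \in V) = (p <= basis_mx V)%MS.
Proof.
apply/idP/idP => [pV|/submxP[c ->]].
  rewrite (coord_vbasis pV); apply: summx_sub => i _.
  by rewrite scalemx_sub// -(rowK (fun i => (vbasis V)`_i)) row_sub.
rewrite mulmx_sum_row; apply: memv_suml => i _; apply: memvZ.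
by rewrite rowK; apply/vbasis_mem/mem_nth; rewrite size_tuple.
Qed.

Let orthE m k (A : 'M[R]_(m, d)) (B : 'M[R]_(k, d)) :
  (A <= orthomx idfun 1%:M B)%MS = (A *m B^T == 0).
Proof. by rewrite /orthomx mul1mx map_mx_id//; apply/sub_kermxP/eqP. Qed.

Lemma sqr_rv_eq0 v : v *m v^T = 0 -> v = 0.
Proof.
move=> /matrixP/(_ 0 0); rewrite !mxE => v0; apply/rowP => i; rewrite mxE.
have /eqP : \sum_j v 0 j ^+ 2 = 0.
  by rewrite -[RHS]v0; apply: eq_bigr => j _; rewrite mxE expr2.
rewrite psumr_eq0 => [/allP/(_ i (mem_index_enum _))|j _]; last exact: sqr_ge0.
by rewrite /= sqrf_eq0 => /eqP.
Qed.

Let orth_disj V :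
  (<<basis_mx V>> :&: orthomx idfun 1%:M (basis_mx V))%MS = 0.
Proof.
apply/eqP/rowV0P => v; rewrite sub_capmx genmxE orthE.
move=> /andP[/submxP[c ->] /eqP cB]; apply: sqr_rv_eq0.
by rewrite trmx_mul mulmxA cB mul0mx.
Qed.

Lemma orth_proj_mem V p : orth_proj V p \in V.
Proof. by rewrite mem_basis_mx -(genmxE (basis_mx V)) proj_mx_sub. Qed.

Lemma orth_proj_orth V p v : v \in V -> (p - orth_proj V p) *m v^T = 0.
Proof.
rewrite mem_basis_mx => /submxP[c ->]; rewrite trmx_mul mulmxA.
suff /eqP -> : (p - orth_proj V p) *m (basis_mx V)^T == 0 by rewrite mul0mx.
rewrite -orthE proj_mx_compl_sub//; apply: submx_full.
rewrite -col_leq_rank mxrank_disjoint_sum//.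
rewrite genmxE mxrank_ker mul1mx map_mx_id// mxrank_tr.
by rewrite subnKC// rank_leq_col.
Qed.

End OrthogonalProjection.

Section Grassmannian.
Variables (R : realType) (d : nat) (m : 'I_d.+1).

(* The bound m <= d makes the type inhabited, as measurableType requires. *)
Definition grassmannian : Type := {V : {vspace 'rV[R]_d} | \dim V == m}.

HB.instance Definition _ :=
  SubType.copy grassmannian {V : {vspace 'rV[R]_d} | \dim V == m}.
HB.instance Definition _ :=
  Choice.copy grassmannian {V : {vspace 'rV[R]_d} | \dim V == m}.

Definition grass_proj_mx (V : grassmannian) : 'M[R]_d := orth_proj_mx (val V).

(* This is the topology of the metric ||P_V - P_W||. *)
HB.instance Definition _ :=
  Topological.copy grassmannian (initial_topology grass_proj_mx).

Lemma grassmannian_nonempty :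
  \dim <<take m (vbasis {: 'rV[R]_d})>>%VS == m.
Proof.
have /basis_free := vbasisP {: 'rV[R]_d}.
rewrite -{1}(cat_take_drop m (vbasis _)) => /catl_free.
rewrite /free => /eqP ->; rewrite size_take size_tuple dimvf dim_matrix mul1r.
by have := ltn_ord m; rewrite ltnS leq_eqVlt => /orP[/eqP ->|->]; rewrite ?ltnn.
Qed.

HB.instance Definition _ := isPointed.Build grassmannian
  (exist (fun V : {vspace 'rV[R]_d} => \dim V == m) _ grassmannian_nonempty).

Definition grass_borel := g_sigma_algebraType (@open grassmannian).
HB.instance Definition _ := Measurable.on grass_borel.

(* The image of the set B under the rotation v |-> v *m g. *)
Definition grass_rotate (g : 'M[R]_d) (B : set grassmannian) :
    set grassmannian :=
  [set W | exists2 V, B V & val W = (linfun (mulmxr g) @: val V)%VS].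

Definition rotation_invariant (gamma : set grass_borel -> \bar R) : Prop :=
  forall g : 'M[R]_d, g *m g^T = 1%:M -> \det g = 1 ->
  forall B : set grass_borel, measurable B -> gamma (grass_rotate g B) = gamma B.

End Grassmannian.

Section Lebesgue.
Variable R : realType.

(* Lebesgue outer measure on R^m.  Projections of Borel sets are analytic, hence
   Lebesgue measurable, so on them it agrees with Lebesgue measure. *)
Definition lebesgue_outer (m : nat) (E : set 'rV[R]_m) : \bar R :=
  ereal_inf [set v | exists a b : nat -> 'rV[R]_m,
    [/\ forall k i, a k 0 i <= b k 0 i,
        E `<=` \bigcup_k [set x | forall i, a k 0 i <= x 0 i <= b k 0 i] &
        v = (\sum_(k <oo) (\prod_(i < m) (b k 0 i - a k 0 i))%:E)%E]].

Variables (d : nat) (m : 'I_d.+1).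

Definition orthonormal_frame (V : grassmannian R m) (F : 'M[R]_(m, d)) : Prop :=
  F *m F^T = 1%:M /\ forall i, row i F \in val V.

Lemma orthonormal_rows k (A : 'M[R]_(k, d)) : row_free A ->
  exists2 F : 'M[R]_(k, d), F *m F^T = 1%:M & (F <= A)%MS.
Proof.
elim: k A => [|k IH] A.
  by move=> _; exists 0; [apply/matrixP => -[]|rewrite sub0mx].
rewrite -[k.+1]/(1 + k)%N in A *; rewrite -(vsubmxK A).
set u := usubmx A; set A' := dsubmx A => freeA.
have freeA' : row_free A'.
  apply/row_freeP; have /row_freeP[B] := freeA.
  rewrite -[B]hsubmxK mul_col_row (scalar_mx_block 1).
  by case/eq_block_mx => _ _ _ ?; exists (rsubmx B).
have [F FF FA] := IH A' freeA'.
pose w := u - u *m F^T *m F.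
have wF : w *m F^T = 0 by rewrite mulmxBl -!mulmxA FF mulmx1 subrr.
have w0 : w != 0.
  apply: contraTneq freeA => /eqP; rewrite subr_eq0 => /eqP uE.
  have uA' : (u <= A')%MS by rewrite uE (submx_trans (submxMl _ _)).
  rewrite /row_free eqn_leq negb_and -!ltnNge; apply/orP; right.
  by rewrite -addsmxE (addsmx_idPr uA') (leq_ltn_trans (rank_leq_row _)).
have ww : 0 < (w *m w^T) 0 0.
  rewrite lt0r; apply/andP; split.
    apply: contraNneq w0 => w0; apply/eqP/sqr_rv_eq0/matrixP => i j.
    by rewrite !ord1 w0 mxE.
  by rewrite mxE sumr_ge0// => j _; rewrite [_^T _ _]mxE -expr2 sqr_ge0.
pose c := Num.sqrt ((w *m w^T) 0 0); pose e := c^-1 *: w.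
have c0 : c != 0 by rewrite sqrtr_eq0 -ltNge.
have eF : e *m F^T = 0 by rewrite -scalemxAl wF scaler0.
exists (col_mx e F); last first.
  rewrite -!addsmxE addsmx_sub; apply/andP; split; last first.
    by rewrite (submx_trans FA) ?addsmxSr.
  rewrite scalemx_sub// addmx_sub ?addsmxSl// eqmx_opp.
  by rewrite (submx_trans (submxMl _ _))// (submx_trans FA) ?addsmxSr.
rewrite tr_col_mx mul_col_row FF eF -[F *m e^T]trmxK trmx_mul trmxK eF trmx0.
rewrite (scalar_mx_block 1); congr block_mx; apply/matrixP => i j.
rewrite !ord1 -scalemxAl linearZ/= -scalemxAr scalerA mxE [RHS]mxE eqxx.
by rewrite -[X in _ * X]sqr_sqrtr ?ltW// -/c -invfM -expr2 mulVf// expf_neq0.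
Qed.

Lemma orthonormal_frame_ex (V : grassmannian R m) :
  exists F, orthonormal_frame V F.
Proof.
suff ex_frame k (W : {vspace 'rV[R]_d}) : \dim W = k ->
    exists F : 'M[R]_(k, d), F *m F^T = 1%:M /\ forall i, row i F \in W.
  by apply: ex_frame; apply/eqP/(valP V).
move=> <-; have [|F FF FW] := @orthonormal_rows _ (basis_mx W).
  rewrite -kermx_eq0; apply/rowV0P => c /sub_kermxP cW; apply/rowP => i.
  rewrite mxE; have /basis_free/freeP := vbasisP W; apply.
  by rewrite -[RHS]cW mulmx_sum_row; apply: eq_bigr => j _; rewrite rowK.
by exists F; split=> // i; rewrite mem_basis_mx (submx_trans (row_sub _ _)).
Qed.

(* Lebesgue measure on V: Lebesgue measure of the set of coordinates with respect
   to an orthonormal basis of V; by isometry invariance it does not depend on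
   the basis chosen. *)
Definition lebesgue_on (V : grassmannian R m) (E : set 'rV[R]_d) : \bar R :=
  lebesgue_outer [set c : 'rV[R]_m | E (c *m get (orthonormal_frame V))].

End Lebesgue.

(* Main.v *)
(* Suppose that A has positive s-dimensional Hausdorff content.  The codes of the
   points of A in a unit cube, with two binary digits of time for each digit of
   space, form an analytic set of Cantor space.  Dyadic net content, described by
   gales (nonnegative superadditive functions on the binary tree), increases to its
   limit along increasing unions, so that a compact subset of the codes has positive
   content, and it carries a Frostman measure tau, parametrised here as the
   image of Lebesgue measure on an interval.

   A point x is projected into the parabolic ball of radius r by a set of V of small
   gamma-measure, which is estimated after reduction to caps and slabs for the
   direction of V (m = 1) or its normal (m = 2); the measure of a cap is bounded by
   packing rotated copies of it.  Together with the two bounds for the tau-measure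
   of Euclidean balls coming from the parabolic dimension, integration over V shows
   that the tau x tau-measure of the pairs whose projections are within r of each
   other is on average O(r^s), up to logarithms.  Markov's inequality then gives a
   projected measure with the decay required by the mass distribution principle.
   When s > m + 1 the Euclidean analogue is O(r^m) without logarithms, and for
   almost all V it holds at V itself, with a constant depending on V, for arbitrarily
   small r; a cover of the projection by boxes of small total
   volume, cut into cells of side about r, would then have too little measure. *)

Require Import Defs.
From mathcomp Require Import all_boot all_order all_algebra.
From mathcomp Require Import all_classical all_reals all_analysis.
From mathcomp Require Import measurable_realfun lra ring zify.

Set Implicit Arguments.
Unset Strict Implicit.
Unset Printing Implicit Defensive.

Import Order.TTheory GRing.Theory Num.Theory.
Import numFieldNormedType.Exports.
Local Open Scope classical_set_scope.
Local Open Scope ring_scope.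

(** Positive Hausdorff content of a Borel set carries no compactness. Content is therefore taken on
    a tree, where it is exactly additive as long as it stays below its cap; this makes both
    continuity along increasing unions and Choquet's capacitability argument elementary.

    The threshold m + 1 comes from a sum over scales. Put x = 2^(-s). A Euclidean ball of radius
    2^(-j) has mass O((2x)^j), being covered by about 2^j parabolic balls of the same radius, and
    O(x^(j/2)), lying in boundedly many parabolic balls of radius 2^(-j/2). Weighted by the measure
    of the bad V, the worst scale contributes O(x^k) as long as 2^(m+1) x >= 1, that is s <= m + 1;
    for s > m + 1 the Euclidean sum is dominated by a convergent geometric series.

    An averaged bound becomes a bound at all scales by summing Markov's inequality over k, which
    costs a little of the exponent. Part (1) can afford this, since every exponent below dim A will
    do. Part (2) cannot, since r^m is exactly the rate needed, and settles for infinitely many good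
    scales. *)

(** * Gales and net content on Cantor space *)

(* Prefixes are stored with the most recent bit first, so that the children of
   the node w are true :: w and false :: w. *)
Fixpoint pre (c : nat -> bool) n :=
  if n is n'.+1 then c n' :: pre c n' else [::].

Lemma size_pre c n : size (pre c n) = n.
Proof. by elim: n => //= n ->. Qed.

Lemma preD c m n : exists v, size v = n /\ pre c (m + n) = v ++ pre c m.
Proof.
elim: n => [|n [v [sv E]]]; first by exists [::]; rewrite addn0.
by exists (c (m + n)%N :: v); rewrite addnS /= sv E.
Qed.

Lemma pre_suffix c n v y : pre c n = v ++ y -> y = pre c (size y).
Proof.
elim: v n => [|b v IH] n /=; first by move=> <-; rewrite size_pre.
by case: n => //= n [_ /IH].
Qed.

Lemma eq_pre c c' n : (forall i, (i < n)%N -> c i = c' i) -> pre c n = pre c' n.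
Proof.
elim: n => //= n IH h; rewrite h// IH// => i lin; apply: h; exact: ltnW.
Qed.

Lemma pre_eq c c' n i : pre c n = pre c' n -> (i < n)%N -> c i = c' i.
Proof.
elim: n => //= n IH [cn /IH h]; rewrite ltnS leq_eqVlt => /orP[/eqP ->//|].
exact: h.
Qed.

(** The head of a list is its latest bit, so the recursion on the tail meets the nodes nearest the
    root first: this is the stopping time of P on the path to x, and its values form an
    antichain. *)
Fixpoint first (P : pred (seq bool)) x : option (seq bool) :=
  match x with
  | [::] => if P [::] then Some [::] else None
  | b :: x' => if first P x' is Some y then Some y
               else if P x then Some x else None
  end.

Lemma first_some P x y : first P x = Some y -> P y /\ exists v, x = v ++ y.
Proof.
elim: x => [|b x IH] /=; first by case: ifP => // P0 [<-]; split=> //; exists [::].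
case: (first P x) IH => [z|] IH.
  by case=> ?; subst z; have [Py [v ->]] := IH erefl; split=> //; exists (b :: v).
by case: ifP => // Px [<-]; split=> //; exists [::].
Qed.

Lemma first_none P x : first P x = None -> P x = false.
Proof. by case: x => [|b x] /=; [case: ifP|case: first => //; case: ifP]. Qed.

Lemma first_cat P v x y : first P x = Some y -> first P (v ++ x) = Some y.
Proof. by move=> h; elim: v => //= b v ->. Qed.

Lemma first_self P x y : first P x = Some y -> first P y = Some y.
Proof.
elim: x => [|b x IH] /=; first by case: ifP => // P0 [<-] /=; rewrite P0.
case E : (first P x) => [z|]; first by case=> ?; subst z; apply: IH.
by case: ifP => // Px [<-] /=; rewrite E Px.
Qed.

Section Gale.
Variables (R : realType) (psi : nat -> R).
Hypothesis psi_gt0 : forall n, 0 < psi n.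
Implicit Types (g h : seq bool -> R) (E : set (nat -> bool)) (w x v : seq bool).

Definition gale w g := (forall x, 0 <= g x) /\
  forall v, g (true :: v ++ w) + g (false :: v ++ w) <= g (v ++ w).

Definition wins w g E := forall c, E c -> pre c (size w) = w ->
  exists n, psi (size w + n) <= g (pre c (size w + n)).

(* For the countable covers of E below w by cylinders, the least total weight
   psi: a cover gives the gale summing the weights of its members below a node,
   and the first winning nodes of a gale form a cover. *)
Definition content E w : R := inf [set g w | g in [set g | gale w g /\ wins w g E]].

Let root_gale w x : R := if x == w then psi (size w) else 0.

Let root_galeP E w : [set g | gale w g /\ wins w g E] (root_gale w).
Proof.
have neq b v : (b :: v ++ w == w) = false.
  by apply/eqP => /(congr1 size) /=; rewrite size_cat; lia.
split; first split.
- by move=> x; rewrite /root_gale; case: ifP => // _; apply/ltW.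
- move=> v; rewrite /root_gale !neq addr0; case: ifP => // _; exact/ltW.
- by move=> c Ec cw; exists 0%N; rewrite addn0 cw /root_gale eqxx.
Qed.

Lemma content_has_inf E w : has_inf [set g w | g in [set g | gale w g /\ wins w g E]].
Proof.
split; first by exists (root_gale w w); exists (root_gale w) => //; apply: root_galeP.
by exists 0 => _ [g [[g0 _] _] <-].
Qed.

Lemma content_le E w g : gale w g -> wins w g E -> content E w <= g w.
Proof. by move=> gg wg; apply: (ge_inf (content_has_inf E w).2); exists g. Qed.

Lemma content_ge E w a : (forall g, gale w g -> wins w g E -> a <= g w) ->
  a <= content E w.
Proof.
move=> h; apply: lb_le_inf; first exact: (content_has_inf E w).1.
by move=> _ [g [gg wg] <-]; exact: h.
Qed.

Lemma content_lt E w a : content E w < a ->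
  exists g, [/\ gale w g, wins w g E & g w < a].
Proof.
move=> ltEa; have [_ [g [gg wg] <-] ga] :=
  @inf_adherent R _ (a - content E w) (ltac:(by rewrite subr_gt0)) (content_has_inf E w).
by exists g; split=> //; move: ga; rewrite -/(content E w) addrC subrK.
Qed.

Lemma content_ge0 E w : 0 <= content E w.
Proof. by apply: content_ge => g [] . Qed.

Lemma content_le_psi E w : content E w <= psi (size w).
Proof.
have [gg wg] := root_galeP E w; have := content_le gg wg.
by rewrite /root_gale eqxx.
Qed.

Lemma content_sub E E' w : E `<=` E' -> content E w <= content E' w.
Proof. by move=> EE'; apply: content_ge => g gg wg; apply: content_le => // c /EE'/wg. Qed.

Lemma content_miss E w : (forall c, E c -> pre c (size w) <> w) -> content E w = 0.
Proof.
move=> miss; apply/eqP; rewrite eq_le content_ge0 andbT.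
by apply: (@content_le _ _ (fun=> 0)) => [|c /miss//]; split=> // v; rewrite addr0.
Qed.

Let suffix_child b b' v w : suffix (b :: w) (v ++ b' :: w) = (b == b').
Proof.
apply/suffixP/eqP => [[s]|->]; last by exists v.
move=> E; have := congr1 size E; rewrite !size_cat /= => szE.
by move: E => /eqP; rewrite eqseq_cat; [case/andP => _ /eqP[]|move: szE => /eqP; rewrite eqn_add2r => /eqP].
Qed.

Let suffix_root b w : suffix (b :: w) w = false.
Proof. by apply/negP => /size_suffix /=; rewrite ltnn. Qed.

Lemma content_children E w :
  content E w <= content E (true :: w) + content E (false :: w).
Proof.
rewrite -lerBlDr; apply: content_ge => g1 [g10 gg1] w1.
rewrite lerBlDr -lerBlDl; apply: content_ge => g0 [g00 gg0] w0.
rewrite lerBlDl.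
pose g x := if suffix (true :: w) x then g1 x else
  if suffix (false :: w) x then g0 x else
  if x == w then g1 (true :: w) + g0 (false :: w) else 0.
have -> : g1 (true :: w) + g0 (false :: w) = g w by rewrite /g !suffix_root eqxx.
apply: content_le.
  split=> [x|v]; first by rewrite /g; do 3?case: ifP => // _; rewrite addr_ge0.
  case/lastP: v => [|v b].
    by rewrite /g /= !(suffix_child _ _ [::]) !suffix_root /= eqxx.
  rewrite cat_rcons /g -!(cat_cons _ v) !suffix_child !cat_cons.
  by case: b => /=; [have := gg1 v|have := gg0 v].
move=> c Ec cw; have cw' : pre c (size w).+1 = c (size w) :: w by rewrite /= cw.
have mem n : suffix (c (size w) :: w) (pre c ((size w).+1 + n)).
  by have [v [_ ->]] := preD c (size w).+1 n; rewrite cw' suffix_suffix.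
have memN n b : b != c (size w) -> suffix (b :: w) (pre c ((size w).+1 + n)) = false.
  have [v' [_ ->]] := preD c (size w).+1 n.
  by rewrite cw' suffix_child => /negbTE.
case: (boolP (c (size w))) => cb.
  have [|n hn] := w1 c Ec _; first by rewrite /= cw cb.
  by exists n.+1; rewrite addnS -addSn /g; move: (mem n); rewrite cb => ->.
have [|n hn] := w0 c Ec _; first by rewrite /= cw (negbTE cb).
exists n.+1; rewrite addnS -addSn /g.
by move: (mem n) (memN n true); rewrite (negbTE cb) => -> ->.
Qed.

Let gale_child w g b : gale w g -> gale (b :: w) g.
Proof. by case=> g0 gg; split=> // v; rewrite -cat_rcons -!cat_cons gg. Qed.

(** A gale below [psi] at w cannot win at w itself, so every win happens strictly below and the same
    gale serves both children. *)
Lemma content_split E w g : gale w g -> wins w g E -> g w < psi (size w) ->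
  content E (true :: w) + content E (false :: w) <= g w.
Proof.
move=> gg wg lt; apply: (le_trans _ (gg.2 [::])) => /=.
have wchild b : wins (b :: w) g E.
  move=> c Ec /= [cb cw]; have [[|n]] := wg c Ec cw.
    by rewrite addn0 cw leNgt lt.
  by rewrite addnS => hn; exists n; rewrite addSn.
by apply: lerD; apply: content_le => //; exact: gale_child.
Qed.

(** Together with [content_children], content is exactly additive at every node where it is below
    its cap [psi]; there it behaves like a gale itself. *)
Lemma content_split_lt E w : content E w < psi (size w) ->
  content E (true :: w) + content E (false :: w) <= content E w.
Proof.
move=> lt; rewrite leNgt; apply/negP => lt'.
have : content E w < Order.min (psi (size w))
    (content E (true :: w) + content E (false :: w)) by rewrite lt_min lt.
move=> /content_lt[g [gg wg]]; rewrite lt_min => /andP[g1].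
by rewrite ltNge content_split.
Qed.

Lemma content_setU E E' : content (E `|` E') [::] <= content E [::] + content E' [::].
Proof.
rewrite -lerBlDr; apply: content_ge => g1 [g10 gg1] w1.
rewrite lerBlDr -lerBlDl; apply: content_ge => g0 [g00 gg0] w0.
rewrite lerBlDl.
apply: (@content_le _ [::] (fun x => g1 x + g0 x)).
  split=> [x|v]; first by rewrite addr_ge0.
  by rewrite addrACA lerD.
move=> c [Ec|Ec] cw; [have [n hn] := w1 c Ec cw|have [n hn] := w0 c Ec cw];
  exists n; apply: (le_trans hn); by rewrite ?lerDl ?lerDr.
Qed.

(* Running a near-optimal gale until it first wins and then restarting shows
   content E <= theta * content E at the root. *)
Lemma content_contraction E theta : 0 < theta -> theta < 1 ->
  (forall w, (exists2 c, E c & pre c (size w) = w) ->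
     content E w < theta * psi (size w)) ->
  content E [::] = 0.
Proof.
move=> th0 th1 small.
suff le : content E [::] <= theta * content E [::].
  apply/eqP; rewrite eq_le content_ge0 andbT.
  have := content_ge0 E [::]; set a := content _ _ in le *; move=> a0.
  by rewrite leNgt; apply/negP => a0'; move: le; rewrite leNgt => /negP; apply; nra.
rewrite -ler_pdivrMl//; apply: content_ge => g [g0 gg] wg.
rewrite ler_pdivrMl//.
have /choice[h hP] : forall w, exists h, [/\ gale w h, wins w h E &
    h w <= theta * psi (size w)].
  move=> w; have [hit|miss] := pselect (exists2 c, E c & pre c (size w) = w).
    have [h [gh wh hw]] := content_lt (small _ hit).
    by exists h; split=> //; exact: ltW.
  exists (fun=> 0); split.
  - by split=> // v; rewrite addr0.
  - by move=> c Ec cw; case: miss; exists c.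
  - by rewrite mulr_ge0// ltW.
pose P x := psi (size x) <= g x.
(* The value [theta * g y] at a stopping node may exceed [h y y]. This is harmless: superadditivity
   at y only needs [h y y <= theta * psi <= theta * g y]. *)
pose f x := if first P x is Some y then
  (if x == y then theta * g y else h y x) else theta * g x.
have -> : theta * g [::] = f [::].
  by rewrite /f; case E1 : (first P [::]) => [y|//]; have [_ [[|//] /= <-]] := first_some E1.
apply: content_le.
  split=> [x|v].
    rewrite /f; case: first => [y|]; last by rewrite mulr_ge0// ltW.
    by case: ifP => _; [rewrite mulr_ge0// ltW|case: (hP y) => -[]].
  rewrite cats0 /f /=.
  case E1 : (first P v) => [y|]; last first.
    have e b : (if (if P (b :: v) then Some (b :: v) else None) is Some y then
       (if b :: v == y then theta * g y else h y (b :: v)) else theta * g (b :: v))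
      = theta * g (b :: v) by case: ifP => //; rewrite eqxx.
    by rewrite !e -mulrDr ler_wpM2l ?(ltW th0)//; have := gg v; rewrite cats0.
  have [Py [v' vE]] := first_some E1; have [[hy0 ghy] _ hy] := hP y.
  have ney b : (b :: v == y) = false.
    by apply/eqP => /(congr1 size); rewrite vE /= size_cat; lia.
  rewrite !ney; have gv := ghy v'; rewrite -vE in gv.
  case: eqP => vy; last exact: gv.
  apply: (le_trans gv); rewrite vy; apply: (le_trans hy).
  by rewrite ler_wpM2l// ltW.
move=> c Ec _; have [n hn] := wg c Ec erefl; rewrite /= add0n in hn.
case E1 : (first P (pre c n)) => [y|]; last first.
  by have := first_none E1; rewrite /P size_pre hn.
have [Py [v vE]] := first_some E1; have [[hy0 ghy] why hy] := hP y.
have cy := pre_suffix vE; have [n' hn'] := why c Ec (esym cy).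
exists (size y + n')%N; rewrite /= add0n; apply: (le_trans hn').
have [u [su uE]] := preD c (size y) n'; rewrite uE -cy.
rewrite /f (first_cat _ (first_self E1)); case: eqP => // uy.
by rewrite uy; apply: (le_trans hy); rewrite ler_wpM2l// ltW.
Qed.

Let gale_le_root g v : gale [::] g -> g v <= g [::].
Proof.
move=> [g0 gg]; elim: v => // b v IH; apply: le_trans IH.
have := gg v; rewrite cats0; apply: le_trans.
by case: b; rewrite ?lerDl ?lerDr.
Qed.

Lemma content_bigcup0 (E : nat -> set (nat -> bool)) :
  (forall j, content (E j) [::] = 0) -> content (\bigcup_j E j) [::] = 0.
Proof.
move=> E0; apply/eqP; rewrite eq_le content_ge0 andbT.
apply/ler_addgt0Pr => e e0; rewrite add0r.
have /choice[g gP] : forall j, exists g, [/\ gale [::] g, wins [::] g (E j) &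
    g [::] < e / 2 ^+ j.+1].
  by move=> j; apply: content_lt; rewrite E0 divr_gt0// exprn_gt0.
pose S n x := \sum_(j < n) g j x.
have g0 j x : 0 <= g j x by case: (gP j) => -[].
have Sle n x : S n x <= e.
  suff : S n x <= e - e / 2 ^+ n by move/le_trans; apply; rewrite gerBl divr_ge0// ?ltW// exprn_ge0.
  elim: n => [|n IH]; first by rewrite /S big_ord0 expr0 divr1 subrr.
  rewrite /S big_ord_recr /= -/(S n x); have [gg _ glt] := gP n.
  apply: (le_trans (lerD IH (le_trans (gale_le_root x gg) (ltW glt)))).
  by rewrite exprS invfM; lra.
have Smon n m x : (n <= m)%N -> S n x <= S m x.
  move=> /subnK <-; elim: (m - n)%N => // k IH; rewrite addSn.
  by apply: (le_trans IH); rewrite /S big_ord_recr /= lerDl.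
(* The sum of all the gales, as a supremum of partial sums. Superadditivity survives because [S n]
   increases with n, so that partial sums at the two children can be compared at a common index. *)
pose G x := sup (range (S ^~ x)).
have hs x : has_sup (range (S ^~ x)).
  by split; [exists (S 0%N x), 0%N|exists e => _ [n _ <-]].
have SG n x : S n x <= G x by apply: (ub_le_sup (hs x).2); exists n.
apply: (@le_trans _ _ (G [::])); last by apply: ge_sup => [|_ [n _ <-]//]; exact: (hs _).1.
apply: content_le.
  split=> [x|v]; first by apply: le_trans (SG 0%N x); rewrite /S big_ord0.
  rewrite cats0 -lerBrDr; apply: ge_sup => [|_ [n _ <-]]; first exact: (hs _).1.
  rewrite lerBrDl -lerBrDr; apply: ge_sup => [|_ [m _ <-]]; first exact: (hs _).1.
  rewrite lerBrDl addrC addrC; apply: le_trans (SG (maxn m n) v).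
  apply: (le_trans (lerD (Smon _ (maxn m n) _ _) (Smon _ (maxn m n) _ _))).
  - by rewrite leq_maxr.
  - by rewrite leq_maxl.
  rewrite /S -big_split /=; apply: ler_sum => j _; have [[_ gg] _ _] := gP j.
  by have := gg v; rewrite cats0.
move=> c [j _ Ec] cw; have [_ wj _] := gP j; have [n hn] := wj c Ec cw.
exists n; apply: (le_trans hn); apply: le_trans (SG j.+1 _).
by rewrite /S big_ord_recr /= lerDr sumr_ge0.
Qed.

(* Below the first nodes where the limit content reaches theta * psi nothing is
   left to do; the points that never meet such a node form a set of content 0. *)
Lemma content_bigcup (E : nat -> set (nat -> bool)) a :
  (forall i j, (i <= j)%N -> E i `<=` E j) ->
  (forall j, content (E j) [::] <= a) -> content (\bigcup_j E j) [::] <= a.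
Proof.
move=> Emon Ea; set U := \bigcup_j E j.
have a0 : 0 <= a := le_trans (content_ge0 (E 0%N) [::]) (Ea 0%N).
suff main theta : 0 < theta -> theta < 1 -> content U [::] <= a / theta.
  rewrite leNgt; apply/negP => aU.
  have U0 : 0 < content U [::] by apply: le_lt_trans aU.
  pose t := (a / content U [::] + 1) / 2.
  have aU1 : a / content U [::] < 1 by rewrite ltr_pdivrMr// mul1r.
  have aU0 : 0 <= a / content U [::] by rewrite divr_ge0// ltW.
  have t0 : 0 < t by rewrite /t; lra.
  have t1 : t < 1 by rewrite /t; lra.
  have := main t t0 t1; rewrite ler_pdivlMr// mulrC -ler_pdivlMr// leNgt => /negP; apply.
  by rewrite /t; lra.
move=> th0 th1.
pose g x := sup (range (fun j => content (E j) x)).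
have hs x : has_sup (range (fun j => content (E j) x)).
  by split; [exists (content (E 0%N) x), 0%N|exists (psi (size x)) => _ [n _ <-]; exact: content_le_psi].
have cg j x : content (E j) x <= g x by apply: (ub_le_sup (hs x).2); exists j.
have g0 x : 0 <= g x := le_trans (content_ge0 _ _) (cg 0%N x).
have gsplit x : g x < psi (size x) -> g (true :: x) + g (false :: x) <= g x.
  move=> lt; rewrite -lerBrDr; apply: ge_sup => [|_ [n _ <-]]; first exact: (hs _).1.
  rewrite lerBrDl -lerBrDr; apply: ge_sup => [|_ [m _ <-]]; first exact: (hs _).1.
  rewrite lerBrDl addrC addrC; apply: le_trans (cg (maxn m n) x).
  apply: le_trans (content_split_lt (le_lt_trans (cg _ _) lt)).
  by rewrite lerD// content_sub//; apply: Emon; rewrite ?leq_maxl ?leq_maxr.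
pose P x := theta * psi (size x) <= g x.
(* Before stopping, [g < theta * psi < psi], so [gsplit] applies; at the stopping node [g / theta]
   is at least [psi], so G wins there. The slack theta is needed because the supremum g may approach
   [psi] without any single content reaching it. *)
pose G x := if first P x is Some y then (if x == y then g x / theta else 0) else g x / theta.
have gt0 x : 0 <= g x / theta by rewrite divr_ge0// ltW.
have gG : gale [::] G.
  split=> [x|v]; first by rewrite /G; case: first => // y; case: ifP.
  rewrite cats0 /G /=; case E1 : (first P v) => [y|].
    have [Py [v' vE]] := first_some E1.
    have ney b : (b :: v == y) = false.
      by apply/eqP => /(congr1 size); rewrite vE /= size_cat; lia.
    by rewrite !ney addr0; case: ifP.
  have e b : (if (if P (b :: v) then Some (b :: v) else None) is Some y then
       (if b :: v == y then g (b :: v) / theta else 0) else g (b :: v) / theta)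
      = g (b :: v) / theta by case: ifP => //; rewrite eqxx.
  rewrite !e -mulrDl ler_wpM2r ?invr_ge0 ?(ltW th0)//; apply: gsplit.
  have /negbT := first_none E1; rewrite -ltNge => /lt_trans; apply.
  by rewrite gtr_pMl.
pose A' := [set c | forall n, g (pre c n) < theta * psi n].
have A'0 : content (U `&` A') [::] = 0.
  rewrite setI_bigcupl; apply: content_bigcup0 => j.
  apply: (content_contraction th0 th1) => w [c [Ec A'c] cw].
  apply: le_lt_trans (_ : g w < _); last by rewrite -{1}cw.
  by apply: le_trans (cg j w); apply: content_sub; exact: subIsetl.
have -> : U = (U `&` A') `|` (U `\` A') by rewrite setUIDK.
apply: (le_trans (content_setU _ _)); rewrite A'0 add0r.
apply: (@le_trans _ _ (G [::])); last first.
  apply: (@le_trans _ _ (g [::] / theta)).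
    by rewrite /G; case: first => // y; case: ifP.
  rewrite ler_wpM2r ?invr_ge0 ?(ltW th0)//.
  by apply: ge_sup => [|_ [n _ <-]//]; exact: (hs _).1.
apply: content_le => // c [Uc /existsNP[n /negP]]; rewrite -leNgt => hn _.
case E1 : (first P (pre c n)) => [y|]; last first.
  by have := first_none E1; rewrite /P size_pre hn.
have [Py [v vE]] := first_some E1; exists (size y); rewrite /= add0n.
rewrite -(pre_suffix vE) /G (first_self E1) eqxx.
by rewrite ler_pdivlMr// mulrC.
Qed.

End Gale.

(** * Analytic sets and Frostman measures on Cantor space *)

(** A diagonal form of compactness: the m-th approximant is confined to the finite sets [cand] only
    below index m, which is all that successive counterexamples provide. *)
Lemma konig (T : eqType) (z : nat -> nat -> T) (cand : nat -> seq T) :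
  (forall m i, (i < m)%N -> z m i \in cand i) ->
  exists y, forall n M, exists2 m, (M <= m)%N & forall i, (i < n)%N -> z m i = y i.
Proof.
move=> zc; pose x0 := z 0%N 0%N.
pose Inf s := forall M, exists2 m, (M <= m)%N &
  forall i, (i < size s)%N -> z m i = nth x0 s i.
have ext s : Inf s -> exists a, Inf (rcons s a).
  move=> Infs; apply: contrapT => /forallNP nex.
  have /choice[B HB] : forall a, exists B, forall m, (B <= m)%N ->
      exists2 i, (i < size (rcons s a))%N & z m i <> nth x0 (rcons s a) i.
    move=> a; have /existsNP[B HB] := nex a; exists B => m Bm.
    apply: contrapT => h; apply: HB; exists m => // i isz; apply: contrapT => zi.
    by apply: h; exists i.
  have [m mB mz] := Infs (maxn (size s).+1 (\max_(a <- cand (size s)) B a)).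
  have cm : z m (size s) \in cand (size s) by apply: zc; apply: leq_trans mB; exact: leq_maxl.
  have [|i] := HB (z m (size s)) m.
    apply: leq_trans mB; rewrite leq_max; apply/orP; right.
    by rewrite (big_rem (z m (size s)))//= leq_maxl.
  rewrite size_rcons ltnS leq_eqVlt => /orP[/eqP ->|ilt]; rewrite nth_rcons.
    by rewrite ltnn eqxx.
  by rewrite ilt; rewrite mz.
have /choice[st stP] : forall s, exists a, Inf s -> Inf (rcons s a).
  move=> s; have [/ext[a ha]|h] := pselect (Inf s); first by exists a.
  by exists x0.
pose S := fix S n := if n is n'.+1 then rcons (S n') (st (S n')) else [::].
have sS n : size (S n) = n by elim: n => //= n IH; rewrite size_rcons IH.
have IS n : Inf (S n).
  elim: n => [|n IH] /=; last exact: stP.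
  by move=> M; exists M.
have nS n i : (i < n)%N -> nth x0 (S n) i = st (S i).
  elim: n => // n IH; rewrite ltnS /= nth_rcons sS leq_eqVlt => /orP[/eqP ->|lt].
    by rewrite ltnn eqxx.
  by rewrite lt IH.
exists (fun i => st (S i)) => n M; have [m Mm h] := IS n M; exists m => // i ni.
by rewrite h ?sS// nS.
Qed.

Lemma le_mem_iota k n : (k <= n)%N -> k \in iota 0 n.+1.
Proof. by rewrite mem_iota add0n ltnS. Qed.

(** F is closed in the product of Cantor space and Baire space; analytic sets are taken as
    projections of such F along s. *)
Definition closed_rel (F : (nat -> bool) -> (nat -> nat) -> Prop) :=
  forall c s, (forall n, exists c' s',
    (forall i, (i < n)%N -> c' i = c i /\ s' i = s i) /\ F c' s') -> F c s.

Definition cantor_analytic (E : set (nat -> bool)) :=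
  exists2 F, closed_rel F & E = [set c | exists s, F c s].

Definition cantor_closed (K : set (nat -> bool)) :=
  forall c, (forall n, exists2 c', K c' & pre c' n = pre c n) -> K c.

Definition cantor_open (U : set (nat -> bool)) :=
  forall c, U c -> exists n, forall c', pre c' n = pre c n -> U c'.

Lemma closed_rel_bounded F (b : nat -> nat) : closed_rel F ->
  cantor_closed [set c | exists2 s, (forall i, s i <= b i)%N & F c s].
Proof.
move=> Fcl c cK.
have /choice[cc /choice[ss H]] : forall n, exists c', exists s', [/\ pre c' n = pre c n,
    (forall i, s' i <= b i)%N & F c' s'].
  by move=> n; have [c' [s' sb Fs] e] := cK n; exists c', s'.
have [|y yP] := @konig _ ss (fun i => iota 0 (b i).+1).
  by move=> m i _; apply: le_mem_iota; have [] := H m.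
exists y.
  by move=> i; have [m _ h] := yP i.+1 0%N; rewrite -h//; have [] := H m.
apply: Fcl => n; have [m nm h] := yP n n; have [e _ Fm] := H m.
exists (cc m), (ss m); split=> // i ni; split; last exact: h.
exact: (pre_eq e (leq_trans ni nm)).
Qed.

(** The sets in which only the first n coordinates of s are bounded decrease to a compact set but
    need not be compact. Still, counterexamples for each n would have a limit point, which satisfies
    all the bounds. *)
Lemma closed_rel_compact F (b : nat -> nat) U : closed_rel F -> cantor_open U ->
  [set c | exists2 s, (forall i, s i <= b i)%N & F c s] `<=` U ->
  exists n, [set c | exists2 s, (forall i, i < n -> s i <= b i)%N & F c s] `<=` U.
Proof.
move=> Fcl Uop KU; apply: contrapT => /forallNP nsub.
have /choice[cc /choice[ss H]] : forall n, exists c, exists s,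
    [/\ (forall i, i < n -> s i <= b i)%N, F c s & ~ U c].
  move=> n; have /existsNP[c] := nsub n.
  by move=> /not_implyP[[s sb Fc] Uc]; exists c, s.
have [|y yP] := @konig _ (fun m i => (cc m i, ss m i))
    (fun i => [seq (x, k) | x <- [:: true; false], k <- iota 0 (b i).+1]).
  move=> m i im; apply/allpairsP; exists (cc m i, ss m i); split => //=.
    by case: (cc m i).
  by apply: le_mem_iota; have [h _ _] := H m; exact: h.
pose c i := (y i).1; pose s i := (y i).2.
have Uc : U c.
  apply: KU; exists s.
    move=> i; have [m im h] := yP i.+1 i.+1; rewrite /s -h//=.
    by have [hb _ _] := H m; apply: hb.
  apply: Fcl => n; have [m nm h] := yP n n; have [_ Fm _] := H m.
  by exists (cc m), (ss m); split=> // i ni; rewrite /c /s -h.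
have [n cU] := Uop c Uc; have [m nm h] := yP n n; have [_ _] := H m; apply.
by apply: cU; apply: eq_pre => i ni; rewrite /c -h.
Qed.

Section Frostman.
Variables (R : realType) (psi : nat -> R).
Hypothesis psi_gt0 : forall n, 0 < psi n.

(** Choquet's argument. Bounds for the coordinates of the witness s are fixed one at a time, each
    keeping the content above a by [content_bigcup]. A gale winning on the resulting compact set
    wins on an open set around it, hence on some [A (S n)], and so starts above a. *)
Lemma analytic_capacitable E : cantor_analytic E -> 0 < content psi E [::] ->
  exists K, [/\ K `<=` E, cantor_closed K & 0 < content psi K [::]].
Proof.
move=> [F Fcl ->] E0; set E' := [set c | _] in E0 *.
pose a := content psi E' [::] / 2.
have a0 : 0 < a by rewrite divr_gt0.
pose A l := [set c | exists2 s, (forall i, i < size l -> s i <= nth 0 l i)%N & F c s].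
have ext l : a < content psi (A l) [::] -> exists k, a < content psi (A (rcons l k)) [::].
  move=> aA; apply: contrapT => /forallNP h; move: aA; rewrite ltNge => /negP; apply.
  have -> : A l = \bigcup_k A (rcons l k).
    apply/seteqP; split => [c [s sl Fs]|c [k _ [s sl Fs]]]; last first.
      by exists s => // i il; have := sl i; rewrite size_rcons nth_rcons il; apply; exact: ltnW.
    exists (s (size l)) => //; exists s => // i.
    rewrite size_rcons ltnS leq_eqVlt nth_rcons => /orP[/eqP ->|il].
      by rewrite ltnn eqxx.
    by rewrite il sl.
  apply: content_bigcup => // [i j ij c [s sl Fs]|j]; last first.
    by rewrite leNgt; apply/negP/h.
  exists s => // k; rewrite size_rcons => kl; have := sl k; rewrite size_rcons => /(_ kl).
  rewrite !nth_rcons; case: ifP => // _; case: ifP => // _ /leq_trans; exact.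
have /choice[st stP] : forall l, exists k,
    a < content psi (A l) [::] -> a < content psi (A (rcons l k)) [::].
  move=> l; have [/ext[k hk]|h] := pselect (a < content psi (A l) [::]); first by exists k.
  by exists 0%N.
pose S := fix S n := if n is n'.+1 then rcons (S n') (st (S n')) else [::].
have sS n : size (S n) = n by elim: n => //= n IH; rewrite size_rcons IH.
have nS n i : (i < n)%N -> nth 0%N (S n) i = st (S i).
  elim: n => // n IH; rewrite ltnS /= nth_rcons sS leq_eqVlt => /orP[/eqP ->|lt].
    by rewrite ltnn eqxx.
  by rewrite lt IH.
have aS n : a < content psi (A (S n)) [::].
  elim: n => [|n IH] /=; last exact: stP.
  have -> : A [::] = E' by apply/seteqP; split=> c [s]; [move=> _ Fs; exists s|exists s].
  by rewrite /a ltr_pdivrMr// mulr_natr mulr2n ltrDl.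
pose b i := st (S i).
exists [set c | exists2 s, (forall i, s i <= b i)%N & F c s]; split.
- by move=> c [s _ Fs]; exists s.
- exact: closed_rel_bounded.
apply: (lt_le_trans a0); apply: content_ge => // g gg wg.
have [||n An] := @closed_rel_compact F b [set c | exists n, psi n <= g (pre c n)] Fcl.
- by move=> c [n cn]; exists n => c' e; exists n; rewrite e.
- by move=> c /wg /(_ erefl)[n]; rewrite /= add0n => h; exists n.
apply: (le_trans (ltW (aS n))); apply: content_le => // c [s sl Fs] _.
have [|k hk] := An c; last by exists k.
by exists s => // i ni; rewrite /b -(nS n)// sl// sS.
Qed.

(* The mass of each node is split between its children in proportion to their
   contents, which keeps the mass of a node below its content; the mass is then
   laid out as nested subintervals of the real line. *)
Lemma frostman_closed K : cantor_closed K -> 0 < content psi K [::] ->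
  exists M (p : R -> nat -> bool), [/\ 0 < M,
    forall u, 0 <= u < M -> K (p u),
    forall n w, measurable [set u : R | pre (p u) n = w] &
    forall w, exists2 x, 0 <= x <= psi (size w) & exists y,
     [set u | 0 <= u < M /\ pre (p u) (size w) = w] `<=` `[y, y + x]].
Proof.
move=> Kcl K0; pose m := content psi K.
pose f := fix f w := if w is b :: w' then
  f w' * (m (b :: w') / (m (true :: w') + m (false :: w'))) else m [::].
pose a := fix a w := if w is b :: w' then
  a w' + (if b then f (false :: w') else 0) else 0.
have m0 w : 0 <= m w by exact: content_ge0.
have f0 w : 0 <= f w by elim: w => //= b w IH; rewrite mulr_ge0// divr_ge0// addr_ge0.
have mm w := content_children psi_gt0 K w.
have fm w : f w <= m w.
  elim: w => //= b w IH; set S := m (true :: w) + m (false :: w).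
  have [S0|S0] := leP S 0.
    have S00 : S = 0 by apply/eqP; rewrite eq_le S0 addr_ge0.
    by rewrite S00 invr0 !mulr0.
  rewrite mulrA ler_pdivrMr// mulrC ler_wpM2l//; apply: (le_trans IH); exact: mm.
have fS w : f (true :: w) + f (false :: w) = f w.
  rewrite /= -mulrDr -mulrDl; set S := m (true :: w) + m (false :: w).
  (* Here division by 0 gives both children mass 0. No mass is lost, because the mass of w is at
     most its content, which is then 0. *)
  have [S0|S0] := eqVneq S 0; last by rewrite divff// mulr1.
  rewrite S0 mul0r mulr0; apply/esym/eqP; rewrite eq_le f0 andbT.
  by apply: (le_trans (fm w)); have := mm w; rewrite -/(m _) -/(m _) -/S S0.
(* [q u n] follows the half-open intervals [[a w, a w + f w)] containing u; the false child takes
   the left part of its parent's interval. *)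
pose q := fix q (u : R) n := if n is n'.+1 then
  (a (q u n') + f (false :: q u n') <= u) :: q u n' else [::] : seq bool.
pose p (u : R) i := a (q u i) + f (false :: q u i) <= u.
have pq u n : pre (p u) n = q u n by elim: n => //= n ->.
have aq u n : 0 <= u < m [::] -> a (q u n) <= u < a (q u n) + f (q u n).
  move=> um; elim: n => [|n /andP[IH1 IH2]]; first by rewrite /= add0r.
  change (q u n.+1) with ((a (q u n) + f (false :: q u n) <= u) :: q u n).
  set w := q u n in IH1 IH2 *; have := fS w.
  change (a (?b :: w)) with (a w + (if b then f (false :: w) else 0)).
  by case: (leP (a w + f (false :: w)) u) => h e; apply/andP; split; lra.
exists (m [::]), p; split=> //.
- move=> u um; apply: Kcl => n; apply: contrapT => h.
  (* A node that misses K has content 0, hence an empty interval, which cannot contain u. *)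
  have : m (pre (p u) n) = 0.
    by apply: content_miss => // c Kc; rewrite size_pre => e; apply: h; exists c.
  have := aq u n um; have := fm (q u n); rewrite pq; lra.
- elim=> [|n IH] w.
    case: w => [|b w]; first by rewrite (_ : [set _ | _] = setT)//; apply/seteqP; split.
    by rewrite (_ : [set _ | _] = set0)//; apply/seteqP; split.
  case: w => [|b w]; first by rewrite (_ : [set _ | _] = set0)//; apply/seteqP; split.
  rewrite (_ : [set _ | _] = [set u : R | pre (p u) n = w] `&`
    (if b then `[a w + f (false :: w), +oo[%classic else `]-oo, a w + f (false :: w)[%classic)).
    by apply: measurableI; [exact: IH|case: b; exact: measurable_itv].
  apply/seteqP; split => u /=.
    case=> pb pw; split=> //; rewrite /p -pq pw in pb.
    case: b pb => /= pb; rewrite in_itv/= ?andbT ?pb//.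
    by rewrite ltNge pb.
  case=> pw hb; rewrite pw /p -pq pw; congr cons.
  case: b hb => /=; rewrite in_itv/= ?andbT => h; first by rewrite h.
  by apply/negbTE; rewrite -ltNge.
- move=> w; exists (f w).
    by rewrite f0/= (le_trans (fm w))// content_le_psi.
  exists (a w) => u [um pw]; rewrite /= in_itv/=.
  by have := aq u (size w) um; rewrite -pq pw => /andP[-> /ltW].
Qed.

Lemma frostman_analytic E : cantor_analytic E -> 0 < content psi E [::] ->
  exists M (p : R -> nat -> bool), [/\ 0 < M,
    forall u, 0 <= u < M -> E (p u),
    forall n w, measurable [set u : R | pre (p u) n = w] &
    forall w, exists2 x, 0 <= x <= psi (size w) & exists y,
     [set u | 0 <= u < M /\ pre (p u) (size w) = w] `<=` `[y, y + x]].
Proof.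
move=> Ea E0; have [K [KE Kcl K0]] := analytic_capacitable Ea E0.
have [M [p [M0 pK pm pw]]] := frostman_closed Kcl K0.
by exists M, p; split=> // u /pK/KE.
Qed.

End Frostman.

(** The first entry of s guesses the length of a cylinder about c contained in U, which turns an
    open condition into a closed one. *)
Lemma analytic_open U : cantor_open U -> cantor_analytic U.
Proof.
move=> Uop; exists (fun c s => [set c' | pre c' (s 0%N) = pre c (s 0%N)] `<=` U).
  (* Agreement up to at least 1 is required so that [s' 0 = s 0] also when [s 0] is 0. *)
  move=> c s h; have [c' [s' [e F']]] := h (maxn (s 0%N) 1).
  have s0 : s' 0%N = s 0%N by apply: (e 0%N _).2; rewrite leq_max orbT.
  have cc : pre c' (s 0%N) = pre c (s 0%N).
    by apply: eq_pre => i im; apply: (e i _).1; rewrite leq_max im.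
  by move=> x /= xc; apply: F'; rewrite /= s0 xc cc.
apply/seteqP; split=> c /=; last by case=> s; apply.
by move=> /Uop[n hn]; exists (fun=> n) => c' /hn.
Qed.

Lemma analytic_closed U : cantor_open U -> cantor_analytic (~` U).
Proof.
move=> Uop; exists (fun c s => ~ U c).
  move=> c s h Uc; have [n hn] := Uop c Uc; have [c' [s' [e]]] := h n; apply.
  by apply: hn; apply: eq_pre => i im; apply: (e i _).1.
by apply/seteqP; split=> c /=; [exists (fun=> 0%N)|case].
Qed.

Lemma analytic_bigcup (E : nat -> set (nat -> bool)) :
  (forall j, cantor_analytic (E j)) -> cantor_analytic (\bigcup_j E j).
Proof.
move=> Ea; have /choice[F HF] : forall j, exists F, closed_rel F /\
    E j = [set c | exists s, F c s] by move=> j; have [F ? ?] := Ea j; exists F.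
exists (fun c s => F (s 0%N) c (fun i => s i.+1)).
  move=> c s h; apply: (HF (s 0%N)).1 => n; have [c' [s' [e F']]] := h n.+1.
  have s0 : s' 0%N = s 0%N by apply: (e 0%N _).2.
  exists c', (fun i => s' i.+1); rewrite -s0; split=> // i im; split.
    by apply: (e i _).1; exact: ltnW.
  by apply: (e i.+1 _).2.
apply/seteqP; split => [c [j _]|c [s Fs]].
  by rewrite (HF j).2 => -[s Fs]; exists (fun i => if i is i'.+1 then s i' else j).
by exists (s 0%N) => //; rewrite (HF _).2; exists (fun i => s i.+1).
Qed.

Lemma analytic_bigcap (E : nat -> set (nat -> bool)) :
  (forall j, cantor_analytic (E j)) -> cantor_analytic (\bigcap_j E j).
Proof.
move=> Ea; have /choice[F HF] : forall j, exists F, closed_rel F /\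
    E j = [set c | exists s, F c s] by move=> j; have [F ? ?] := Ea j; exists F.
exists (fun c s => forall j, F j c (fun i => s (pickle (j, i)))).
  move=> c s h j; apply: (HF j).1 => n.
  have [c' [s' [e F']]] := h (maxn n (\max_(i < n) (pickle (j, nat_of_ord i)).+1)).
  exists c', (fun i => s' (pickle (j, i))); split=> // i im; split.
    by apply: (e i _).1; rewrite leq_max im.
  apply: (e _ _).2; rewrite leq_max; apply/orP; right.
  exact: (@leq_bigmax _ (fun i : 'I_n => (pickle (j, nat_of_ord i)).+1) (Ordinal im)).
apply/seteqP; split => [c Ec|c [s Fs] j _]; last first.
  by rewrite (HF _).2; exists (fun i => s (pickle (j, i))).
have /choice[s sP] : forall j, exists s, F j c s.
  by move=> j; have := Ec j I; rewrite (HF j).2.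
exists (fun k => if unpickle k is Some ji then s ji.1 ji.2 else 0%N) => j.
rewrite (_ : (fun i => _) = s j)//; apply: funext => i.
by rewrite pickleK.
Qed.

(** * Binary digits and the coding of unit cubes *)

Section Binary.
Variable R : realType.
Implicit Types c : nat -> bool.

Definition bin_sum c n : R := \sum_(i < n) (c i)%:R / 2 ^+ i.+1.

Definition bin c : R := sup (range (bin_sum c)).

Fixpoint bin_nat c n := if n is n'.+1 then ((bin_nat c n').*2 + c n')%N else 0%N.

Lemma bin_sumE c n : bin_sum c n = (bin_nat c n)%:R / 2 ^+ n.
Proof.
elim: n => [|n IH]; first by rewrite /bin_sum big_ord0 mul0r.
rewrite /bin_sum big_ord_recr /= -/(bin_sum c n) IH natrD -mul2n natrM mulrDl.
by rewrite exprS; field; rewrite expf_neq0// pnatr_eq0.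
Qed.

Lemma bin_nat_inj c c' n : bin_nat c n = bin_nat c' n ->
  forall i, (i < n)%N -> c i = c' i.
Proof.
elim: n => //= n IH e; have eb : c n = c' n.
  by move: (congr1 odd e); rewrite !oddD !odd_double /= !oddb.
move=> i; rewrite ltnS leq_eqVlt => /orP[/eqP ->//|]; apply: IH.
by move: e; rewrite eb => /eqP; rewrite eqn_add2r => /eqP/double_inj.
Qed.

Lemma bin_sum_mono c n m : (n <= m)%N -> bin_sum c n <= bin_sum c m.
Proof.
move=> /subnK <-; elim: (m - n)%N => // k IH; rewrite addSn.
apply: (le_trans IH); rewrite /bin_sum big_ord_recr /= lerDl.
by rewrite divr_ge0// exprn_ge0.
Qed.

Lemma bin_sum_gap c n m : bin_sum c (n + m) + (2 ^+ (n + m))^-1 <= bin_sum c n + (2 ^+ n)^-1.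
Proof.
elim: m => [|m IH]; first by rewrite addn0.
rewrite addnS; apply: le_trans IH; rewrite /bin_sum big_ord_recr /= -addrA lerD2l.
rewrite exprS invfM; set x := (2 ^+ (n + m))^-1.
have : 0 <= x by rewrite invr_ge0 exprn_ge0.
by case: (c _) => /=; lra.
Qed.

Lemma bin_has_sup c : has_sup (range (bin_sum c)).
Proof.
split; first by exists (bin_sum c 0), 0%N.
exists (bin_sum c 0 + 1) => _ [n _ <-]; have := bin_sum_gap c 0 n.
rewrite add0n expr0 invr1; apply: le_trans.
by rewrite lerDl invr_ge0 exprn_ge0.
Qed.

Lemma bin_ge c n : bin_sum c n <= bin c.
Proof. by apply: (ub_le_sup (bin_has_sup c).2); exists n. Qed.

Lemma bin_le c n : bin c <= bin_sum c n + (2 ^+ n)^-1.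
Proof.
apply: ge_sup => [|_ [m _ <-]]; first exact: (bin_has_sup c).1.
have [nm|mn] := leqP n m.
  have := bin_sum_gap c n (m - n); rewrite subnKC//; apply: le_trans.
  by rewrite lerDl invr_ge0 exprn_ge0.
by apply: (le_trans (bin_sum_mono c (ltnW mn))); rewrite lerDl invr_ge0 exprn_ge0.
Qed.

Lemma bin_dist c c' n : (forall i, (i < n)%N -> c i = c' i) ->
  `|bin c - bin c'| <= (2 ^+ n)^-1.
Proof.
move=> e; have es : bin_sum c n = bin_sum c' n.
  by apply: eq_bigr => i _; rewrite e.
have := bin_ge c n; have := bin_le c n; have := bin_ge c' n; have := bin_le c' n.
by rewrite es ler_norml => *; apply/andP; split; lra.
Qed.

Lemma bin_surj (x : R) : 0 <= x <= 1 -> exists c, bin c = x.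
Proof.
(* The doubling map, with digit 1 as soon as y reaches 1/2. The endpoint 1 is a fixed point and gets
   all digits 1, so the closed interval is covered. *)
move=> x01; pose st (y : R) : R := 2 * y - ((2^-1 : R) <= y)%R%:R.
pose y n := iter n st x; pose c n := (2^-1 : R) <= y n; exists c.
have y01 n : 0 <= y n <= 1.
  elim: n => [|n /andP[y0 y1]]; first exact: x01.
  rewrite /y iterS -/(y n) /st.
  by case: (leP (2^-1 : R) (y n)) => /= h; apply/andP; split; lra.
have xE n : x = bin_sum c n + y n / 2 ^+ n.
  elim: n => [|n IH]; first by rewrite /bin_sum big_ord0 add0r expr0 divr1.
  have -> : y n.+1 = 2 * y n - (c n)%:R by [].
  rewrite /bin_sum big_ord_recr /= -/(bin_sum c n) {1}IH -addrA; congr (_ + _).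
  by rewrite exprS; field; rewrite expf_neq0// pnatr_eq0.
apply/eqP; rewrite eq_le; apply/andP; split.
  apply: ge_sup => [|_ [m _ <-]]; first exact: (bin_has_sup c).1.
  by rewrite [leRHS](xE m) lerDl divr_ge0// ?exprn_ge0//; case/andP: (y01 m).
rewrite leNgt; apply/negP => lt; pose d := x - bin c.
have d0 : 0 < d by rewrite subr_gt0.
have [n nP] : exists n, d^-1 < 2 ^+ n.
  exists (Num.bound d^-1); apply: (lt_le_trans (archi_boundP _)); first by rewrite invr_ge0 ltW.
  by rewrite -natrX ler_nat ltnW// ltn_expl.
have p0 : 0 < 2 ^+ n :> R by rewrite exprn_gt0.
have dn : (2 ^+ n)^-1 < d by rewrite -[d]invrK ltf_pV2 ?posrE ?invr_gt0.
have yn : y n / 2 ^+ n <= (2 ^+ n)^-1.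
  by rewrite ler_piMl ?invr_ge0 ?(ltW p0)//; case/andP: (y01 n).
have := bin_ge c n; have := xE n; rewrite /d in dn; lra.
Qed.

(* Each step of four bits refines both space coordinates once and time twice, so
   that cylinders of length 4 k are mapped to sets of parabolic diameter of order
   2^(-k). *)
Definition digits (i : 'I_3) c (j : nat) : bool :=
  if (i < 2)%N then c (4 * j + i)%N else c (4 * j./2 + 2 + odd j)%N.

Definition code_point (z : 'rV[R]_3) c : 'rV[R]_3 :=
  \row_i (z 0 i + bin (digits i c)).

(** How many binary digits of coordinate i are determined by the first 4 k bits of a code. *)
Definition code_prec (i : 'I_3) k := if (i < 2)%N then k else k.*2.

Lemma digits_lt (i : 'I_3) k j : (j < code_prec i k)%N ->
  forall c c', (forall l, (l < 4 * k)%N -> c l = c' l) -> digits i c j = digits i c' j.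
Proof.
rewrite /code_prec /digits => jk c c' e.
case: ifP jk => i2 jk; apply: e.
  by lia.
have := odd_double_half j; case: (odd j) => /=; lia.
Qed.

Lemma digits_pre k c c' : (forall (i : 'I_3) j, (j < code_prec i k)%N ->
  digits i c j = digits i c' j) -> pre c (4 * k) = pre c' (4 * k).
Proof.
move=> e; apply: eq_pre => l lk; have h := divn_eq l 4; have r4 := ltn_pmod l (isT : 0 < 4)%N.
set q := (l %/ 4)%N in h; set r := (l %% 4)%N in h r4.
have qk : (q < k)%N by rewrite /q ltn_divLR// mulnC.
case: r h r4 => [|[|[|[|//]]]] h _.
- have := e (@Ordinal 3 0 isT) q qk; rewrite /digits /= (_ : (4 * q + 0)%N = l)//; lia.
- have := e (@Ordinal 3 1 isT) q qk; rewrite /digits /= (_ : (4 * q + 1)%N = l)//; lia.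
- have := e (@Ordinal 3 2 isT) q.*2; rewrite /code_prec /= ltn_double => /(_ qk).
  by rewrite /digits /= doubleK odd_double /= (_ : (4 * q + 2 + 0)%N = l)//; lia.
- have := e (@Ordinal 3 2 isT) q.*2.+1; rewrite /code_prec /= => /(_ _).
  rewrite /digits /= uphalf_double odd_double /= (_ : (4 * q + 2 + 1)%N = l); last lia.
  by apply; rewrite -doubleS leq_double.
Qed.

Lemma code_point_dist z k c c' (i : 'I_3) : pre c (4 * k) = pre c' (4 * k) ->
  `|code_point z c 0 i - code_point z c' 0 i| <= (2 ^+ code_prec i k)^-1.
Proof.
move=> e; rewrite !mxE opprD addrACA subrr add0r; apply: bin_dist => j jk.
by apply: (digits_lt jk) => l; apply: pre_eq.
Qed.

Lemma code_point_surj (z p : 'rV[R]_3) :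
  (forall i, z 0 i <= p 0 i <= z 0 i + 1) -> exists c, code_point z c = p.
Proof.
move=> zp; have /choice[d dP] : forall i, exists d, bin d = p 0 i - z 0 i.
  by move=> i; apply: bin_surj; have /andP[? ?] := zp i; apply/andP; split; lra.
pose o (k : nat) : 'I_3 := inord k.
exists (fun l => match (l %% 4)%N with
  | 0%N => d (o 0%N) (l %/ 4)%N | 1%N => d (o 1%N) (l %/ 4)%N
  | 2%N => d (o 2%N) (l %/ 4).*2 | _ => d (o 2%N) (l %/ 4).*2.+1 end).
apply/rowP => i; rewrite mxE -[p 0 i](subrK (z 0 i)) addrC -dP; congr (bin _ + _).
apply: funext => j; rewrite /digits; have [i2|i2] := ltnP i 2.
  have m4 : (i %% 4 = i)%N by rewrite modn_small// (leq_trans i2).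
  rewrite mulnC modnMDl m4 divnMDl// divn_small ?addn0 ?(leq_trans i2)//.
  have -> : i = o i by apply: val_inj; rewrite /= inordK.
  rewrite [nat_of_ord (o _)]inordK//; case: i i2 {m4} => -[|[|[]]] //=.
have -> : i = o 2%N.
  by apply: val_inj; rewrite /= inordK//; move: (ltn_ord i) i2; lia.
have b4 : (2 + odd j < 4)%N by case: odd.
rewrite -addnA mulnC modnMDl divnMDl// modn_small// divn_small// addn0.
by have := odd_double_half j; case: odd => /= e; rewrite -[RHS]/(d _ _) -[in RHS]e.
Qed.

End Binary.

(** * Sets of positive Hausdorff dimension have codes of positive content *)

Definition hnull (R : realType) (T : Type) (d : T -> T -> R) (s : R) (A : set T) :=
  forall e : R, 0 < e -> exists B : nat -> set T,
    A `<=` \bigcup_k B k /\ (\sum_(k <oo) poweR (diam d (B k)) s < e%:E)%E.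

Section HNull.
Variables (R : realType) (T : Type) (d : T -> T -> R).
Implicit Types (A B : set T).

Lemma diam_ge0 B : (0 <= diam d B)%E.
Proof. by rewrite /diam le_max lexx. Qed.

Lemma diam_le B (r : R) : 0 <= r -> (forall p q, B p -> B q -> d p q <= r) ->
  (diam d B <= r%:E)%E.
Proof.
move=> r0 h; rewrite /diam ge_max lee_fin r0/=; apply: ge_ereal_sup.
by move=> _ [p Bp [q Bq <-]]; rewrite lee_fin h.
Qed.

Lemma le_diam B p q : B p -> B q -> ((d p q)%:E <= diam d B)%E.
Proof.
move=> Bp Bq; rewrite /diam le_max; apply/orP; right.
by apply: ereal_sup_ubound; exists p => //; exists q.
Qed.

Lemma poweR_diam_le B (r s : R) : 0 <= r -> 0 < s ->
  (forall p q, B p -> B q -> d p q <= r) -> (poweR (diam d B) s <= (r `^ s)%:E)%E.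
Proof.
move=> r0 s0 /(diam_le r0) h; rewrite -poweR_EFin.
by apply: (gt0_ler_poweR (ltW s0)) => //; rewrite in_itv /= leey andbT ?diam_ge0 ?lee_fin.
Qed.

Lemma hnull_sub s A B : A `<=` B -> hnull d s B -> hnull d s A.
Proof.
move=> AB nB e /nB[C [BC Ce]]; exists C; split=> //; exact: subset_trans BC.
Qed.

Lemma hnull_bigcup s (A : nat -> set T) : (forall i, hnull d s (A i)) ->
  hnull d s (\bigcup_i A i).
Proof.
move=> nA e e0; have /choice[B BP] : forall i, exists B : nat -> set T,
    A i `<=` \bigcup_k B k /\
    (\sum_(k <oo) poweR (diam d (B k)) s < (e / 2 / (2 ^ i.+1)%:R)%:E)%E.
  by move=> i; apply: nA; rewrite !divr_gt0// ltr0n expn_gt0.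
have := card_nat2; rewrite card_eq_sym => /card_set_bijP[f fb].
exists (fun k => B (f k).1 (f k).2); split.
  move=> x [i _ /(BP i).1[j _ Bx]].
  by have [_ _ /(_ (i, j) I)[k _ fk]] := fb; exists k => //; rewrite fk.
pose a i j := poweR (diam d (B i j)) s.
rewrite nneseries_esumT => [|k]; last exact: poweR_ge0.
rewrite -(@reindex_esum _ _ _ _ _ f (fun p => a p.1 p.2) fb).
have -> : [set: nat * nat] = [set: nat] `*`` (fun=> [set: nat]).
  by apply/seteqP; split.
rewrite -(@esum_esum _ _ _ _ _ a); last by move=> *; exact: poweR_ge0.
rewrite -nneseries_esumT; last by move=> i; apply: esum_ge0 => j _; exact: poweR_ge0.
apply: (@le_lt_trans _ _ (e / 2)%:E); last by rewrite lte_fin ltr_pdivrMr// mulr_natr mulr2n ltrDl.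
apply: le_trans (epsilon_trick0 _ _); last by rewrite divr_ge0// ltW.
apply: lee_nneseries => [i _ _|i _]; first by apply: esum_ge0 => j _; exact: poweR_ge0.
rewrite -nneseries_esumT; last by move=> j; exact: poweR_ge0.
by apply: ltW; have [] := BP i.
Qed.

End HNull.

(** Kraft's inequality for gales: first nodes form an antichain, and superadditivity pushes the
    values on an antichain up to v. The depth bound L makes this an induction on the height of the
    subtree. *)
Lemma gale_antichain (R : realType) (psi : nat -> R) (g : seq bool -> R) s L v :
  gale [::] g -> uniq s ->
  (forall w, w \in s -> first (fun x => psi (size x) <= g x) w = Some w) ->
  \sum_(w <- s | suffix v w && (size w <= size v + L)%N) g w <= g v.
Proof.
move=> [g0 gg] us sf; elim: L v => [|L IH] v; (have [vs|vs] := boolP (v \in s);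
  [have e w : w \in s -> suffix v w -> w = v by
    move=> ws /suffixP[u wE]; have := sf w ws; rewrite wE (first_cat _ (sf v vs)) => -[]
  |have ne w : w \in s -> suffix v w -> w != v by
    move=> ws _; apply: contraNneq vs => <-]).
- rewrite (bigID (pred1 v)) /= [X in _ + X]big1_seq => [|w]; last first.
    by case/andP=> /andP[/andP[vw _] wv] ws; rewrite (e w)// eqxx in wv.
  rewrite addr0 (eq_bigl (pred1 v)); last first.
    by move=> w /=; case: eqP => [->|]; rewrite ?andbF// suffix_refl leq_addr.
  by rewrite -big_filter (eq_big_seq (fun=> g v)); last first;
    [move=> w; rewrite mem_filter => /andP[/eqP->]|
     rewrite big_const_seq count_predT size_filter count_uniq_mem// vs /= addr0].
- rewrite big1_seq// => w /andP[/andP[vw sz] ws].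
  have := ne w ws vw; have /suffixP[u uE] := vw; move: sz; rewrite uE size_cat addn0.
  by case: u uE => [|b u] uE /=; [rewrite eqxx|rewrite ltnNge leq_addl].
- rewrite (bigID (pred1 v)) /= [X in _ + X]big1_seq => [|w]; last first.
    by case/andP=> /andP[/andP[vw _] wv] ws; rewrite (e w)// eqxx in wv.
  rewrite addr0 (eq_bigl (pred1 v)); last first.
    by move=> w /=; case: eqP => [->|]; rewrite ?andbF// suffix_refl leq_addr.
  by rewrite -big_filter (eq_big_seq (fun=> g v)); last first;
    [move=> w; rewrite mem_filter => /andP[/eqP->]|
     rewrite big_const_seq count_predT size_filter count_uniq_mem// vs /= addr0].
- have := gg v; rewrite cats0; apply: le_trans.
  apply: le_trans (lerD (IH (true :: v)) (IH (false :: v))).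
  rewrite big_seq_cond [X in X + _]big_seq_cond [X in _ + X]big_seq_cond.
  rewrite (bigID (suffix (true :: v))) /= lerD//.
    rewrite big_mkcond [X in _ <= X]big_mkcond; apply: ler_sum => w _.
    case: ifP => [/andP[/and3P[-> vw sz] ->]|_]; last by case: ifP.
    by rewrite addSnnS sz.
  rewrite big_mkcond [X in _ <= X]big_mkcond; apply: ler_sum => w _.
  case: ifP => [/andP[/and3P[ws vw sz] tw]|_]; last by case: ifP.
  rewrite ws addSnnS sz andbT ifT//; have := ne w ws vw; have /suffixP[u uE] := vw.
  move: tw; rewrite uE; case/lastP: u {uE} => [|u b]; first by rewrite eqxx.
  rewrite cat_rcons; case: b => [|_ _]; last exact: suffix_suffix.
  by rewrite suffix_suffix.
Qed.

Definition ord3 (k : nat) : 'I_3 := inord k.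

Section Coding.
Variable R : realType.
Local Notation pdist := (@parabolic_dist R 2).

Lemma ord3E (i : 'I_3) : [\/ i = ord3 0, i = ord3 1 | i = ord3 2].
Proof.
case: i => [[|[|[|//]]]] h; [apply: Or31|apply: Or32|apply: Or33];
  by apply: val_inj; rewrite /= inordK.
Qed.

Lemma sum3E (V : nmodType) (F : 'I_3 -> V) : \sum_i F i = F (ord3 0) + F (ord3 1) + F (ord3 2).
Proof.
rewrite !big_ord_recl big_ord0 addr0 addrA; congr (F _ + F _ + F _);
  by apply: val_inj; rewrite /= inordK.
Qed.

Lemma parabolic_normE (p : 'rV[R]_3) : parabolic_norm p =
  Num.sqrt (p 0 (ord3 0) ^+ 2 + p 0 (ord3 1) ^+ 2 + `|p 0 (ord3 2)|).
Proof.
rewrite /parabolic_norm 2!big_ord_recl big_ord0 addr0.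
by congr (Num.sqrt (p 0 _ ^+ 2 + p 0 _ ^+ 2 + `|p 0 _|));
  apply: val_inj; rewrite /= inordK.
Qed.

Lemma sqr_parabolic_norm (p : 'rV[R]_3) : parabolic_norm p ^+ 2 =
  p 0 (ord3 0) ^+ 2 + p 0 (ord3 1) ^+ 2 + `|p 0 (ord3 2)|.
Proof. by rewrite parabolic_normE sqr_sqrtr// !addr_ge0// sqr_ge0. Qed.

Lemma parabolic_norm_ge0 (p : 'rV[R]_3) : 0 <= parabolic_norm p.
Proof. by rewrite parabolic_normE sqrtr_ge0. Qed.

Lemma code_point_parabolic_dist z k c c' : pre c (4 * k) = pre c' (4 * k) ->
  pdist (code_point z c) (code_point z c') <= 2 * 2^-1 ^+ k.
Proof.
move=> e; rewrite -[leRHS]ger0_norm ?mulr_ge0 ?exprn_ge0 ?invr_ge0//.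
rewrite -sqrtr_sqr /parabolic_dist parabolic_normE ler_sqrt ?sqr_ge0//.
have hx (i : 'I_3) : (i < 2)%N -> (code_point z c - code_point z c') 0 i ^+ 2 <= (2^-1 ^+ k) ^+ 2.
  move=> i2; rewrite -real_normK ?num_real// ler_sqr ?nnegrE ?exprn_ge0 ?invr_ge0//.
  by have := code_point_dist z i e; rewrite /code_prec i2 exprVn !mxE.
have ht : `|(code_point z c - code_point z c') 0 (ord3 2)| <= (2^-1 ^+ k) ^+ 2.
  have := code_point_dist z (ord3 2) e.
  by rewrite /code_prec inordK//= -muln2 exprM -!exprVn !mxE.
have h0 := hx (ord3 0); have h1 := hx (ord3 1); rewrite !inordK// in h0 h1.
have := h0 isT; have := h1 isT; rewrite exprMn; have := sqr_ge0 ((2^-1 : R) ^+ k); lra.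
Qed.

(* Up to a constant factor, the diameter of a cylinder of length n to the power s. *)
Definition dim_weight (s : R) n : R := (2 `^ (- s)) ^+ (n %/ 4).

Lemma dim_weight_gt0 s n : 0 < dim_weight s n.
Proof. by rewrite exprn_gt0// powR_gt0. Qed.

Lemma half_powR s k : (2^-1 ^+ k : R) `^ s = (2 `^ (- s)) ^+ k.
Proof.
rewrite -[X in X `^ _]powR_mulrn ?invr_ge0// -powRrM mulrC powRrM powR_mulrn ?powR_ge0//.
by rewrite -powR_inv1// -powRrM mulN1r.
Qed.

Lemma hnull_code z s (A : set 'rV[R]_3) : 0 < s ->
  content (dim_weight s) [set c | A (code_point z c)] [::] = 0 ->
  hnull pdist s (A `&` range (code_point z)).
Proof.
move=> s0 c0 e e0; have w0 := dim_weight_gt0 s.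
have p0 : 0 < 2 `^ s :> R by rewrite powR_gt0.
have [g [[g0 gg] wg ge]] : exists g, [/\ gale [::] g,
    wins (dim_weight s) [::] g [set c | A (code_point z c)] & g [::] < e / 2 `^ s].
  by apply: (content_lt w0); rewrite c0 divr_gt0.
pose P x := dim_weight s (size x) <= g x.
(* Only the nodes where the gale wins for the first time contribute. All other words get the empty
   set, whose diameter 0 has power 0 because s > 0, so that the cover can be enumerated by [pickle]
   over all words. *)
pose cyl w := if first P w == Some w then
  [set code_point z c | c in [set c | pre c (size w) = w]] else set0.
exists (fun k => if pickle_inv k is Some w then cyl w else set0); split.
  move=> _ [/[swap] -[c _ <-] Ap]; have [n hn] := wg c Ap erefl; rewrite /= add0n in hn.
  case E1 : (first P (pre c n)) => [y|]; last first.
    by have := first_none E1; rewrite /P size_pre hn.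
  have [Py [v vE]] := first_some E1; exists (pickle y) => //.
  rewrite pickleK_inv /cyl (first_self E1) eqxx; exists c => //=.
  by rewrite -(pre_suffix vE).
pose t w := if first P w == Some w then g w else 0.
have t0 w : 0 <= t w by rewrite /t; case: ifP.
have h w : (poweR (diam pdist (cyl w)) s <= (2 `^ s * t w)%:E)%E.
  rewrite /cyl /t; case: ifP => [/eqP fw|_]; last first.
    apply: (@le_trans _ _ (0 `^ s)%:E); first by apply: poweR_diam_le.
    by rewrite powR0 ?mulr0// gt_eqF.
  have [Pw _] := first_some fw.
  apply: (@le_trans _ _ ((2 * 2^-1 ^+ (size w %/ 4)) `^ s)%:E).
    apply: poweR_diam_le => //.
    move=> _ _ [c cw <-] [c' cw' <-]; apply: code_point_parabolic_dist.
    apply: eq_pre => i ilt; apply: (pre_eq (n := size w)); first by rewrite cw cw'.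
    by apply: (leq_trans ilt); rewrite mulnC leq_divM.
  rewrite lee_fin powRM ?exprn_ge0 ?invr_ge0// ler_pM2l//.
  by apply: le_trans Pw; rewrite /P /dim_weight half_powR.
have pinf : (\sum_(0 <= k <oo) poweR (diam pdist
    (if pickle_inv k is Some w then cyl w else set0)) s <= (2 `^ s * g [::])%:E)%E.
  apply: lime_le; first by apply: is_cvg_nneseries => k _ _; exact: poweR_ge0.
  apply: nearW => N.
  apply: (@le_trans _ _ (\sum_(0 <= k < N) (2 `^ s * (if pickle_inv k is Some w then t w else 0))%:E)%E).
    apply: lee_sum => k _; case: pickle_inv => [w|]; first exact: h.
    rewrite mulr0; apply: (@le_trans _ _ (0 `^ s)%:E); first by apply: poweR_diam_le.
    by rewrite powR0// gt_eqF.
  rewrite sumEFin lee_fin -mulr_sumr ler_pM2l//.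
  set l := pmap (@pickle_inv (seq bool)) (index_iota 0 N).
  have -> : \sum_(0 <= k < N) (if pickle_inv k is Some w then t w else 0) = \sum_(w <- l) t w.
    rewrite /l; elim: (index_iota 0 N) => [|k r IH]; first by rewrite !big_nil.
    by rewrite big_cons IH /=; case: (pickle_inv k) => [w|] /=; rewrite ?big_cons ?add0r.
  pose l' := [seq w <- l | first P w == Some w].
  have -> : \sum_(w <- l) t w = \sum_(w <- l') g w by rewrite big_filter [RHS]big_mkcond.
  have ul : uniq l' by rewrite filter_uniq// (pmap_uniq (@pickle_invK _))// iota_uniq.
  have lf w : w \in l' -> first P w = Some w by rewrite mem_filter => /andP[/eqP].
  have := gale_antichain (\max_(w <- l') size w) [::] (conj g0 gg) ul lf.
  apply: le_trans; rewrite big_seq [leRHS]big_seq_cond le_eqVlt; apply/orP; left; apply/eqP.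
  apply: eq_bigl => w; case: (boolP (w \in l')) => //= wl; apply/esym.
  by rewrite suffix0s add0n; apply: leq_bigmax_seq.
apply: (le_lt_trans pinf); rewrite lte_fin mulrC.
by rewrite -ltr_pdivlMr.
Qed.

Lemma not_hnull_content s (A : set 'rV[R]_3) : 0 < s -> ~ hnull pdist s A ->
  exists z, 0 < content (dim_weight s) [set c | A (code_point z c)] [::].
Proof.
move=> s0 nA; apply: contrapT => /forallNP h; apply: nA.
pose zpt (z : int * int * int) : 'rV[R]_3 :=
  \row_i (if (i == 0 :> nat) then z.1.1%:~R else if (i == 1 :> nat)%N then z.1.2%:~R else z.2%:~R).
apply: (@hnull_sub _ _ _ _ _ (\bigcup_k if unpickle k is Some z then
    A `&` range (code_point (zpt z)) else set0)); last first.
  apply: hnull_bigcup => k; case: unpickle => [z|]; last first.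
    move=> e e0; exists (fun=> set0); split=> //.
    rewrite eseries0 ?lte_fin// => i _ _.
    apply/eqP; rewrite eq_le poweR_ge0 andbT.
    apply: (@le_trans _ _ (0 `^ s)%:E); first by apply: poweR_diam_le.
    by rewrite powR0// gt_eqF.
  apply: hnull_code => //; apply/eqP; rewrite eq_le content_ge0; last exact: dim_weight_gt0.
  by rewrite andbT leNgt; apply/negP/h.
move=> p Ap; pose fl i := Num.floor (p 0 i).
pose z := (fl (ord3 0), fl (ord3 1), fl (ord3 2)).
have [k kz] : exists k, unpickle k = Some z by exists (pickle z); rewrite pickleK.
exists k; first exact: I.
rewrite kz; split; first exact: Ap.
have [i|c cp] := @code_point_surj R (zpt z) p; last by exists c.
have -> : zpt z 0 i = (fl i)%:~R.
  by rewrite mxE; case: (ord3E i) => -> /=; rewrite inordK.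
by rewrite /fl floor_le_tmp /= ltW// -intrD1 lt_succ_floor.
Qed.

End Coding.

(** * Frostman measures on Borel subsets of parabolic space *)

Lemma exists_half_exp_lt (R : realType) (e : R) : 0 < e -> exists n, (2 ^+ n)^-1 < e.
Proof.
move=> e0; exists (Num.bound e^-1).
rewrite -[ltRHS]invrK ltf_pV2 ?posrE ?invr_gt0 ?exprn_gt0//.
apply: (lt_le_trans (archi_boundP _)); first by rewrite invr_ge0 ltW.
by rewrite -natrX ler_nat ltnW// ltn_expl.
Qed.

(** Analytic sets are not closed under complements, so the sigma-algebra used consists of the sets
    whose codes are analytic together with the codes of their complements. *)
Lemma borel_analytic (R : realType) (A : set 'rV[R]_3) (z : 'rV[R]_3) : borel_set A ->
  cantor_analytic [set c | A (code_point z c)].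
Proof.
pose codes (B : set 'rV[R]_3) := [set c | B (code_point z c)].
pose G := [set B : set 'rV[R]_3 |
  cantor_analytic (codes B) /\ cantor_analytic (codes (~` B))].
suff GA : <<s @open 'rV[R]_3 >> `<=` G by move=> /GA[].
apply: smallest_sub.
  split.
  - have cU : cantor_open set0 by [].
    by split; [exact: analytic_open|exact: analytic_closed cU].
  - by move=> B [GB GBc]; rewrite setTD; split=> //; rewrite setCK.
  - move=> B GB; split.
      have -> : codes (\bigcup_k B k) = \bigcup_k codes (B k) by [].
      by apply: analytic_bigcup => k; have [] := GB k.
    have -> : codes (~` \bigcup_k B k) = \bigcap_k codes (~` B k).
      by rewrite setC_bigcup.
    by apply: analytic_bigcap => k; have [] := GB k.
move=> U oU; suff cU : cantor_open (codes U).
  by split; [exact: analytic_open|exact: analytic_closed cU].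
move=> c Uc; have /nbhs_ballP[e /= e0 eU] := open_nbhs_nbhs (conj oU Uc).
have [n ne] := exists_half_exp_lt e0; exists (4 * n)%N => c' cc'; apply: eU.
split=> // i j; rewrite !ord1; rewrite -ball_normE /=.
apply: le_lt_trans ne; apply: (le_trans (code_point_dist z j (esym cc'))).
rewrite lef_pV2 ?posrE ?exprn_gt0// ler_eXn2l ?ltr1n// /code_prec.
by case: ifP => // _; rewrite -addnn leq_addr.
Qed.

Lemma measure_cover_le d (T : measurableType d) (R : realType)
    (mu : {measure set T -> \bar R}) (I : finType) (S : set T) (F : I -> set T) (x : R) :
  measurable S -> (forall i, measurable (F i)) -> (forall i, mu (F i) <= x%:E)%E ->
  S `<=` [set u | exists i, F i u] -> (mu S <= (#|I|%:R * x)%:E)%E.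
Proof.
move=> mS mF Fx SF; pose n := #|I|.
have [I0|I0] := posnP n.
  rewrite (_ : S = set0) ?measure0 ?[#|I|]I0 ?mul0r//.
  apply/seteqP; split=> // u /SF[i _]; have : (0 < n)%N by apply/card_gt0P; exists i.
  by rewrite I0.
pose F' k : set T := if insub k is Some j then F (enum_val (j : 'I_n)) else set0.
have F'E (j : 'I_n) : F' j = F (enum_val j) by rewrite /F' valK.
apply: (@le_trans _ _ (mu (\big[setU/set0]_(k < n) F' k))).
  apply: le_measure; rewrite ?inE//.
    by apply: bigsetU_measurable => j _; rewrite F'E.
  move=> u /SF[i Fi]; rewrite -bigcup_mkord; exists (enum_rank i) => /=; first exact: ltn_ord.
  by rewrite F'E enum_rankK.
apply: (le_trans (Boole_inequality mu _)) => [k kn|].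
  by rewrite (F'E (Ordinal kn)).
apply: (@le_trans _ _ (\sum_(k < n) x%:E)%E); first by apply: lee_sum => k _; rewrite F'E; exact: Fx.
by rewrite sumEFin sumr_const card_ord mulr_natl.
Qed.

Lemma measurable_set_ler d (T : measurableType d) (R : realType) (f g : T -> R) :
  measurable_fun setT f -> measurable_fun setT g -> measurable [set x | f x <= g x].
Proof.
move=> mf mg; rewrite -[X in measurable X]setTI.
by have /(_ measurableT [set true]) := measurable_fun_ler mf mg; apply.
Qed.

Section FrostmanMeasure.
Variable R : realType.

Lemma measurable_bin (q : R -> nat -> bool) :
  (forall j, measurable_fun [set: R] (fun u => q u j)) ->
  measurable_fun [set: R] (fun u => bin R (q u)).
Proof.
move=> mq; apply: (@measurable_fun_cvg _ _ _ _ (fun n u => bin_sum R (q u) n)) => [n|u _].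
  rewrite /bin_sum; apply: measurable_sum => j; apply: measurable_funM => //.
  have mb : measurable_fun [set: bool] (fun b => b%:R : R) by [].
  exact: (measurableT_comp mb (mq j)).
apply/cvgrPdist_le => e e0; have [N Ne] := exists_half_exp_lt e0.
near=> n; have Nn : (N <= n)%N by near: n; exact: nbhs_infty_ge.
have := bin_ge R (q u) n; have := bin_le R (q u) n => h1 h2.
rewrite ger0_norm ?subr_ge0//; apply: le_trans (ltW Ne).
have : (2 ^+ n : R)^-1 <= (2 ^+ N)^-1.
  by rewrite lef_pV2 ?posrE ?exprn_gt0// ler_eXn2l ?ltr1n.
lra.
Unshelve. all: by end_near. Qed.

Lemma bin_nat_dist (c c' : nat -> bool) n (r : R) : 0 <= r ->
  `|bin R c - bin R c'| <= r ->
  `|(bin_nat c n)%:R - (bin_nat c' n)%:R| <= r * 2 ^+ n + 1 :> R.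
Proof.
move=> r0; have p0 : 0 < 2 ^+ n :> R by rewrite exprn_gt0.
have hN b : (bin_nat b n)%:R <= bin R b * 2 ^+ n <= (bin_nat b n)%:R + 1.
  have := bin_ge R b n; have := bin_le R b n; rewrite bin_sumE => h1 h2.
  by rewrite -ler_pdivrMr// h2/= -ler_pdivlMr// mulrDl mul1r.
rewrite ler_norml => /andP[h5 h6]; have /andP[h1 h2] := hN c; have /andP[h3 h4] := hN c'.
have h5' := ler_wpM2r (ltW p0) h5; have h6' := ler_wpM2r (ltW p0) h6.
by rewrite ler_norml; apply/andP; split; lra.
Qed.

(** Here r is a radius in the maximum norm, not a parabolic one, and k is a free resolution: the
    first factors count the cylinders of length 4 k that meet the box, the last is the greatest mass
    of one of them. [frostman_boxes] chooses k. *)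
Lemma frostman_parabolic (A : set 'rV[R]_3) (s : R) : 0 < s -> borel_set A ->
  ~ hnull (@parabolic_dist R 2) s A ->
  exists (tau : {finite_measure set (measurableTypeR R) -> \bar R}) (phi : R -> 'rV[R]_3),
  [/\ (0 < tau setT)%E, forall u, A (phi u),
    forall i, measurable_fun setT (fun u => phi u 0 i),
    forall u v i, `|phi u 0 i - phi v 0 i| <= 1 &
    forall (p : 'rV[R]_3) (r : R) k, 0 <= r ->
      (tau [set u | forall i, (`|phi u 0 i - p 0 i| <= r)%R] <=
       ((4 * r * 2 ^+ k + 3) ^+ 2 * (4 * r * 2 ^+ k.*2 + 3) * (2 `^ (- s)) ^+ k)%:E)%E].
Proof.
move=> s0 bA nA; have [z cA] := not_hnull_content s0 nA.
have [M [q [M0 qA qm qw]]] := frostman_analytic (dim_weight_gt0 s) (borel_analytic z bA) cA.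
pose D := [set u : R | 0 <= u < M].
have DE : D = `[0, M[%classic by apply/seteqP; split=> u /=; rewrite in_itv.
have mD : measurable (D : set (measurableTypeR R)) by rewrite DE; exact: measurable_itv.
have lD : lebesgue_measure D = M%:E.
  by rewrite DE lebesgue_measure_itv/= lte_fin M0 oppr0 adde0.
have lDoo : (lebesgue_measure D < +oo)%E by rewrite lD ltry.
pose tau := mfrestr mD lDoo.
(* Parameters outside [[0, M)], to which tau gives no mass, are sent to 0, so that phi takes its
   values in A everywhere. *)
pose pr (u : R) := if 0 <= u < M then u else 0.
have prM u : 0 <= pr u < M by rewrite /pr; case: ifP => //; rewrite lexx M0.
have mpr : measurable_fun [set: R] pr.
  apply: measurable_fun_ifT => //; apply: (measurable_fun_bool true).
  by rewrite setTI -[X in measurable X]/D.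
pose phi u := code_point z (q (pr u)).
have mq l : measurable_fun [set: R] (fun u => q (pr u) l).
  apply: (measurable_fun_bool true); rewrite setTI.
  have -> : (fun u => q (pr u) l) @^-1` [set true] =
      pr @^-1` (\bigcup_w [set u | pre (q u) l.+1 = true :: w]).
    apply/seteqP; split=> u /=; last by case=> w _ /= [].
    by move=> qt; exists (pre (q (pr u)) l) => //=; rewrite qt.
  rewrite -[_ @^-1` _]setTI; apply: mpr => //.
  apply: countable_bigcupT_measurable => // w; exact: qm.
have mphi i : measurable_fun setT (fun u => phi u 0 i).
  rewrite /phi; under eq_fun do rewrite mxE.
  apply: measurable_funD => //; apply: measurable_bin => j; rewrite /digits.
  by case: (i < 2)%N; exact: mq.
exists tau, phi; split=> //.
- by rewrite /= /mfrestr /mrestr setTI lD lte_fin.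
- by move=> u; apply: qA; exact: prM.
- move=> u v i; rewrite !mxE opprD addrACA subrr add0r.
  by have := @bin_dist R (digits i (q (pr u))) (digits i (q (pr v))) 0; rewrite expr0 invr1; apply.
move=> p r k r0; set S := [set u | _].
have x0 : 0 <= (2 `^ (- s)) ^+ k :> R by rewrite exprn_ge0// powR_ge0.
pose S' := S `&` D.
have [S'0|/set0P[u0 [Su0 Du0]]] := eqVneq S' set0.
  rewrite /= /mfrestr /mrestr -/S' S'0 measure0 lee_fin.
  by rewrite !mulr_ge0 ?sqr_ge0 ?addr_ge0 ?mulr_ge0// exprn_ge0.
have prD u : D u -> pr u = u by rewrite /pr /D /= => ->.
pose N i u := bin_nat (digits i (q u)) (code_prec i k).
(* Two points of S differ by at most 2 r in each coordinate, so the integers formed by their leading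
   digits differ by at most h. This leaves at most 2 h + 1 values, which is the source of the 4 and
   the 3 in the bound. *)
pose h (i : 'I_3) : R := 2 * r * 2 ^+ code_prec i k + 1.
have h0 i : 0 <= h i by rewrite addr_ge0// !mulr_ge0// exprn_ge0.
pose Q i : nat := Num.trunc (h i).
have QE i : (Q i)%:R <= h i < (Q i).+1%:R by apply: truncn_itv.
have NQ i u : S' u -> (N i u0 <= N i u + Q i)%N /\ (N i u <= N i u0 + Q i)%N.
  move=> [Su Du]; have : `|(N i u)%:R - (N i u0)%:R| <= h i :> R.
    apply: bin_nat_dist; first by rewrite mulr_ge0.
    have := Su i; have := Su0 i; rewrite /phi !mxE (prD _ Du) (prD _ Du0).
    rewrite !ler_norml => /andP[? ?] /andP[? ?]; apply/andP; split; lra.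
  move=> /le_lt_trans /(_ (andP (QE i)).2); rewrite ltr_norml => /andP[h1 h2].
  rewrite -ltnS -[in X in _ /\ X]ltnS; split.
    by rewrite -(ltr_nat R) -addnS natrD; lra.
  by rewrite -(ltr_nat R) -addnS natrD; lra.
pose Idx := ('I_((Q (ord3 0)).*2.+1) * 'I_((Q (ord3 1)).*2.+1) * 'I_((Q (ord3 2)).*2.+1))%type.
pose n (j : Idx) (i : 'I_3) : nat := if i == ord3 0 then j.1.1 : nat else if i == ord3 1 then j.1.2 : nat else j.2.
pose C (j : Idx) := [set u | S' u /\ forall i, (N i u + Q i = N i u0 + n j i)%N].
have /choice[F FP] : forall j, exists F : set R, [/\ measurable F, C j `<=` F &
    (lebesgue_measure F <= ((2 `^ (- s)) ^+ k)%:E)%E].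
  move=> j; have [Cj0|/set0P[u [[_ Du] Cu]]] := eqVneq (C j) set0.
    by exists set0; rewrite Cj0; split=> //; rewrite measure0 lee_fin.
  have [x /andP[x1 x2] [y xy]] := qw (pre (q u) (4 * k)).
  exists `[y, y + x]%classic; split.
  - exact: measurable_itv.
  - move=> v [[_ Dv] Cv]; apply: xy; split=> //; rewrite size_pre.
    apply: digits_pre => i l lk; apply: (bin_nat_inj _ lk).
    by apply/eqP; rewrite -(eqn_add2r (Q i)) Cu Cv.
  - rewrite lebesgue_measure_itv/= -EFinD addrAC subrr add0r; case: ifP => _ //.
      by move: x2; rewrite size_pre /dim_weight mulKn.
have mS : measurable (S : set (measurableTypeR R)).
  have -> : S = \bigcap_i (setT `&` (fun u => `|phi u 0 i - p 0 i|) @^-1` [set x | x <= r]).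
    apply/seteqP; split=> u /=; first by move=> h' i _; split=> //; exact: h'.
    by move=> h' i; have [_] := h' i I.
  apply: fin_bigcap_measurable => [|i _]; first exact: finite_finset.
  rewrite setTI; apply: measurable_set_ler => //.
  apply: (measurableT_comp (@normr_measurable _ _)).
  by apply: measurable_funB; [exact: mphi|exact: measurable_cst].
rewrite /= /mfrestr /mrestr -/S'.
apply: (le_trans (@measure_cover_le _ _ _ lebesgue_measure Idx S' F _ (measurableI _ _ mS mD) _ _ _)).
- by move=> j; have [] := FP j.
- by move=> j; have [_ _] := FP j; exact.
- move=> u S'u; have [NQ1 NQ2] := (fun i => proj1 (NQ i u S'u), fun i => proj2 (NQ i u S'u)).
  have lt i : (N i u + Q i - N i u0 < (Q i).*2.+1)%N.
    by have := NQ1 i; have := NQ2 i; lia.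
  exists (Ordinal (lt (ord3 0)), Ordinal (lt (ord3 1)), Ordinal (lt (ord3 2))).
  have [_ FC _] := FP (Ordinal (lt (ord3 0)), Ordinal (lt (ord3 1)), Ordinal (lt (ord3 2))).
  apply: FC; split=> // i; rewrite /n /=; have := NQ1 i.
  have n10 : ord3 1 != ord3 0 by apply/eqP => /(congr1 val); rewrite /= !inordK.
  have n20 : ord3 2 != ord3 0 by apply/eqP => /(congr1 val); rewrite /= !inordK.
  have n21 : ord3 2 != ord3 1 by apply/eqP => /(congr1 val); rewrite /= !inordK.
  case: (ord3E i) => -> /=; rewrite ?eqxx ?(negbTE n10) ?(negbTE n20) ?(negbTE n21) /=;
    by move=> h1; rewrite subnKC.
rewrite lee_fin ler_wpM2r// !card_prod !card_ord !natrM expr2.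
have lb i : (((Q i).*2.+1)%:R : R) <= 2 * h i + 1.
  by rewrite -addn1 -muln2 natrD natrM; have /andP[] := QE i; lra.
have e0 : 2 * h (ord3 0) + 1 = 4 * r * 2 ^+ k + 3 by rewrite /h /code_prec inordK//=; lra.
have e1 : 2 * h (ord3 1) + 1 = 4 * r * 2 ^+ k + 3 by rewrite /h /code_prec inordK//=; lra.
have e2 : 2 * h (ord3 2) + 1 = 4 * r * 2 ^+ k.*2 + 3 by rewrite /h /code_prec inordK//=; lra.
by rewrite -e2 -{1}e0 -e1; do !apply: ler_pM.
Qed.

End FrostmanMeasure.

Section BoxBound.
Variable R : realType.

(** Here x stands for 2^(-s). The first bound takes k = j: in time the box is longer than a cylinder
    by a factor of order 2^j. The second takes k = j/2, where boundedly many cylinders suffice. *)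
Lemma frostman_boxes (tau : set (measurableTypeR R) -> \bar R) (phi : R -> 'rV[R]_3) (x : R) :
  0 < x -> x <= 1 ->
  (forall (p : 'rV[R]_3) (r : R) k, 0 <= r ->
      (tau [set u | forall i, (`|phi u 0 i - p 0 i| <= r)%R] <=
       ((4 * r * 2 ^+ k + 3) ^+ 2 * (4 * r * 2 ^+ k.*2 + 3) * x ^+ k)%:E)%E) ->
  forall L, 0 < L -> exists2 C, 0 < C & forall (p : 'rV[R]_3) j,
    let B := [set u | forall i, (`|phi u 0 i - p 0 i| <= L / 2 ^+ j)%R] in
    (tau B <= (C * (2 * x) ^+ j)%:E)%E /\ (tau B <= (C * x ^+ j./2)%:E)%E.
Proof.
move=> x0 x1 H L L0; exists ((4 * L + 3) ^+ 3); first by rewrite exprn_gt0//; lra.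
move=> p j B; have Lj0 : 0 <= L / 2 ^+ j by rewrite divr_ge0 ?exprn_ge0// ltW.
have bnd k (c : R) : 0 <= c -> 4 * (L / 2 ^+ j) * 2 ^+ k + 3 <= 4 * L + 3 ->
    4 * (L / 2 ^+ j) * 2 ^+ k.*2 + 3 <= (4 * L + 3) * c ->
    (tau B <= ((4 * L + 3) ^+ 3 * c * x ^+ k)%:E)%E.
  move=> c0 h1 h2; apply: (le_trans (H p _ k Lj0)); rewrite lee_fin.
  move: (L / 2 ^+ j) Lj0 h1 h2 => y Lj0 h1 h2.
  apply: ler_pM => //; rewrite ?exprn_ge0 ?(ltW x0)//.
    by rewrite mulr_ge0 ?sqr_ge0// addr_ge0// !mulr_ge0 ?exprn_ge0// ltW.
  rewrite [X in _ <= X * c]exprSr -[X in _ <= X]mulrA; apply: ler_pM => //; rewrite ?sqr_ge0//.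
    by rewrite addr_ge0// !mulr_ge0 ?exprn_ge0.
  by rewrite ler_sqr ?nnegrE// ?addr_ge0// ?mulr_ge0 ?exprn_ge0 ?(ltW L0).
have cancel k : L / 2 ^+ j * 2 ^+ (j + k) = L * 2 ^+ k.
  by rewrite exprD mulrA divfK// expf_neq0.
have half k : (k <= j)%N -> L / 2 ^+ j * 2 ^+ k <= L.
  move=> kj; rewrite -mulrA ler_piMr ?(ltW L0)// mulrC ler_pdivrMr ?exprn_gt0// mul1r.
  by rewrite ler_eXn2l ?ltr1n.
split.
  rewrite exprMn mulrA; apply: bnd.
  - by rewrite exprn_ge0.
  - by rewrite lerD2r -!mulrA ler_pM2l// mulrA half.
  - rewrite -[4 * _ * _]mulrA -addnn cancel.
    by have : 1 <= 2 ^+ j :> R; [rewrite exprn_ege1 ?ler1n|lra].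
rewrite -[_ ^+ 3]mulr1; apply: bnd => //; rewrite ?mulr1 lerD2r -[4 * _ * _]mulrA ler_pM2l//.
  by apply: half; have := odd_double_half j; lia.
by apply: half; have := odd_double_half j; lia.
Qed.

End BoxBound.

(** * Lines and planes in R^3 through their unit direction *)

Section Direction.
Variable R : realType.
Implicit Types (u v n : 'rV[R]_3) (g D : 'M[R]_3).

Definition dot u v : R := (u *m v^T) 0 0.

Lemma dotE u v : dot u v = u 0 (ord3 0) * v 0 (ord3 0) + u 0 (ord3 1) * v 0 (ord3 1)
  + u 0 (ord3 2) * v 0 (ord3 2).
Proof. by rewrite /dot mxE sum3E !mxE. Qed.

Lemma dot_ge0 u : 0 <= dot u u.
Proof. by rewrite dotE -!expr2 !addr_ge0// sqr_ge0. Qed.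

Lemma dot_scalar u v : u *m v^T = (dot u v)%:M.
Proof. by rewrite -mx11_scalar. Qed.

Definition quad D u : R := (u *m D *m u^T) 0 0.

Lemma quad_rank1 v u : quad (v^T *m v) u = dot u v ^+ 2.
Proof.
rewrite /quad !mulmxA (dot_scalar u v) -mulmxA mul_scalar_mx mxE expr2.
by congr (_ * _); rewrite -/(dot v u) !dotE; lra.
Qed.

Lemma quad1 u : quad 1%:M u = dot u u.
Proof. by rewrite /quad mulmx1. Qed.

Lemma quadZ D c u : quad D (c *: u) = c ^+ 2 * quad D u.
Proof.
rewrite /quad linearZ/= -scalemxAr -!scalemxAl scalerA mxE expr2.
by [].
Qed.

Lemma det3E (A : 'M[R]_3) : let a i j := A (ord3 i) (ord3 j) in
  \det A = a 0%N 0%N * (a 1%N 1%N * a 2%N 2%N - a 1%N 2%N * a 2%N 1%N)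
    - a 0%N 1%N * (a 1%N 0%N * a 2%N 2%N - a 1%N 2%N * a 2%N 0%N)
    + a 0%N 2%N * (a 1%N 0%N * a 2%N 1%N - a 1%N 1%N * a 2%N 0%N).
Proof.
rewrite /= (expand_det_row _ (ord3 0)) sum3E /cofactor.
have m2 (B : 'M[R]_2) : \det B = B ord0 ord0 * B ord_max ord_max - B ord0 ord_max * B ord_max ord0.
  rewrite (expand_det_row _ ord0) !big_ord_recl big_ord0 addr0 /cofactor !det_mx11 !mxE.
  by rewrite /= expr0 expr1 mul1r mulN1r mulrN;
     congr (B _ _ * B _ _ - B _ _ * B _ _); apply: val_inj.
have l (i : nat) (k : 'I_2) : (i < 3)%N -> lift (ord3 i) k = ord3 (bump i k).
  by move=> i3; apply: val_inj; rewrite /= /bump !inordK//; case: k => -[|[|]] //=; case: i i3 => [|[|[|]]].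
rewrite !m2 !mxE !l//= /ord3 !inordK//= expr0 expr1 expr2 !mulN1r mul1r !opprK mul1r.
by rewrite mulrN.
Qed.

(* The half-turn about the line spanned by u - v exchanges u and - v. *)
Lemma rotation_exists u v : dot u u = 1 -> dot v v = 1 ->
  exists g, [/\ g *m g^T = 1%:M, \det g = 1 & u *m g = v \/ u *m g = - v].
Proof.
move=> u1 v1; have [->|uv] := eqVneq u v.
  by exists 1%:M; rewrite trmx1 mulmx1 det1 mulmx1; split=> //; left.
pose w := u - v; pose N := dot w w.
have N0 : N != 0.
  apply: contra_neq uv => N0; apply/eqP; rewrite -subr_eq0; apply/eqP/sqr_rv_eq0.
  by rewrite dot_scalar -/w -/N N0 raddf0.
pose g : 'M[R]_3 := (2 / N) *: (w^T *m w) - 1%:M.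
have gT : g^T = g by rewrite /g linearB/= linearZ/= trmx_mul trmxK trmx1.
have gg : g *m g = 1%:M.
  rewrite /g mulmxBl mulmxBr !mul1mx !mulmx1 -scalemxAl -scalemxAr scalerA.
  rewrite mulmxA -(mulmxA w^T) dot_scalar mul_mx_scalar -scalemxAl scalerA -/N.
  have -> : 2 / N * (2 / N) * N = 2 / N + 2 / N by field.
  by rewrite scalerDl addrK opprB addrC subrK.
have gE i j : g i j = 2 / N * (w 0 i * w 0 j) - (i == j)%:R.
  by rewrite /g !mxE big_ord1 !mxE.
have neq (i j : nat) : (i < 3)%N -> (j < 3)%N -> (ord3 i == ord3 j) = (i == j).
  by move=> i3 j3; rewrite -val_eqE /= !inordK.
have NE : N = w 0 (ord3 0) ^+ 2 + w 0 (ord3 1) ^+ 2 + w 0 (ord3 2) ^+ 2.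
  by rewrite /N dotE; lra.
exists g; split; first by rewrite gT.
  rewrite det3E !gE !neq//= NE; field.
  by rewrite -NE.
right; rewrite /g mulmxBr mulmx1 -scalemxAr mulmxA dot_scalar mul_scalar_mx scalerA.
have Nw : N = 2 * dot u w.
  by move: u1 v1; rewrite /N /w !dotE !mxE => u1 v1; lra.
have -> : 2 / N * dot u w = 1 by rewrite mulrAC -Nw mulfV.
by rewrite scale1r /w addrAC subrr add0r.
Qed.

End Direction.

Section Grassmann.
Variable R : realType.
Local Notation rV := 'rV[R]_3.

Lemma orth_proj_unique (V : {vspace rV}) p q : q \in V ->
  (forall v, v \in V -> (p - q) *m v^T = 0) -> orth_proj V p = q.
Proof.
move=> qV pq; apply/esym/eqP; rewrite -subr_eq0; apply/eqP/sqr_rv_eq0.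
set w := q - _; have wV : w \in V by rewrite memvB// orth_proj_mem.
have wE : w = (p - orth_proj V p) - (p - q) by rewrite opprB addrC addrA subrK.
by rewrite {1}wE mulmxBl (orth_proj_orth _ wV) pq// subr0.
Qed.

Lemma orthonormal_span (k : nat) (F : 'M[R]_(k, 3)) (V : {vspace rV}) v :
  F *m F^T = 1%:M -> (forall i, row i F \in V) -> \dim V = k -> v \in V ->
  exists c : 'rV_k, v = c *m F.
Proof.
move=> FF FV dV vV; have FB : (F <= basis_mx V)%MS.
  by apply/row_subP => i; rewrite -mem_basis_mx.
have rF : \rank F = k by apply/eqP/row_freeP; exists F^T.
have BF : (basis_mx V <= F)%MS.
  have := mxrank_leqif_sup FB; rewrite rF => /leqifP; case: ifP => // _.
  by rewrite ltnNge -dV rank_leq_row.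
by apply/submxP; apply: submx_trans BF; rewrite -mem_basis_mx.
Qed.

Lemma orth_proj_frame (k : nat) (F : 'M[R]_(k, 3)) (V : {vspace rV}) :
  F *m F^T = 1%:M -> (forall i, row i F \in V) -> \dim V = k ->
  orth_proj_mx V = F^T *m F.
Proof.
move=> FF FV dV; apply/row_matrixP => i; rewrite !rowE.
apply: orth_proj_unique.
  rewrite mulmxA mulmx_sum_row; apply: memv_suml => j _; exact/memvZ/FV.
move=> v /(orthonormal_span FF FV dV)[c ->].
by rewrite trmx_mul mulmxBl !mulmxA -[_ *m F *m F^T]mulmxA FF mulmx1 subrr.
Qed.

Lemma rank1_frame (F : 'M[R]_(1, 3)) : F *m F^T = 1%:M -> dot F F = 1.
Proof. by rewrite /dot => ->; rewrite mxE eqxx. Qed.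

Lemma rank2_frame (F : 'M[R]_(2, 3)) : F *m F^T = 1%:M ->
  exists2 v, dot v v = 1 & 1%:M - F^T *m F = v^T *m v.
Proof.
move=> FF; have /rowV0Pn[w wK w0] : kermx F^T != 0.
  rewrite -mxrank_eq0 mxrank_ker -lt0n subn_gt0.
  by apply: leq_ltn_trans (rank_leq_col _) _.
have wF : w *m F^T = 0 by apply/sub_kermxP.
have N0 : 0 < dot w w.
  rewrite lt_neqAle dot_ge0 andbT eq_sym; apply: contra_neq w0 => N0.
  by apply: sqr_rv_eq0; rewrite dot_scalar N0 raddf0.
pose c := Num.sqrt (dot w w); have c0 : c != 0 by rewrite sqrtr_eq0 -ltNge.
pose v := c^-1 *: w.
have vv : dot v v = 1.
  rewrite /dot /v linearZ/= -scalemxAr -scalemxAl scalerA mxE -/(dot w w).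
  by rewrite -[dot w w]sqr_sqrtr ?ltW// -/c -invfM -expr2 mulVf// expf_neq0.
have vF : v *m F^T = 0 by rewrite -scalemxAl wF scaler0.
exists v => //.
have OO : col_mx F v *m (col_mx F v)^T = 1%:M.
  rewrite tr_col_mx mul_col_row FF vF dot_scalar vv -[F *m v^T]trmxK trmx_mul trmxK vF trmx0.
  by rewrite -scalar_mx_block.
(* A one-sided inverse of a square matrix is two-sided; the block form of [O^T O = 1] is the
   completeness relation [F^T F + v^T v = 1]. *)
have OO' : (col_mx F v)^T *m col_mx F v = 1%:M := @mulmx1C _ 3 (col_mx F v) _ OO.
rewrite -OO' tr_col_mx mul_row_col.
by rewrite addrAC subrr add0r.
Qed.

Variable m : 'I_4.
Local Notation G := (grassmannian R m).

(* The projection onto the line V, or onto the normal of the plane V: in both cases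
   v^T *m v for a unit vector v, which is unique up to sign. *)
Definition dirmx (V : G) : 'M[R]_3 :=
  if m == 1%N :> nat then grass_proj_mx V else 1%:M - grass_proj_mx V.

Lemma grass_frame (V : G) : exists F : 'M[R]_(m, 3),
  [/\ F *m F^T = 1%:M, forall i, row i F \in val V & grass_proj_mx V = F^T *m F].
Proof.
have [F [FF FV]] := orthonormal_frame_ex V; exists F; split=> //.
exact: orth_proj_frame (eqP (valP V)).
Qed.

Lemma unit_direction (hm : m = 1%N :> nat \/ m = 2%N :> nat) (V : G) :
  exists2 v, dot v v = 1 & dirmx V = v^T *m v.
Proof.
have [F [FF _ E]] := grass_frame V; rewrite /dirmx E.
move: (nat_of_ord m) hm F FF {E} => k; case=> ->; rewrite ?eqxx /=.
  by move=> F FF; exists F => //; exact: rank1_frame.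
exact: rank2_frame.
Qed.

Lemma grass_proj_rotate (V W : G) (g : 'M[R]_3) : g *m g^T = 1%:M ->
  val W = (linfun (mulmxr g) @: val V)%VS -> grass_proj_mx W = g^T *m grass_proj_mx V *m g.
Proof.
move=> gg WV; have [F [FF FV ->]] := grass_frame V.
have -> : g^T *m (F^T *m F) *m g = (F *m g)^T *m (F *m g).
  by rewrite trmx_mul !mulmxA.
apply: orth_proj_frame; last exact: (eqP (valP W)).
  by rewrite trmx_mul mulmxA -(mulmxA F) gg mulmx1.
move=> i; rewrite WV row_mul; have -> : row i F *m g = linfun (mulmxr g) (row i F).
  by rewrite lfunE.
exact/memv_img/FV.
Qed.

Lemma dirmx_rotate (V W : G) (g : 'M[R]_3) : g *m g^T = 1%:M ->
  val W = (linfun (mulmxr g) @: val V)%VS -> dirmx W = g^T *m dirmx V *m g.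
Proof.
move=> gg WV; rewrite /dirmx (grass_proj_rotate gg WV); case: ifP => // _.
by rewrite mulmxBr mulmxBl mulmx1 (mulmx1C gg).
Qed.

Lemma grass_rotate_ex (g : 'M[R]_3) (V : G) : g *m g^T = 1%:M ->
  exists W : G, val W = (linfun (mulmxr g) @: val V)%VS.
Proof.
move=> gg; have dW : \dim (linfun (mulmxr g) @: val V)%VS == m.
  rewrite limg_dim_eq; first exact: (valP V).
  apply/eqP; rewrite -subv0; apply/subvP => v; rewrite memv_cap => /andP[_].
  rewrite memv_ker lfunE /= => /eqP vg; rewrite memv0.
  by rewrite -[v]mulmx1 -gg mulmxA vg mul0mx.
by exists (exist (fun V : {vspace rV} => \dim V == m) _ dW).
Qed.

Lemma measurable_grass_proj i j :
  measurable_fun setT (fun V : grass_borel R m => grass_proj_mx V i j).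
Proof.
apply: (measurability _ (RGenOInfty.measurableE R)) => _ [_ [x ->] <-].
rewrite setTI; apply: sub_sigma_algebra.
exists [set M : 'M[R]_3 | x < M i j].
  by have /continuousP := @coord_continuous R 3 3 i j; move=> /(_ [set y | x < y]); apply; exact: open_gt.
by apply/seteqP; split=> V /=; rewrite in_itv/= andbT.
Qed.

Lemma measurable_dirmx i j :
  measurable_fun setT (fun V : grass_borel R m => dirmx V i j).
Proof.
rewrite /dirmx; case: (m == 1%N :> nat); first exact: (measurable_grass_proj i j).
rewrite (_ : (fun _ => _) = fun V => (1%:M : 'M[R]_3) i j - grass_proj_mx V i j).
  apply: measurable_funB; first exact: measurable_cst.
  exact: (measurable_grass_proj i j).
by apply: funext => V; rewrite mxE [X in _ + X = _]mxE.
Qed.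

Lemma measurable_quad_dirmx u :
  measurable_fun setT (fun V : grass_borel R m => quad (dirmx V) u).
Proof.
rewrite /quad; under eq_fun do rewrite mxE.
apply: measurable_sum => i; under eq_fun do rewrite !mxE.
apply: measurable_funM; last exact: measurable_cst.
apply: measurable_sum => j; apply: measurable_funM; first exact: measurable_cst.
exact: (measurable_dirmx j i).
Qed.

End Grassmann.

(** * Invariant measures of caps and slabs *)

Lemma norm_le_sqr (R : realType) (x b : R) : 0 <= b -> x ^+ 2 <= b ^+ 2 -> `|x| <= b.
Proof. by move=> b0; rewrite -[x ^+ 2]real_normK ?num_real// ler_sqr ?nnegrE. Qed.

Lemma le_norm_sqr (R : realType) (x b : R) : 0 <= b -> b ^+ 2 <= x ^+ 2 -> b <= `|x|.
Proof. by move=> b0; rewrite -[x ^+ 2]real_normK ?num_real// ler_sqr ?nnegrE. Qed.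

Lemma sum_sqr_small (R : realType) (a b c r : R) : 0 <= r ->
  a ^+ 2 + b ^+ 2 + c ^+ 2 <= r ^+ 2 -> [/\ `|a| <= r, `|b| <= r & `|c| <= r].
Proof.
move=> r0 h; have := sqr_ge0 a; have := sqr_ge0 b; have := sqr_ge0 c => *.
by split; apply: norm_le_sqr => //; lra.
Qed.

(* Two of the directions (i k, j k, 1) in a common cap are so close that their
   indices agree when k = 20 rho. *)
Lemma packing_separation (R : realType) (Y0 Y1 Z0 Z1 v0 v1 v2 rho : R) (s := Y0 * v0 + Y1 * v1 + v2)
    (t := Z0 * v0 + Z1 * v1 + v2) :
  0 < rho -> rho <= 20^-1 -> 0 <= Y0 <= 1 -> 0 <= Y1 <= 1 -> 0 <= Z0 <= 1 -> 0 <= Z1 <= 1 ->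
  v0 ^+ 2 + v1 ^+ 2 + v2 ^+ 2 = 1 ->
  Y0 ^+ 2 + Y1 ^+ 2 + 1 - s ^+ 2 <= rho ^+ 2 * (Y0 ^+ 2 + Y1 ^+ 2 + 1) ->
  Z0 ^+ 2 + Z1 ^+ 2 + 1 - t ^+ 2 <= rho ^+ 2 * (Z0 ^+ 2 + Z1 ^+ 2 + 1) ->
  `|Y0 - Z0| < 20 * rho /\ `|Y1 - Z1| < 20 * rho.
Proof.
move=> r0 r1 /andP[Y00 Y01] /andP[Y10 Y11] /andP[Z00 Z01] /andP[Z10 Z11] vv hs ht.
have sq a : 0 <= a <= 1 -> a ^+ 2 <= 1 :> R.
  by move=> /andP[a0 a1]; rewrite expr_le1.
have sqY0 : Y0 ^+ 2 <= 1 by rewrite sq ?Y00.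
have sqY1 : Y1 ^+ 2 <= 1 by rewrite sq ?Y10.
have sqZ0 : Z0 ^+ 2 <= 1 by rewrite sq ?Z00.
have sqZ1 : Z1 ^+ 2 <= 1 by rewrite sq ?Z10.
have r2 : 0 <= rho ^+ 2 by exact: sqr_ge0.
have P1 : (Y0 - s * v0) ^+ 2 + (Y1 - s * v1) ^+ 2 + (1 - s * v2) ^+ 2 =
    Y0 ^+ 2 + Y1 ^+ 2 + 1 - s ^+ 2.
  have -> : (Y0 - s * v0) ^+ 2 + (Y1 - s * v1) ^+ 2 + (1 - s * v2) ^+ 2 =
    Y0 ^+ 2 + Y1 ^+ 2 + 1 - 2 * s * (Y0 * v0 + Y1 * v1 + v2) + s ^+ 2 * (v0 ^+ 2 + v1 ^+ 2 + v2 ^+ 2) by ring.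
  by rewrite vv -/s; ring.
have P2 : (Z0 - t * v0) ^+ 2 + (Z1 - t * v1) ^+ 2 + (1 - t * v2) ^+ 2 =
    Z0 ^+ 2 + Z1 ^+ 2 + 1 - t ^+ 2.
  have -> : (Z0 - t * v0) ^+ 2 + (Z1 - t * v1) ^+ 2 + (1 - t * v2) ^+ 2 =
    Z0 ^+ 2 + Z1 ^+ 2 + 1 - 2 * t * (Z0 * v0 + Z1 * v1 + v2) + t ^+ 2 * (v0 ^+ 2 + v1 ^+ 2 + v2 ^+ 2) by ring.
  by rewrite vv -/t; ring.
have d1 : Y0 ^+ 2 + Y1 ^+ 2 + 1 - s ^+ 2 <= 4 * rho ^+ 2.
  have : rho ^+ 2 * (Y0 ^+ 2 + Y1 ^+ 2 + 1) <= rho ^+ 2 * 4 by rewrite ler_wpM2l//; lra.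
  lra.
have d2 : Z0 ^+ 2 + Z1 ^+ 2 + 1 - t ^+ 2 <= 4 * rho ^+ 2.
  have : rho ^+ 2 * (Z0 ^+ 2 + Z1 ^+ 2 + 1) <= rho ^+ 2 * 4 by rewrite ler_wpM2l//; lra.
  lra.
have rr : 4 * rho ^+ 2 = (2 * rho) ^+ 2 by ring.
have rho2 : 0 <= 2 * rho by rewrite mulr_ge0// ltW.
rewrite -P1 rr in d1; rewrite -P2 rr in d2.
have [p0 p1 p2] := sum_sqr_small rho2 d1; have [q0 q1 q2] := sum_sqr_small rho2 d2.
rewrite P1 in d1; rewrite P2 in d2.
have r4 : 4 * rho ^+ 2 <= 100^-1.
  have : rho * rho <= 20^-1 * 20^-1 by rewrite ler_pM// ltW.
  rewrite expr2; lra.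
have t9 : 9 / 10 <= `|t|.
  apply: le_norm_sqr; first by rewrite divr_ge0.
  have := sqr_ge0 Z0; have := sqr_ge0 Z1; rewrite -rr in d2; clear - d2 r4 => *; lra.
have bd (x : R) : x ^+ 2 <= 4 -> `|x| <= 2.
  by move=> x4; apply: norm_le_sqr => //; clear - x4; lra.
have s2 : `|s| <= 2.
  have := sqr_ge0 (Y0 - s * v0); have := sqr_ge0 (Y1 - s * v1); have := sqr_ge0 (1 - s * v2).
  by move=> a1 a2 a3; apply: bd; clear - P1 sqY0 sqY1 a1 a2 a3; lra.
have t2 : `|t| <= 2.
  have := sqr_ge0 (Z0 - t * v0); have := sqr_ge0 (Z1 - t * v1); have := sqr_ge0 (1 - t * v2).
  by move=> a1 a2 a3; apply: bd; clear - P2 sqZ0 sqZ1 a1 a2 a3; lra.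
(* The vectors Y - s v and Z - t v are short. In t Y - s Z the components along v cancel, so it is
   short too; its last coordinate t - s then separates the two factors. *)
have cross a b : `|a| <= 2 * rho -> `|b| <= 2 * rho -> `|t * a - s * b| <= 8 * rho.
  move=> ha hb; apply: (le_trans (ler_normB _ _)); rewrite !normrM.
  have := ler_pM (normr_ge0 t) (normr_ge0 a) t2 ha.
  have := ler_pM (normr_ge0 s) (normr_ge0 b) s2 hb.
  by clear => *; lra.
have c2 : `|t - s| <= 8 * rho.
  by have := cross _ _ p2 q2; rewrite (_ : t * (1 - s * v2) - s * (1 - t * v2) = t - s)//; ring.
have fin y z w : 0 <= z <= 1 -> `|y - s * w| <= 2 * rho -> `|z - t * w| <= 2 * rho ->
    `|y - z| < 20 * rho.
  move=> /andP[z0 z1] hy hz; have c := cross _ _ hy hz.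
  have h : `|t * (y - z)| <= 16 * rho.
    have -> : t * (y - z) = (t * (y - s * w) - s * (z - t * w)) - (t - s) * z by ring.
    apply: (le_trans (ler_normB _ _)); rewrite normrM (ger0_norm z0).
    have := ler_pM (normr_ge0 (t - s)) z0 c2 z1; clear - c => *; lra.
  rewrite normrM in h; have := ler_wpM2r (normr_ge0 (y - z)) t9.
  clear - h r0 => *; lra.
by split; [apply: (fin _ _ v0)|apply: (fin _ _ v1)] => //; apply/andP.
Qed.

Section Caps.
Variables (R : realType) (m : 'I_4).
Hypothesis hm : m = 1%N :> nat \/ m = 2%N :> nat.
Variable gamma : probability (grass_borel R m) R.
Hypothesis hgamma : rotation_invariant gamma.
Local Notation rV := 'rV[R]_3.
Local Notation G := (grass_borel R m).
Implicit Types (u v n : rV) (V : G) (rho : R).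

Definition qset u (A : set R) : set G := [set V : G | A (quad (dirmx V) u)].

Definition cap u rho : set G := qset u [set x | 1 - x <= rho ^+ 2].

Lemma measurable_qset u A : measurable A -> measurable (qset u A).
Proof.
move=> mA; rewrite -[qset u A]setTI.
exact: (measurable_quad_dirmx (m := m) u measurableT).
Qed.

Lemma measurable_cap u rho : measurable (cap u rho).
Proof. by apply: measurable_qset; apply: measurable_set_ler => //; exact: measurable_funB. Qed.

Lemma quad_dirmx_rotate (V W : grassmannian R m) (g : 'M[R]_3) u : g *m g^T = 1%:M ->
  val W = (linfun (mulmxr g) @: val V)%VS -> quad (dirmx W) (u *m g) = quad (dirmx V) u.
Proof.
move=> gg WV; rewrite /quad (dirmx_rotate gg WV) trmx_mul !mulmxA.
rewrite -(mulmxA u g g^T) gg mulmx1.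
by rewrite -(mulmxA (u *m dirmx V) g) gg mulmx1.
Qed.

Lemma grass_rotate_qset u A (g : 'M[R]_3) : g *m g^T = 1%:M ->
  grass_rotate g (qset u A) = qset (u *m g) A.
Proof.
move=> gg; apply/seteqP; split=> W /=.
  by case=> V uV WV; rewrite /qset /= (quad_dirmx_rotate _ gg WV).
have gg' : g^T *m g^T^T = 1%:M by rewrite trmxK; exact: mulmx1C.
have [V VW] := grass_rotate_ex W gg'.
move=> uW; exists V.
  rewrite /qset /=; have := quad_dirmx_rotate (u *m g) gg' VW.
  by rewrite -mulmxA gg mulmx1 => ->.
rewrite VW -limg_comp -[LHS]lim1g; congr (_ @: _)%VS.
by apply/lfunP => v; rewrite comp_lfunE !lfunE /= -mulmxA (mulmx1C gg) mulmx1.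
Qed.

Lemma gamma_qset_eq u v A : measurable A -> dot u u = 1 -> dot v v = 1 ->
  gamma (qset u A) = gamma (qset v A).
Proof.
move=> mA u1 v1; have [g [gg dg ug]] := rotation_exists u1 v1.
rewrite -(hgamma gg dg (measurable_qset u mA)) grass_rotate_qset//.
case: ug => ->//; congr (gamma _).
by apply/seteqP; split=> V; rewrite /qset /= -[- v]scaleN1r quadZ sqrrN expr1n mul1r.
Qed.

Lemma dirmx_dot (V : grassmannian R m) : exists2 v, dot v v = 1 & forall u,
  quad (dirmx V) u = dot u v ^+ 2.
Proof.
by have [v v1 E] := unit_direction hm V; exists v => // u; rewrite E quad_rank1.
Qed.

Definition vec3 (a b c : R) : rV :=
  \row_i (if i == ord3 0 then a else if i == ord3 1 then b else c).

Lemma ord3_eq i j : (i < 3)%N -> (j < 3)%N -> (ord3 i == ord3 j) = (i == j).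
Proof. by move=> i3 j3; rewrite -val_eqE /= !inordK. Qed.

Lemma vec3E a b c : (vec3 a b c 0 (ord3 0) = a) * (vec3 a b c 0 (ord3 1) = b) *
  (vec3 a b c 0 (ord3 2) = c).
Proof. by rewrite !mxE !ord3_eq. Qed.

(** For rho > 1/20 the bound exceeds 1. Otherwise the directions (20 rho i, 20 rho j, 1) with i, j <
    N give N^2 disjoint caps of equal measure. Since N >= 1 is the integral part of 1 / (20 rho), 40
    rho N > 1, and 1600 is 40^2. *)
Lemma gamma_cap u rho : dot u u = 1 -> 0 < rho ->
  (gamma (cap u rho) <= (1600 * rho ^+ 2)%:E)%E.
Proof.
move=> u1 r0; have [r1|r1] := ltP 20^-1 rho.
  apply: (le_trans (probability_le1 gamma (measurable_cap u rho))).
  by rewrite lee_fin; nra.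
pose N := Num.trunc (20 * rho)^-1.
have k0 : 0 < 20 * rho by lra.
have /andP[N1 N2] : N%:R <= (20 * rho)^-1 < N.+1%:R.
  by apply: truncn_itv; rewrite invr_ge0 ltW.
have kN : 20 * rho * N%:R <= 1 by rewrite mulrC -ler_pdivlMr// mul1r.
have kN1 : 1 < 20 * rho * N%:R + 20 * rho.
  have : 20 * rho * (20 * rho)^-1 < 20 * rho * (N%:R + 1) by rewrite ltr_pM2l// natr1.
  rewrite mulfV ?gt_eqF//; lra.
pose I := ('I_N * 'I_N)%type.
pose Y (i : 'I_(#|{: I}|)) := vec3 (20 * rho * (enum_val i).1%:R) (20 * rho * (enum_val i).2%:R) 1.
pose nY i := Num.sqrt (dot (Y i) (Y i)).
have Y1 i : 1 <= dot (Y i) (Y i).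
  by rewrite dotE !vec3E mulr1 lerDr addr_ge0// -expr2 sqr_ge0.
have nY0 i : 0 < nY i by rewrite sqrtr_gt0; apply: lt_le_trans (Y1 i).
have nY2 i : nY i ^+ 2 = dot (Y i) (Y i) by rewrite sqr_sqrtr// dot_ge0.
pose y i := (nY i)^-1 *: Y i.
have yy i : dot (y i) (y i) = 1.
  by rewrite -quad1 quadZ quad1 exprVn nY2 mulVf// gt_eqF// (lt_le_trans _ (Y1 i)).
have kb (a : 'I_N) : 0 <= 20 * rho * a%:R <= 1.
  rewrite mulr_ge0 ?(ltW k0)//=; apply: le_trans kN.
  by rewrite ler_pM2l// ler_nat ltnW.
have capY i (V : G) v : (forall u, quad (dirmx V) u = dot u v ^+ 2) -> cap (y i) rho V ->
    dot (Y i) (Y i) - dot (Y i) v ^+ 2 <= rho ^+ 2 * dot (Y i) (Y i).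
  move=> qV; rewrite /cap /qset /= quadZ qV exprVn nY2 => h.
  have Y0 : 0 < dot (Y i) (Y i) := lt_le_trans ltr01 (Y1 i).
  rewrite -ler_pdivrMr// mulrBl divff ?gt_eqF//; apply: le_trans h.
  by rewrite mulrC.
have inj (a b : 'I_N) : `|20 * rho * a%:R - 20 * rho * b%:R| < 20 * rho -> a = b.
  rewrite -mulrBr normrM (gtr0_norm k0) -ltr_pdivlMl// mulVf ?gt_eqF//.
  rewrite ltr_norml => /andP[h1 h2]; apply/val_inj/eqP; rewrite eqn_leq.
  by apply/andP; split; rewrite -ltnS -(ltr_nat R) -natr1; lra.
have tI : trivIset setT (fun i => cap (y i) rho).
  apply/trivIsetP => i j _ _ ij; apply/seteqP; split=> // V [Vi Vj].
  move: ij; apply/negP; rewrite negbK; apply/eqP.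
  have [v v1 qV] := dirmx_dot V.
  have := capY i V v qV Vi; have := capY j V v qV Vj; rewrite dotE in v1.
  rewrite ![dot _ _]dotE !vec3E !mulr1 -!expr2 !mul1r => hj hi.
  rewrite -!expr2 in v1.
  have [h1 h2] := packing_separation r0 r1 (kb _) (kb _) (kb _) (kb _) v1 hi hj.
  apply: enum_val_inj; move: (inj _ _ h1) (inj _ _ h2).
  by case: (enum_val i) (enum_val j) => [? ?] [? ?] /= -> ->.
have mc i : measurable (cap (y i) rho) := measurable_cap _ _.
pose U : set G := \big[setU/set0]_(i < #|{: I}|) cap (y i) rho.
have mU : measurable U by apply: bigsetU_measurable => i _; exact: mc.
have EU := measure_semi_additive_ord gamma mc tI mU.
have : (gamma U <= 1)%E by exact: probability_le1.
rewrite EU (eq_bigr (fun=> gamma (cap u rho))); last first.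
  move=> i _; apply: gamma_qset_eq => //.
  by apply: measurable_set_ler => //; exact: measurable_funB.
have cfin : gamma (cap u rho) \is a fin_num by apply: fin_num_measure; exact: measurable_cap.
rewrite -(fineK cfin) sumEFin !lee_fin sumr_const card_ord card_prod !card_ord -[_ *+ _]mulr_natr natrM.
have N0 : 1 <= N%:R :> R.
  rewrite ler1n -ltnS -(ltr_nat R); apply: le_lt_trans N2.
  by rewrite -[leLHS]invr1 lef_pV2 ?posrE//; lra.
have f0 : 0 <= fine (gamma (cap u rho)) by rewrite fine_ge0.
move: (fine _) f0 => f f0 fN.
have h1 : 1 < 2 * (20 * rho * N%:R).
  have := ler_wpM2l (ltW k0) N0; lra.
have h2 : 1 <= (40 * rho * N%:R) ^+ 2.
  by rewrite exprn_ege1//; lra.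
have : f * 1 <= f * (40 * rho * N%:R) ^+ 2 by rewrite ler_wpM2l.
have -> : f * (40 * rho * N%:R) ^+ 2 = 1600 * rho ^+ 2 * (f * (N%:R * N%:R)) by ring.
have K0 : 0 <= 1600 * rho ^+ 2 := mulr_ge0 (ler0n _ _) (sqr_ge0 _).
move: (1600 * rho ^+ 2) K0 => K K0; rewrite mulr1 => /le_trans; apply.
by rewrite ler_piMr.
Qed.

End Caps.

Lemma grid_index (R : realType) (L b y : R) : 0 < b -> - L <= y <= L ->
  exists i : 'I_((Num.trunc (2 * L / b)).+1), i%:R * b - L <= y <= i.+1%:R * b - L.
Proof.
move=> b0 /andP[y1 y2]; set N := Num.trunc _.
have y0 : 0 <= (y + L) / b by rewrite divr_ge0 ?(ltW b0)//; lra.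
have /andP[h1 h2] := truncn_itv y0; set k := Num.trunc _ in h1 h2.
have kN : (k < N.+1)%N.
  rewrite ltnS; apply: le_truncn; rewrite ler_pM2r ?invr_gt0//; lra.
exists (Ordinal kN) => /=; move: h1 h2; rewrite ler_pdivlMr// ltr_pdivrMr// => h1 h2.
by apply/andP; split; lra.
Qed.

Lemma grid_card (R : realType) (L b : R) : 0 < b -> 0 <= L ->
  (Num.trunc (2 * L / b)).+1%:R <= 2 * L / b + 1.
Proof.
move=> b0 L0; rewrite -natr1 lerD2r.
have h : 0 <= 2 * L / b by rewrite divr_ge0 ?(ltW b0)// mulr_ge0.
by have /andP[] := truncn_itv h.
Qed.

Lemma sqr_sub_le (R : realType) (a b r : R) : `|a - b| <= r -> (a - b) ^+ 2 <= r ^+ 2.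
Proof.
move=> h; rewrite -[_ ^+ 2]real_normK ?num_real// ler_sqr// ?nnegrE//.
exact: le_trans h.
Qed.

(* On the unit sphere a coordinate bounded away from 0 is a Lipschitz function
   of the others. *)
Lemma sqr_lipschitz (R : realType) (x x' k e : R) : 0 < k -> k <= x -> k <= x' ->
  `|x ^+ 2 - x' ^+ 2| <= 2 * k * e -> `|x - x'| <= e.
Proof.
move=> k0 kx kx'; rewrite subr_sqr normrM (@ger0_norm _ (x + x')); last by lra.
move=> h; have k2 : 0 < 2 * k by lra.
rewrite -(ler_pM2l k2); apply: le_trans h; rewrite mulrC ler_wpM2l//; lra.
Qed.

Lemma norm_subr_sqr (R : realType) (y y' M e : R) : `|y| <= M -> `|y'| <= M ->
  `|y - y'| <= e -> `|y ^+ 2 - y' ^+ 2| <= 2 * M * e.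
Proof.
move=> yM yM' h; rewrite subr_sqr normrM mulrC; apply: ler_pM => //.
by apply: (le_trans (ler_normD _ _)); lra.
Qed.

Lemma slab_close (R : realType) (x y z x' y' z' rho : R) : 0 < rho -> rho <= 2^-1 ->
  x ^+ 2 + y ^+ 2 + z ^+ 2 = 1 -> x' ^+ 2 + y' ^+ 2 + z' ^+ 2 = 1 ->
  3 / 5 <= x -> 3 / 5 <= x' -> `|z| <= rho -> `|z'| <= rho -> `|y - y'| <= rho ->
  (x - x') ^+ 2 + (y - y') ^+ 2 + (z - z') ^+ 2 <= (5 * rho) ^+ 2.
Proof.
move=> r0 r1 e e' hx hx' hz hz' hy.
have z2 : `|z - z'| <= 2 * rho by apply: (le_trans (ler_normB _ _)); lra.
have y1 : `|y| <= 1.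
  by apply: norm_le_sqr => //; have := sqr_ge0 x; have := sqr_ge0 z; lra.
have y1' : `|y'| <= 1.
  by apply: norm_le_sqr => //; have := sqr_ge0 x'; have := sqr_ge0 z'; lra.
have hy2 := norm_subr_sqr y1 y1' hy.
have hz1 : `|z| <= 2^-1 := le_trans hz r1; have hz1' : `|z'| <= 2^-1 := le_trans hz' r1.
have hz2 := norm_subr_sqr hz1 hz1' z2.
have hx2 : `|x - x'| <= 4 * rho.
  apply: (sqr_lipschitz (k := 3 / 5)); rewrite ?divr_gt0//.
  have -> : x ^+ 2 - x' ^+ 2 = - ((y ^+ 2 - y' ^+ 2) + (z ^+ 2 - z' ^+ 2)).
    by clear - e e'; lra.
  by rewrite normrN; apply: (le_trans (ler_normD _ _)); clear - hy2 hz2 r0; lra.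
have := sqr_sub_le hx2; have := sqr_sub_le hy; have := sqr_sub_le z2.
have := sqr_ge0 rho; clear; rewrite !exprMn; lra.
Qed.

(** Here a, c, q are the coordinates of a scaled normal in [plane_chart]. With a bounded away from
    0, a cell for c fixes a through a^2 + c^2 = 1, and the nearly known product a q then fixes q. *)
Lemma aniso_close1 (R : realType) (a c q a' c' q' b Q : R) : 0 < b -> 1 <= Q ->
  a ^+ 2 + c ^+ 2 = 1 -> a' ^+ 2 + c' ^+ 2 = 1 -> 7 / 10 <= a -> 7 / 10 <= a' ->
  `|c - c'| <= b -> `|a * q - a' * q'| <= 2 * b -> `|q'| <= Q ->
  (a - a') ^+ 2 + (c - c') ^+ 2 + (q - q') ^+ 2 <= (9 * Q * b) ^+ 2.
Proof.
move=> b0 Q1 e e' ha ha' hc haq hq.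
have bQ : b <= Q * b by rewrite ler_peMl// ltW.
have c1 : `|c| <= 1 by apply: norm_le_sqr => //; have := sqr_ge0 a; clear - e; lra.
have c1' : `|c'| <= 1 by apply: norm_le_sqr => //; have := sqr_ge0 a'; clear - e'; lra.
have hc2 := norm_subr_sqr c1 c1' hc.
have ha2 : `|a - a'| <= 2 * b.
  apply: (sqr_lipschitz (k := 7 / 10)); rewrite ?divr_gt0//.
  have -> : a ^+ 2 - a' ^+ 2 = - (c ^+ 2 - c' ^+ 2) by clear - e e'; lra.
  by rewrite normrN; clear - hc2 b0; lra.
have hq2 : `|q - q'| <= 6 * Q * b.
  have h : `|a * (q - q')| <= 4 * Q * b.
    have -> : a * (q - q') = (a * q - a' * q') - (a - a') * q' by ring.
    apply: (le_trans (ler_normB _ _)); rewrite normrM.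
    have := ler_pM (normr_ge0 _) (normr_ge0 _) ha2 hq; clear - haq bQ; lra.
  rewrite normrM (@ger0_norm _ a) in h; last by lra.
  have := ler_wpM2r (normr_ge0 (q - q')) ha; have : 0 <= Q * b by lra.
  clear - h; lra.
have := sqr_sub_le ha2; have := sqr_sub_le hc; have := sqr_sub_le hq2.
have : b ^+ 2 <= (Q * b) ^+ 2 by rewrite ler_sqr ?nnegrE; lra.
have := sqr_ge0 (Q * b); clear; rewrite !exprMn; lra.
Qed.

(** The complementary case: with c bounded away from 0, a cell for q together with the product a q
    fixes a, because |q| >= 1/Q, and a fixes c. *)
Lemma aniso_close2 (R : realType) (a c q a' c' q' b Q : R) : 0 < b -> 1 <= Q ->
  a ^+ 2 + c ^+ 2 = 1 -> a' ^+ 2 + c' ^+ 2 = 1 -> 7 / 10 <= c -> 7 / 10 <= c' ->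
  `|q - q'| <= b -> `|a * q - a' * q'| <= 2 * b -> 1 <= Q * `|q| ->
  (a - a') ^+ 2 + (c - c') ^+ 2 + (q - q') ^+ 2 <= (9 * Q * b) ^+ 2.
Proof.
move=> b0 Q1 e e' hc hc' hq haq Qq.
have bQ : b <= Q * b by rewrite ler_peMl// ltW.
have a1 : `|a| <= 1 by apply: norm_le_sqr => //; have := sqr_ge0 c; clear - e; lra.
have a1' : `|a'| <= 1 by apply: norm_le_sqr => //; have := sqr_ge0 c'; clear - e'; lra.
have ha2 : `|a - a'| <= 3 * Q * b.
  have h : `|(a - a') * q| <= 3 * b.
    have -> : (a - a') * q = (a * q - a' * q') - a' * (q - q') by ring.
    apply: (le_trans (ler_normB _ _)); rewrite normrM.
    have := ler_pM (normr_ge0 _) (normr_ge0 _) a1' hq; clear - haq; lra.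
  rewrite normrM in h; have Q0 : 0 <= Q by lra.
  have := ler_wpM2l Q0 h; have := ler_wpM2l (normr_ge0 (a - a')) Qq; clear; lra.
have ac2 := norm_subr_sqr a1 a1' ha2.
have hc2 : `|c - c'| <= 5 * Q * b.
  apply: (sqr_lipschitz (k := 7 / 10)); rewrite ?divr_gt0//.
  have -> : c ^+ 2 - c' ^+ 2 = - (a ^+ 2 - a' ^+ 2) by clear - e e'; lra.
  rewrite normrN; have Qb0 : 0 <= Q * b by clear - b0 bQ; lra.
  clear - ac2 Qb0; lra.
have := sqr_sub_le ha2; have := sqr_sub_le hc2; have := sqr_sub_le hq.
have : b ^+ 2 <= (Q * b) ^+ 2 by rewrite ler_sqr ?nnegrE; lra.
have := sqr_ge0 (Q * b); clear; rewrite !exprMn; lra.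
Qed.

Section Slices.
Variables (R : realType) (m : 'I_4).
Hypothesis hm : m = 1%N :> nat \/ m = 2%N :> nat.
Variable gamma : probability (grass_borel R m) R.
Hypothesis hgamma : rotation_invariant gamma.
Local Notation rV := 'rV[R]_3.
Local Notation G := (grass_borel R m).
Implicit Types (u v n : rV) (V : G) (rho : R).

Lemma gamma_cap_bound : exists2 C, 0 < C & forall u rho, dot u u = 1 -> 0 < rho ->
  (gamma (cap u rho) <= (C * rho ^+ 2)%:E)%E.
Proof. by exists 1600%:R => [|*]; [rewrite ltr0n|exact: gamma_cap]. Qed.

(** For n nonzero, [dirmx V] is the projection onto the line of n. The vector is left unnormalised
    so that a normal of V can be rescaled to suit a chart. *)
Definition direction V n := forall u, quad (dirmx V) u * dot n n = dot u n ^+ 2.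

Lemma dotC u v : dot u v = dot v u.
Proof. by rewrite !dotE; lra. Qed.

Lemma dotZl a u v : dot (a *: u) v = a * dot u v.
Proof. by rewrite /dot -scalemxAl mxE. Qed.

(** The squared sine of the angle between n and n', times [dot n' n'], is the squared distance of n'
    from the line of n, hence at most |n - n'|^2; and n' has length at least 1. *)
Lemma direction_cap V n n' rho : direction V n -> 1 <= dot n n -> 1 <= dot n' n' ->
  dot (n - n') (n - n') <= rho ^+ 2 -> cap ((Num.sqrt (dot n' n'))^-1 *: n') rho V.
Proof.
move=> dV n1 n1' nn; rewrite /cap /qset /= quadZ exprVn sqr_sqrtr ?dot_ge0//.
have N0 : 0 < dot n n := lt_le_trans ltr01 n1.
have N0' : 0 < dot n' n' := lt_le_trans ltr01 n1'.
apply: le_trans nn; have -> : quad (dirmx V) n' = dot n' n ^+ 2 / dot n n.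
  by rewrite -dV mulfK// gt_eqF.
have E : dot (n - n') (n - n') = dot n n + dot n' n' - 2 * dot n' n.
  by rewrite !dotE !mxE; ring.
have D0 := dot_ge0 (n - n'); rewrite E in D0 *.
move: (dot n n) (dot n' n') (dot n' n) N0 N0' n1' D0 => N N' s N0 N0' N1' D0.
have key : 0 <= N * (N' * (N + N' - 2 * s) - N') + s ^+ 2.
  have -> : N * (N' * (N + N' - 2 * s) - N') + s ^+ 2 =
    (N - s) ^+ 2 + (N' - 1) * (N * (N + N' - 2 * s)) by ring.
  by rewrite addr_ge0 ?sqr_ge0// mulr_ge0 ?subr_ge0// mulr_ge0// ltW.
rewrite -subr_ge0.
have -> : N + N' - 2 * s - (1 - N'^-1 * (s ^+ 2 / N)) =
    (N * (N' * (N + N' - 2 * s) - N') + s ^+ 2) / (N * N').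
  by field; rewrite !gt_eqF.
exact: divr_ge0 key (mulr_ge0 (ltW N0) (ltW N0')).
Qed.

(** A class of [rel] has diameter at most rho, so a cap centred at any one of its members catches
    every V with a direction in the class. A measure bound is thus reduced to counting classes. *)
Lemma direction_cover C (I : finType) (rel : I -> rV -> Prop) (S : set G) rho :
  (forall u rho, dot u u = 1 -> 0 < rho -> (gamma (cap u rho) <= (C * rho ^+ 2)%:E)%E) ->
  0 < C -> 0 < rho -> measurable S ->
  (forall i n n', rel i n -> rel i n' -> dot (n - n') (n - n') <= rho ^+ 2) ->
  (forall V, S V -> exists i n, [/\ rel i n, direction V n & 1 <= dot n n]) ->
  (gamma S <= (#|I|%:R * (C * rho ^+ 2))%:E)%E.
Proof.
move=> HC C0 r0 mS close cov.
have /choice[F FP] : forall i, exists F : set G, [/\ measurable F,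
    (gamma F <= (C * rho ^+ 2)%:E)%E &
    forall V n, rel i n -> direction V n -> 1 <= dot n n -> F V].
  move=> i; have [[n [rn n1]]|no] := pselect (exists n, rel i n /\ 1 <= dot n n).
    exists (cap ((Num.sqrt (dot n n))^-1 *: n) rho); split.
    - exact: measurable_cap.
    - apply: HC => //; rewrite -quad1 quadZ quad1 exprVn sqr_sqrtr ?dot_ge0// mulVf//.
      by rewrite gt_eqF// (lt_le_trans ltr01 n1).
    - by move=> V n' rn' dV n1'; apply: (direction_cap dV) => //; exact: close rn' rn.
  exists set0; split => //.
    by rewrite measure0 lee_fin mulr_ge0 ?sqr_ge0// ltW.
  by move=> V n rn _ n1; apply: no; exists n.
apply: (@measure_cover_le _ _ _ gamma I S F).
- exact: mS.
- by move=> i; have [] := FP i.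
- by move=> i; have [] := FP i.
- move=> V /cov[i [n [rn dV n1]]]; exists i; have [_ _ FV] := FP i; exact: FV rn dV n1.
Qed.

Lemma direction_ex V : exists2 v, dot v v = 1 & direction V v.
Proof.
have [v v1 qV] := dirmx_dot hm V; exists v => // u.
by rewrite v1 mulr1 qV.
Qed.

Lemma dotZr a u v : dot u (a *: v) = a * dot u v.
Proof. by rewrite dotC dotZl dotC. Qed.

Lemma directionZ V n c : direction V n -> direction V (c *: n).
Proof. by move=> dV u; rewrite dotZl !dotZr exprMn -dV; ring. Qed.

Lemma slab_chart (a b z rho : R) : 0 < rho -> rho <= 2^-1 ->
  a ^+ 2 + b ^+ 2 + z ^+ 2 = 1 -> z ^+ 2 <= rho ^+ 2 -> b ^+ 2 <= a ^+ 2 ->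
  exists e : R, [/\ e ^+ 2 = 1, 3 / 5 <= e * a & - 1 <= e * b <= 1].
Proof.
move=> r0 r1 v1 zr ba.
have r2 : rho ^+ 2 <= 4^-1.
  by rewrite (_ : 4^-1 = 2^-1 ^+ 2) ?ler_sqr ?nnegrE ?(ltW r0)//; field.
(* From |z| <= 1/2 the larger of a^2 and b^2 is at least 3/8, which exceeds (3/5)^2. *)
have : 3 / 5 <= `|a|.
  by apply: le_norm_sqr; rewrite ?divr_ge0//; clear - zr ba r2 v1; lra.
have : `|b| <= 1.
  by apply: norm_le_sqr => //; have := sqr_ge0 a; have := sqr_ge0 z; clear - v1; lra.
rewrite ler_norml => /andP[b1 b2].
move=> ha; have [p|p] := leP 0 a.
  rewrite (ger0_norm p) in ha; exists 1.
  by rewrite expr1n !mul1r; split=> //; apply/andP.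
rewrite (ltr0_norm p) in ha; exists (- 1).
by rewrite sqrrN expr1n !mulN1r; split=> //; apply/andP; split; lra.
Qed.

(** Directions nearly orthogonal to u lie close to a great circle, which is covered by O(1 / rho)
    caps of radius 5 rho. Invariance moves u to the vertical axis, where the larger horizontal
    coordinate serves as a chart condition. *)
Lemma gamma_slab : exists2 C, 0 < C & forall u rho, dot u u = 1 -> 0 < rho ->
  (gamma (qset u [set x | (x <= rho ^+ 2)%R]) <= (C * rho)%:E)%E.
Proof.
have [C C0 HC] := gamma_cap_bound.
exists (2 + 2 * (5 * 25 * C)) => [|u rho u1 r0].
  by rewrite addr_gt0// !mulr_gt0.
have mle : measurable [set x : R | x <= rho ^+ 2] by exact: measurable_set_ler.
pose e3 : rV := vec3 0 0 1.
have e31 : dot e3 e3 = 1 by rewrite dotE !vec3E !mulr0 !add0r mulr1.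
rewrite (gamma_qset_eq hgamma mle u1 e31).
have [r1|r1] := ltP 2^-1 rho.
  apply: (le_trans (probability_le1 gamma (measurable_qset e3 mle))).
  have : 0 <= C * rho by rewrite mulr_ge0 ?ltW.
  by rewrite lee_fin; lra.
pose I := (bool * 'I_((Num.trunc (2 * 1 / rho)).+1))%type.
pose rel (i : I) n := [/\ dot n n = 1, `|n 0 (ord3 2)| <= rho,
  3 / 5 <= (if i.1 then n 0 (ord3 0) else n 0 (ord3 1)) &
  i.2%:R * rho - 1 <= (if i.1 then n 0 (ord3 1) else n 0 (ord3 0)) <= i.2.+1%:R * rho - 1].
have r5 : 0 < 5 * rho by rewrite mulr_gt0.
apply: (le_trans (direction_cover (rel := rel) HC C0 r5 (measurable_qset e3 mle) _ _)).
- move=> [[] i] n n' [n1 n2 n3 /andP[n4 n5]] [n1' n2' n3' /andP[n4' n5']] /=;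
    rewrite /= in n3 n4 n5 n3' n4' n5'; rewrite -natr1 in n5; rewrite -natr1 in n5';
    rewrite dotE -!expr2 in n1; rewrite dotE -!expr2 in n1'; rewrite dotE !mxE -!expr2.
    apply: slab_close => //; rewrite ler_norml; apply/andP.
    by split; clear - n4 n5 n4' n5'; lra.
  rewrite [X in X + _]addrC; apply: slab_close => //; rewrite 1?[X in X + _]addrC//.
  by rewrite ler_norml; apply/andP; split; clear - n4 n5 n4' n5'; lra.
- move=> V; rewrite /qset /=; have [v v1 dV] := direction_ex V.
  have -> : quad (dirmx V) e3 = v 0 (ord3 2) ^+ 2.
    by rewrite -[LHS]mulr1 -v1 dV dotE !vec3E !mul0r !add0r mul1r.
  move=> v2; have v1' := v1; rewrite dotE -!expr2 in v1'.
  have dn (e : R) : e ^+ 2 = 1 -> dot (e *: v) (e *: v) = 1.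
    by move=> e1; rewrite dotZl dotZr mulrA -expr2 e1 v1 mulr1.
  have n2 (e : R) : e ^+ 2 = 1 -> `|(e *: v) 0 (ord3 2)| <= rho.
    by move=> e1; rewrite mxE; apply: norm_le_sqr; rewrite ?(ltW r0)// exprMn e1 mul1r.
  have [h|h] := leP (v 0 (ord3 1) ^+ 2) (v 0 (ord3 0) ^+ 2).
    have [e [e1 ea eb]] := slab_chart r0 r1 v1' v2 h.
    have [i hi] := grid_index r0 eb.
    exists (true, i), (e *: v); split; [split=> //=|exact: directionZ|].
    + exact: dn.
    + exact: n2.
    + by rewrite mxE.
    + by rewrite mxE.
    + by rewrite dn.
  rewrite [X in X + _]addrC in v1'.
  have [e [e1 ea eb]] := slab_chart r0 r1 v1' v2 (ltW h).
  have [i hi] := grid_index r0 eb.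
  exists (false, i), (e *: v); split; [split=> //=|exact: directionZ|].
  + exact: dn.
  + exact: n2.
  + by rewrite mxE.
  + by rewrite mxE.
  + by rewrite dn.
rewrite lee_fin card_prod card_bool card_ord natrM.
have := grid_card r0 ler01; set N := _%:R => hN.
have N0 : N * rho <= 5 / 2.
  have : N * rho <= (2 * 1 / rho + 1) * rho by rewrite ler_wpM2r// ltW.
  by rewrite mulrDl divfK ?gt_eqF//; lra.
have -> : 2 * N * (C * (5 * rho) ^+ 2) = (N * rho) * (50 * C * rho) by ring.
have Cr : 0 < C * rho by rewrite mulr_gt0.
apply: (@le_trans _ _ (5 / 2 * (50 * C * rho))).
  by rewrite ler_wpM2r// -mulrA mulr_ge0// ltW.
lra.
Qed.

End Slices.

(** * Measure of the subspaces onto which a vector projects to a short one *)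

(** The first bound holds because the multiple of v drops out of the horizontal cross product. The
    third says that a vector with short projection to a plane that is not nearly horizontal has its
    time coordinate controlled by its horizontal length; [gamma_dyadic] can therefore measure scales
    by [hnorm]. *)
Lemma plane_coordinates (R : realType) (x0 x1 x2 v0 v1 v2 r Q : R) (s := x0 * v0 + x1 * v1 + x2 * v2) :
  0 < r -> 1 <= Q -> v0 ^+ 2 + v1 ^+ 2 + v2 ^+ 2 = 1 ->
  (x0 - s * v0) ^+ 2 + (x1 - s * v1) ^+ 2 + `|x2 - s * v2| <= r ^+ 2 ->
  1 <= Q * (1 - v2 ^+ 2) ->
  [/\ (- x1 * v0 + x0 * v1) ^+ 2 <= r ^+ 2 * (1 - v2 ^+ 2),
     `|x2 * (1 - v2 ^+ 2) - (x0 * v0 + x1 * v1) * v2| <= r ^+ 2 &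
     `|x2| <= Q * (r ^+ 2 + Num.sqrt (x0 ^+ 2 + x1 ^+ 2))].
Proof.
move=> r0 Q1 vv hw hQ.
have h2 : 1 - v2 ^+ 2 = v0 ^+ 2 + v1 ^+ 2 by clear - vv; lra.
have w2E : x2 - s * v2 = x2 * (1 - v2 ^+ 2) - (x0 * v0 + x1 * v1) * v2 by rewrite /s; ring.
have hw2 : `|x2 * (1 - v2 ^+ 2) - (x0 * v0 + x1 * v1) * v2| <= r ^+ 2.
  by rewrite -w2E; have := sqr_ge0 (x0 - s * v0); have := sqr_ge0 (x1 - s * v1); clear - hw; lra.
split=> //.
  have -> : - x1 * v0 + x0 * v1 = (x0 - s * v0) * v1 - (x1 - s * v1) * v0 by ring.
  have hw' : (x0 - s * v0) ^+ 2 + (x1 - s * v1) ^+ 2 <= r ^+ 2.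
    by have := normr_ge0 (x2 - s * v2); clear - hw; lra.
  move: (x0 - s * v0) (x1 - s * v1) hw' => w0 w1 hw'; rewrite h2.
  apply: (@le_trans _ _ ((w0 ^+ 2 + w1 ^+ 2) * (v0 ^+ 2 + v1 ^+ 2))).
    have := sqr_ge0 (w0 * v0 + w1 * v1); clear; lra.
  by rewrite ler_wpM2r// addr_ge0// sqr_ge0.
set xi := Num.sqrt _.
have xi0 : 0 <= xi by exact: sqrtr_ge0.
have xi2 : xi ^+ 2 = x0 ^+ 2 + x1 ^+ 2 by rewrite sqr_sqrtr// addr_ge0// sqr_ge0.
have v21 : `|v2| <= 1.
  by apply: norm_le_sqr => //; have := sqr_ge0 v0; have := sqr_ge0 v1; clear - vv; lra.
have hx : `|x0 * v0 + x1 * v1| <= xi.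
  apply: norm_le_sqr => //; rewrite xi2.
  apply: (@le_trans _ _ ((x0 ^+ 2 + x1 ^+ 2) * (v0 ^+ 2 + v1 ^+ 2))).
    have := sqr_ge0 (x0 * v1 - x1 * v0); clear; lra.
  rewrite ler_piMr ?addr_ge0 ?sqr_ge0//; have := sqr_ge0 v2; clear - vv; lra.
have hh : 0 <= 1 - v2 ^+ 2 by rewrite h2 addr_ge0// sqr_ge0.
have hx2 : `|x2| * (1 - v2 ^+ 2) <= r ^+ 2 + xi.
  rewrite -{1}(ger0_norm hh) -normrM.
  rewrite -[x2 * _](subrK ((x0 * v0 + x1 * v1) * v2)).
  apply: (le_trans (ler_normD _ _)); apply: lerD => //.
  by rewrite normrM -[xi]mulr1; apply: ler_pM.
have Q0 : 0 <= Q by clear - Q1; lra.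
apply: le_trans (ler_wpM2l Q0 hx2).
by rewrite mulrCA ler_peMr.
Qed.

Section Aniso.
Variables (R : realType) (m : 'I_4).
Variable gamma : probability (grass_borel R m) R.
Hypothesis hgamma : rotation_invariant gamma.
Local Notation rV := 'rV[R]_3.
Local Notation G := (grass_borel R m).
Local Notation o0 := (ord3 0).
Local Notation o1 := (ord3 1).
Local Notation o2 := (ord3 2).
Implicit Types (x v n : rV) (V : G).

(* The squared vertical coordinate of the unit direction (m = 1) or unit normal
   (m = 2) of V; the parabolic estimates degenerate where it is 0 or 1. *)
Definition vert (V : grassmannian R m) : R := quad (dirmx V) (vec3 0 0 1).

Lemma vert_direction (V : grassmannian R m) v : dot v v = 1 -> dirmx V = v^T *m v ->
  vert V = v 0 o2 ^+ 2.
Proof.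
by move=> v1 E; rewrite /vert E quad_rank1 dotE !vec3E !mul0r !add0r mul1r.
Qed.

Section Line.
Hypothesis hm1 : m = 1%N :> nat.

Lemma grass_proj_line V : exists v, [/\ dot v v = 1, dirmx V = v^T *m v &
  forall x, x *m grass_proj_mx V = dot x v *: v].
Proof.
have [v v1 E] := unit_direction (or_introl hm1) V; exists v; split=> // x.
move: E; rewrite /dirmx hm1 eqxx => ->.
by rewrite mulmxA dot_scalar mul_scalar_mx.
Qed.

(** The time component is the binding one: it gives |x . v| |v_t| <= r^2, where v_t is bounded below
    by means of [vert]. So V lies in a slab of width of order r^2 / |x| instead of r / |x|. *)
Lemma gamma_line Q : 1 <= Q -> exists2 C, 0 < C & forall x r (S : set G),
  measurable S -> 0 < r -> 0 < dot x x ->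
  (forall V, S V -> parabolic_norm (x *m grass_proj_mx V) <= r /\ 1 <= Q * vert V) ->
  (gamma S <= (C * (r ^+ 2 / Num.sqrt (dot x x)))%:E)%E.
Proof.
move=> Q1; have Q0 : 0 < Q by apply: lt_le_trans Q1.
have [C C0 HC] := gamma_slab (or_introl hm1) hgamma.
exists (C * Q) => [|x r S mS r0 x0 HS]; first exact: mulr_gt0.
set N := Num.sqrt (dot x x); have N0 : 0 < N by rewrite sqrtr_gt0.
have N2 : N ^+ 2 = dot x x by rewrite sqr_sqrtr// ltW.
have rho0 : 0 < Q * r ^+ 2 / N by rewrite divr_gt0// mulr_gt0// exprn_gt0.
have u1 : dot (N^-1 *: x) (N^-1 *: x) = 1.
  by rewrite -quad1 quadZ quad1 exprVn N2 mulVf// gt_eqF.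
have -> : C * Q * (r ^+ 2 / N) = C * (Q * r ^+ 2 / N) by ring.
apply: le_trans (HC (N^-1 *: x) _ u1 rho0); apply: le_measure; rewrite ?inE//.
  by apply: measurable_qset; exact: measurable_set_ler.
move=> V SV; have [v [v1 E xP]] := grass_proj_line V; have [h1 h2] := HS V SV.
rewrite /qset /= quadZ E quad_rank1 exprVn expr_div_n [N^-2 * _]mulrC ler_pM2r; last first.
  by rewrite invr_gt0 exprn_gt0.
rewrite (vert_direction v1 E) in h2.
have : parabolic_norm (x *m grass_proj_mx V) ^+ 2 <= r ^+ 2.
  by rewrite ler_sqr ?nnegrE ?parabolic_norm_ge0 ?(ltW r0).
rewrite xP sqr_parabolic_norm !mxE.
move: (dot x v) (v 0 o0) (v 0 o1) (v 0 o2) h2 => s a b c h2 h3.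
have h4 : `|s * c| <= r ^+ 2.
  by have := sqr_ge0 (s * a); have := sqr_ge0 (s * b); lra.
have h5 : (s * c) ^+ 2 <= (r ^+ 2) ^+ 2.
  by rewrite -[(s * c) ^+ 2]real_normK ?num_real// ler_sqr ?nnegrE ?sqr_ge0.
have h6 : s ^+ 2 <= Q * (s * c) ^+ 2.
  rewrite exprMn mulrCA; apply: ler_peMr => //; exact: sqr_ge0.
apply: (le_trans h6); have -> : (Q * r ^+ 2) ^+ 2 = Q * (Q * (r ^+ 2) ^+ 2) by ring.
rewrite ler_pM2l//.
by apply: (le_trans h5); rewrite ler_peMl// sqr_ge0.
Qed.

End Line.

Section Plane.
Hypothesis hm2 : m = 2%N :> nat.

Lemma grass_proj_plane V : exists v, [/\ dot v v = 1, dirmx V = v^T *m v &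
  forall x, x *m grass_proj_mx V = x - dot x v *: v].
Proof.
have [v v1 E] := unit_direction (or_intror hm2) V; exists v; split=> // x.
have -> : grass_proj_mx V = 1%:M - v^T *m v.
  by rewrite -E /dirmx hm2 /= opprB addrCA subrr addr0.
by rewrite mulmxBr mulmx1 mulmxA dot_scalar mul_scalar_mx.
Qed.

(* n is the normal scaled to horizontal length 1; a and c are its horizontal
   coordinates along x and across x. *)
Definition plane_chart Q x r n (xi := Num.sqrt (x 0 o0 ^+ 2 + x 0 o1 ^+ 2))
    (a := (x 0 o0 * n 0 o0 + x 0 o1 * n 0 o1) / xi)
    (c := (- x 0 o1 * n 0 o0 + x 0 o0 * n 0 o1) / xi) (q := n 0 o2) :=
  [/\ a ^+ 2 + c ^+ 2 = 1, xi * `|c| <= r, `|x 0 o2 - xi * (a * q)| <= Q * r ^+ 2,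
    `|q| <= Q & 1 <= Q * `|q|].

Lemma plane_chartN Q x r n : plane_chart Q x r n -> plane_chart Q x r (- n).
Proof.
rewrite /plane_chart; set xi := Num.sqrt _.
have -> : (x 0 o0 * (- n) 0 o0 + x 0 o1 * (- n) 0 o1) / xi =
  - ((x 0 o0 * n 0 o0 + x 0 o1 * n 0 o1) / xi) by rewrite !mxE; ring.
have -> : (- x 0 o1 * (- n) 0 o0 + x 0 o0 * (- n) 0 o1) / xi =
  - ((- x 0 o1 * n 0 o0 + x 0 o0 * n 0 o1) / xi) by rewrite !mxE; ring.
have -> : (- n) 0 o2 = - n 0 o2 by rewrite mxE.
by rewrite !sqrrN mulrNN !normrN.
Qed.

(** A normal that is not nearly vertical can be scaled to horizontal length 1 by a bounded factor,
    so that |q| <= Q; a normal that is not nearly horizontal keeps |q| >= 1/Q. *)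
Lemma plane_chart_ex Q x r V : 0 < r -> 1 <= Q ->
  0 < x 0 o0 ^+ 2 + x 0 o1 ^+ 2 ->
  parabolic_norm (x *m grass_proj_mx V) <= r -> 1 <= Q * vert V -> 1 <= Q * (1 - vert V) ->
  exists n, [/\ plane_chart Q x r n, direction V n & 1 <= dot n n].
Proof.
move=> r0 Q1 x0 hr; have [v [v1 E xP]] := grass_proj_plane V.
rewrite (vert_direction v1 E) => hq1 hq2.
have Q0 : 0 < Q by apply: lt_le_trans Q1.
have h2 : 0 < 1 - v 0 o2 ^+ 2 by rewrite -(pmulr_rgt0 _ Q0); apply: lt_le_trans hq2.
pose h := Num.sqrt (1 - v 0 o2 ^+ 2); have h0 : 0 < h by rewrite sqrtr_gt0.
have hh : h ^+ 2 = 1 - v 0 o2 ^+ 2 by rewrite sqr_sqrtr// ltW.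
have vv : v 0 o0 ^+ 2 + v 0 o1 ^+ 2 + v 0 o2 ^+ 2 = 1 by rewrite -v1 dotE; ring.
have dV : direction V v by move=> u; rewrite E quad_rank1 v1 mulr1.
have : parabolic_norm (x *m grass_proj_mx V) ^+ 2 <= r ^+ 2.
  by rewrite ler_sqr ?nnegrE ?parabolic_norm_ge0 ?(ltW r0).
rewrite xP sqr_parabolic_norm !mxE dotE => hw.
have [hc ha _] := plane_coordinates r0 Q1 vv hw hq2.
exists (h^-1 *: v); split; last 2 first.
- exact: directionZ.
- rewrite dotZl dotZr v1 mulr1 -invfM -expr2 hh invf_ge1 ?lerBlDr ?lerDl ?sqr_ge0//.
rewrite /plane_chart !mxE; set xi := Num.sqrt _.
have xi0 : 0 < xi by rewrite sqrtr_gt0.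
have xi2 : xi ^+ 2 = x 0 o0 ^+ 2 + x 0 o1 ^+ 2 by rewrite sqr_sqrtr// ltW.
move: (x 0 o0) (x 0 o1) (x 0 o2) (v 0 o0) (v 0 o1) (v 0 o2) xi2 vv hq1 hq2 hh hc ha
  => a0 a1 a2 w0 w1 w2 xi2 vv hq1 hq2 hh hc ha.
have hw01 : h ^+ 2 = w0 ^+ 2 + w1 ^+ 2 by rewrite hh -vv; ring.
have q2 : (h^-1 * w2) ^+ 2 * h ^+ 2 = w2 ^+ 2.
  by rewrite -exprMn; congr (_ ^+ 2); field; rewrite gt_eqF.
have hle1 : h ^+ 2 <= 1 by rewrite hh lerBlDr lerDl sqr_ge0.
have wle1 : w2 ^+ 2 <= 1.
  by rewrite -vv lerDr addr_ge0// sqr_ge0.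
split.
- rewrite !expr_div_n -mulrDl xi2.
  have -> : (a0 * (h^-1 * w0) + a1 * (h^-1 * w1)) ^+ 2 + (- a1 * (h^-1 * w0) + a0 * (h^-1 * w1)) ^+ 2
     = (a0 ^+ 2 + a1 ^+ 2) * (h ^+ 2)^-1 * (w0 ^+ 2 + w1 ^+ 2).
    by field; rewrite gt_eqF.
  rewrite -hw01 divfK ?divff// ?gt_eqF// ?exprn_gt0// -xi2 exprn_gt0//.
- rewrite -{1}(gtr0_norm xi0) -normrM mulrC divfK ?gt_eqF//.
  apply: norm_le_sqr; first exact: ltW.
  have -> : - a1 * (h^-1 * w0) + a0 * (h^-1 * w1) = (- a1 * w0 + a0 * w1) / h by ring.
  by rewrite expr_div_n ler_pdivrMr ?exprn_gt0// hh.
- have -> : a2 - xi * ((a0 * (h^-1 * w0) + a1 * (h^-1 * w1)) / xi * (h^-1 * w2)) =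
    (a2 * h ^+ 2 - (a0 * w0 + a1 * w1) * w2) / h ^+ 2.
    by field; rewrite !gt_eqF.
  rewrite -hh in ha; rewrite normrM [`|_^-1|]ger0_norm ?invr_ge0 ?exprn_ge0 ?(ltW h0)//.
  rewrite ler_pdivrMr ?exprn_gt0//; apply: (le_trans ha).
  rewrite mulrAC ler_peMl ?sqr_ge0//.
  by rewrite hh.
- apply: norm_le_sqr; first exact: ltW.
  rewrite -(ler_pM2r (exprn_gt0 2 h0)) q2 expr2 -mulrA.
  apply: (le_trans wle1); rewrite hh; apply: (le_trans hq2).
  by rewrite ler_peMl// (le_trans ler01).
- rewrite -(@ler_pXn2r _ 2)// ?nnegrE ?mulr_ge0 ?(ltW Q0)// expr1n exprMn real_normK ?num_real//.
  have qw : w2 ^+ 2 <= (h^-1 * w2) ^+ 2.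
    by rewrite -q2 ler_piMr ?sqr_ge0.
  rewrite expr2 -mulrA; apply: (le_trans hq1).
  apply: (@le_trans _ _ (Q * (h^-1 * w2) ^+ 2)); first by rewrite ler_pM2l.
  by rewrite ler_peMl// mulr_ge0 ?sqr_ge0 ?ltW.
Qed.

End Plane.
End Aniso.

Section AnisoBound.
Variables (R : realType) (m : 'I_4).
Variable gamma : probability (grass_borel R m) R.
Hypothesis hgamma : rotation_invariant gamma.
Hypothesis hm2 : m = 2%N :> nat.
Local Notation rV := 'rV[R]_3.
Local Notation G := (grass_borel R m).
Local Notation o0 := (ord3 0).
Local Notation o1 := (ord3 1).
Local Notation o2 := (ord3 2).
Implicit Types (x v n : rV) (V : G).

Definition hnorm x : R := Num.sqrt (x 0 o0 ^+ 2 + x 0 o1 ^+ 2).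
Definition along x n : R := (x 0 o0 * n 0 o0 + x 0 o1 * n 0 o1) / hnorm x.
Definition across x n : R := (- x 0 o1 * n 0 o0 + x 0 o0 * n 0 o1) / hnorm x.

Lemma sqr_hnorm x : hnorm x ^+ 2 = x 0 o0 ^+ 2 + x 0 o1 ^+ 2.
Proof. by rewrite sqr_sqrtr// addr_ge0// sqr_ge0. Qed.

Lemma dot_along_across x n n' : 0 < hnorm x -> dot (n - n') (n - n') =
  (along x n - along x n') ^+ 2 + (across x n - across x n') ^+ 2 + (n 0 o2 - n' 0 o2) ^+ 2.
Proof.
move=> x0; have h2 := sqr_hnorm x; rewrite /along /across dotE !mxE.
move: (hnorm x) (x 0 o0) (x 0 o1) (n 0 o0) (n 0 o1) (n 0 o2) (n' 0 o0) (n' 0 o1) (n' 0 o2) x0 h2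
  => h a0 a1 b0 b1 b2 c0 c1 c2 h0 h2.
rewrite -!mulrBl !expr_div_n -mulrDl.
have -> : (a0 * b0 + a1 * b1 - (a0 * c0 + a1 * c1)) ^+ 2 +
  (- a1 * b0 + a0 * b1 - (- a1 * c0 + a0 * c1)) ^+ 2 =
  ((b0 - c0) ^+ 2 + (b1 - c1) ^+ 2) * (a0 ^+ 2 + a1 ^+ 2) by ring.
by rewrite -h2 mulfK ?expf_neq0 ?gt_eqF// -!expr2.
Qed.

Lemma unit_pair_large (a c : R) : a ^+ 2 + c ^+ 2 = 1 -> c ^+ 2 <= a ^+ 2 -> 7 / 10 <= `|a|.
Proof. by move=> e h; apply: le_norm_sqr; rewrite ?divr_ge0//; lra. Qed.

Lemma alongN x n : along x (- n) = - along x n.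
Proof. by rewrite /along !mxE; ring. Qed.

Lemma acrossN x n : across x (- n) = - across x n.
Proof. by rewrite /across !mxE; ring. Qed.

Lemma directionN V n : direction V n -> direction V (- n).
Proof. by rewrite -scaleN1r; exact: directionZ. Qed.

Lemma dotNN n : dot (- n) (- n) = dot n n.
Proof. by rewrite -scaleN1r dotZl dotZr; ring. Qed.

(** The normals form a strip of thickness b about the curve where [along * q] is constant, so cells
    in one coordinate suffice: [across] where [along] dominates, q where [across] dominates. The
    second family has M cells; M = 0 expresses that it does not occur. The larger of the two
    horizontal coordinates is at least 7/10 since 49/100 < 1/2. *)
Lemma gamma_plane_count C Q x r (S : set G) L M (b := Q * r ^+ 2 / hnorm x) :
  (forall u rho, dot u u = 1 -> 0 < rho -> (gamma (cap u rho) <= (C * rho ^+ 2)%:E)%E) ->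
  0 < C -> 1 <= Q -> 0 < r -> 0 < hnorm x -> measurable S ->
  (forall V, S V -> [/\ parabolic_norm (x *m grass_proj_mx V) <= r,
     1 <= Q * vert V & 1 <= Q * (1 - vert V)]) ->
  (forall n, plane_chart Q x r n -> - L <= across x n <= L) ->
  (forall n, plane_chart Q x r n -> 7 / 10 <= across x n -> exists i : 'I_M,
     i%:R * b - Q <= n 0 o2 <= i.+1%:R * b - Q) ->
  (gamma S <= (((Num.trunc (2 * L / b)).+1 + M)%:R * (C * (9 * Q * b) ^+ 2))%:E)%E.
Proof.
move=> HC C0 Q1 r0 x0 mS HS HL HM.
have Q0 : 0 < Q by apply: lt_le_trans Q1.
have b0 : 0 < b by rewrite divr_gt0// mulr_gt0// exprn_gt0.
have x2 : 0 < x 0 o0 ^+ 2 + x 0 o1 ^+ 2 by rewrite -sqr_hnorm exprn_gt0.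
pose N := (Num.trunc (2 * L / b)).+1; pose I := ('I_N + 'I_M)%type.
pose rel (i : I) n := plane_chart Q x r n /\ match i with
  | inl j => 7 / 10 <= along x n /\ j%:R * b - L <= across x n <= j.+1%:R * b - L
  | inr j => 7 / 10 <= across x n /\ j%:R * b - Q <= n 0 o2 <= j.+1%:R * b - Q end.
have rho0 : 0 < 9 * Q * b by rewrite mulr_gt0// mulr_gt0.
have -> : (N + M)%N = #|{: I}| by rewrite card_sum !card_ord.
have gap (k : nat) (y y' e : R) : k%:R * b - e <= y <= k.+1%:R * b - e ->
    k%:R * b - e <= y' <= k.+1%:R * b - e -> `|y - y'| <= b.
  rewrite -natr1 => /andP[h1 h2] /andP[h3 h4].
  by rewrite ler_norml; apply/andP; split; lra.
have aq n n' : plane_chart Q x r n -> plane_chart Q x r n' ->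
    `|along x n * n 0 o2 - along x n' * n' 0 o2| <= 2 * b.
  move=> [_ _ h _ _] [_ _ h' _ _].
  rewrite -(ler_pM2l x0) -{1}(gtr0_norm x0) -normrM.
  have -> : hnorm x * (2 * b) = 2 * (Q * r ^+ 2) by rewrite /b; field; rewrite gt_eqF.
  have -> : hnorm x * (along x n * n 0 o2 - along x n' * n' 0 o2) =
    (x 0 o2 - hnorm x * (along x n' * n' 0 o2)) - (x 0 o2 - hnorm x * (along x n * n 0 o2)).
    by ring.
  apply: (le_trans (ler_normB _ _)); rewrite mulr_natl mulr2n; exact: lerD.
apply: (direction_cover (rel := rel) HC C0 rho0 mS).
- move=> i n n' [pn hn] [pn' hn']; rewrite (dot_along_across _ _ x0).
  have aqn := aq _ _ pn pn'.
  have [e _ _ q1 q2] := pn; have [e' _ _ q1' q2'] := pn'.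
  case: i hn hn' => j [hn hj] [hn' hj'].
    exact: (aniso_close1 b0 Q1 e e' hn hn' (gap _ _ _ _ hj hj') aqn q1').
  exact: (aniso_close2 b0 Q1 e e' hn hn' (gap _ _ _ _ hj hj') aqn q2).
- move=> V SV; have [h1 h2 h3] := HS V SV.
  have [n [pn dn n1]] := plane_chart_ex hm2 r0 Q1 x2 h1 h2 h3.
  have [e _ _ _ _] := pn; rewrite -/(hnorm x) -/(along x n) -/(across x n) in e.
  have [h|h] := leP (across x n ^+ 2) (along x n ^+ 2).
    have : exists n', [/\ plane_chart Q x r n', direction V n', 1 <= dot n' n' & 7 / 10 <= along x n'].
      have := unit_pair_large e h; have [p|p] := leP 0 (along x n).
        by rewrite ger0_norm// => ?; exists n.
      rewrite ltr0_norm// => ?; exists (- n); rewrite alongN dotNN; split=> //.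
        exact: plane_chartN.
      exact: directionN.
    move=> [n' [pn' dn' n1' a7]]; have [j hj] := grid_index b0 (HL _ pn').
    by exists (inl j), n'; split.
  have : exists n', [/\ plane_chart Q x r n', direction V n', 1 <= dot n' n' & 7 / 10 <= across x n'].
    have := e; rewrite addrC => /unit_pair_large /(_ (ltW h)); have [p|p] := leP 0 (across x n).
      by rewrite ger0_norm// => ?; exists n.
    rewrite ltr0_norm// => ?; exists (- n); rewrite acrossN dotNN; split=> //.
      exact: plane_chartN.
    exact: directionN.
  move=> [n' [pn' dn' n1' a7]]; have [j hj] := HM _ pn' a7.
  by exists (inr j), n'; split.
Qed.

(** Each cell has measure O(b^2) with b of order r^2 / h. If 10 r < 7 h, then |across| <= r / h <
    7/10 leaves only about (r / h) / b cells, whence r^3 / h^2. Otherwise about 1 / b cells give r^2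
    / h, which is comparable with r^3 / h^2 when also r <= h. *)
Lemma gamma_plane Q : 1 <= Q -> exists2 C, 0 < C & forall x r (S : set G),
  measurable S -> 0 < r -> r <= 1 -> 0 < hnorm x ->
  (forall V, S V -> [/\ parabolic_norm (x *m grass_proj_mx V) <= r,
     1 <= Q * vert V & 1 <= Q * (1 - vert V)]) ->
  (gamma S <= (C * (r ^+ 2 / hnorm x))%:E)%E /\
  (r <= hnorm x -> (gamma S <= (C * (r ^+ 3 / hnorm x ^+ 2))%:E)%E).
Proof.
move=> Q1; have Q0 : 0 < Q by apply: lt_le_trans Q1.
have [C C0 HC] := gamma_cap_bound (or_intror hm2) hgamma.
pose K := 81 * C * Q ^+ 2.
have K0 : 0 < K by rewrite !mulr_gt0 ?exprn_gt0 ?ltr0n.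
have KE b : C * (9 * Q * b) ^+ 2 = K * b ^+ 2 by rewrite /K; ring.
exists (2 * (Q + 6 * K * Q ^+ 2)) => [|x r S mS r0 r1 x0 HS].
  by rewrite mulr_gt0// addr_gt0// !mulr_gt0 ?exprn_gt0 ?ltr0n.
set h := hnorm x in x0 *; pose b := Q * r ^+ 2 / h.
have b0 : 0 < b by rewrite divr_gt0// mulr_gt0// exprn_gt0.
have chartc n : plane_chart Q x r n -> h * `|across x n| <= r by case.
have C1Q : 0 <= K * Q ^+ 2 by rewrite mulr_ge0 ?sqr_ge0// ltW.
have r2h : 0 < r ^+ 2 / h by rewrite divr_gt0// exprn_gt0.
have r3h : 0 < r ^+ 3 / h ^+ 2 by rewrite divr_gt0// exprn_gt0.
have [hr|hr] := ltP (10 * r) (7 * h).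
  have rh : r <= h by lra.
  have r32 : r ^+ 3 / h ^+ 2 <= r ^+ 2 / h.
    have -> : r ^+ 3 / h ^+ 2 = (r ^+ 2 / h) * (r / h) by field; rewrite gt_eqF.
    by rewrite ler_piMr ?(ltW r2h)// ler_pdivrMr// mul1r.
  suff main : (gamma S <= (2 * (Q + 6 * K * Q ^+ 2) * (r ^+ 3 / h ^+ 2))%:E)%E.
    split=> //; apply: (le_trans main); rewrite lee_fin ler_wpM2l//.
    by rewrite mulr_ge0// addr_ge0 ?(ltW Q0)// -mulrA mulr_ge0.
  have := gamma_plane_count (L := r / h) (M := 0) HC C0 Q1 r0 x0 mS HS; rewrite -/h -/b KE.
  move=> H; apply: (le_trans (H _ _)).
  - move=> n /chartc; rewrite mulrC -ler_pdivlMr// ler_norml; exact.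
  - move=> n /chartc hn a7; exfalso; move: hn; rewrite ger0_norm; last by lra.
    by have := ler_wpM2l (ltW x0) a7; lra.
  have rh0 : 0 <= r / h by rewrite divr_ge0 ?ltW.
  have := grid_card b0 rh0; rewrite addn0; set N := _%:R => hN.
  rewrite lee_fin.
  apply: (@le_trans _ _ ((2 * (r / h) / b + 1) * (K * b ^+ 2))).
    by rewrite ler_wpM2r// mulr_ge0 ?sqr_ge0// ltW.
  have -> : (2 * (r / h) / b + 1) * (K * b ^+ 2) =
      K * Q * (2 + Q * r) * (r ^+ 3 / h ^+ 2).
    by rewrite /b; field; rewrite !gt_eqF.
  rewrite ler_wpM2r ?(ltW r3h)//.
  have : K * Q * (2 + Q * r) <= K * Q * (3 * Q).
    rewrite ler_pM2l ?mulr_gt0//.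
    have : Q * r <= Q by rewrite ler_piMr// ltW.
    lra.
  have -> : K * Q * (3 * Q) = 3 * (K * Q ^+ 2) by ring.
  by move: C1Q; rewrite -[6 * K * _]mulrA; move: (K * Q ^+ 2) => z; lra.
suff main : (gamma S <= ((Q + 6 * K * Q ^+ 2) * (r ^+ 2 / h))%:E)%E.
  have B0 : 0 <= Q + 6 * K * Q ^+ 2.
    by rewrite addr_ge0 ?(ltW Q0)// -mulrA mulr_ge0.
  have BE : 0 <= (Q + 6 * K * Q ^+ 2) * (r ^+ 2 / h) by rewrite mulr_ge0// ltW.
  split=> [|rh]; apply: (le_trans main); rewrite lee_fin.
    by rewrite -[leRHS]mulrA; move: BE; set z := (Q + _) * _; clearbody z => ?; lra.
  rewrite [2 * _]mulrC -[leRHS]mulrA ler_wpM2l//.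
  have -> : 2 * (r ^+ 3 / h ^+ 2) = (r ^+ 2 / h) * (2 * r / h) by field; rewrite gt_eqF.
  rewrite ler_peMr ?(ltW r2h)// ler_pdivlMr//; lra.
have [b1|b1] := leP 1 b.
  apply: (le_trans (probability_le1 gamma mS)); rewrite lee_fin; apply: (le_trans b1).
  by rewrite /b -mulrA ler_wpM2r ?(ltW r2h)// lerDl -mulrA mulr_ge0.
have Qq n : plane_chart Q x r n -> - Q <= n 0 o2 <= Q by case=> _ _ _; rewrite ler_norml.
have := gamma_plane_count (L := 1) (M := (Num.trunc (2 * Q / b)).+1) HC C0 Q1 r0 x0 mS HS.
rewrite -/h -/b KE => H; apply: (le_trans (H _ _)).
- move=> n [e _ _ _ _]; rewrite -/(hnorm x) -/(along x n) -/(across x n) in e.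
  rewrite -ler_norml; apply: norm_le_sqr => //.
  by rewrite expr1n -e lerDr sqr_ge0.
- move=> n pn _; exact: grid_index b0 (Qq _ pn).
have h2 := grid_card b0 (ltW Q0); have h1 := grid_card b0 (@ler01 R).
rewrite natrD lee_fin.
apply: (@le_trans _ _ ((2 * 1 / b + 1 + (2 * Q / b + 1)) * (K * b ^+ 2))).
  by apply: ler_wpM2r; [rewrite mulr_ge0 ?sqr_ge0 ?(ltW K0)|exact: lerD].
have -> : (2 * 1 / b + 1 + (2 * Q / b + 1)) * (K * b ^+ 2) = K * b * (2 + 2 * Q + 2 * b).
  by field; rewrite gt_eqF.
have Kb : 0 < K * b by rewrite mulr_gt0.
apply: (@le_trans _ _ (K * b * (6 * Q))).
  by rewrite ler_pM2l//; lra.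
have -> : K * b * (6 * Q) = 6 * K * Q ^+ 2 * (r ^+ 2 / h) by rewrite /b; ring.
by rewrite ler_wpM2r ?(ltW r2h)// lerDr ltW.
Qed.

End AnisoBound.

(** * Estimates at dyadic scales *)

(** Lengths below 2^(-K), including 0, are all put into the last scale K, where only the trivial
    bound 1 for gamma is used. *)
Lemma dyadic_scale (R : realType) (N : R) K : N <= 2 ->
  exists j, [/\ (j <= K)%N, N <= 2 / 2 ^+ j & j = K \/ (2 ^+ j)^-1 < N].
Proof.
move=> N2; elim: K => [|K [j [jK Nj h]]].
  by exists 0%N; rewrite expr0 divr1; split=> //; left.
case: h => [jE|h]; last by exists j; split; [exact: leqW|exact: Nj|right].
subst j; have [h|h] := leP N (2 ^+ K)^-1; last by exists K; split=> //; right.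
exists K.+1; split=> //; last by left.
by rewrite exprS invfM mulrA divff ?mul1r// pnatr_eq0.
Qed.

Lemma four_expE (R : realType) k : 4 ^+ k = (2 ^+ k) ^+ 2 :> R.
Proof. by rewrite -exprM mulnC exprM; congr (_ ^+ _); rewrite expr2; ring. Qed.

Lemma eight_expE (R : realType) k : 8 ^+ k = (2 ^+ k) ^+ 3 :> R.
Proof. by rewrite -exprM mulnC exprM; congr (_ ^+ _); rewrite !exprS expr0; ring. Qed.

Section Dyadic.
Variables (R : realType) (m : 'I_4).
Hypothesis hm : m = 1%N :> nat \/ m = 2%N :> nat.
Variable gamma : probability (grass_borel R m) R.
Hypothesis hgamma : rotation_invariant gamma.
Local Notation rV := 'rV[R]_3.
Local Notation G := (grass_borel R m).
Implicit Types (x v n : rV) (V : G).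

(* Up to a constant factor, a bound for the measure of the V whose projection maps
   a point at distance about 2^(-j) from 0 into the parabolic ball of radius 2^(-k). *)
Definition kernel_bound (k j : nat) : R :=
  if (m == 1%N :> nat) || (k <= j)%N then 2 ^+ j / 4 ^+ k else 4 ^+ j / 8 ^+ k.

Lemma coord_le_norm x i : `|x 0 i| <= Num.sqrt (dot x x).
Proof.
apply: norm_le_sqr; rewrite ?sqrtr_ge0// sqr_sqrtr ?dot_ge0// dotE -!expr2.
have := sqr_ge0 (x 0 (ord3 0)); have := sqr_ge0 (x 0 (ord3 1)); have := sqr_ge0 (x 0 (ord3 2)).
by case: (ord3E i) => ->; lra.
Qed.

Lemma norm_le2 x : (forall i, `|x 0 i| <= 1) -> Num.sqrt (dot x x) <= 2.
Proof.
move=> x1; rewrite -[leRHS]ger0_norm// -sqrtr_sqr ler_sqrt// dotE -!expr2.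
have h i : x 0 i ^+ 2 <= 1.
  by rewrite -real_normK ?num_real// expr_le1.
by have := h (ord3 0); have := h (ord3 1); have := h (ord3 2); lra.
Qed.

Lemma hnorm_le x : hnorm x <= Num.sqrt (dot x x).
Proof. by rewrite ler_sqrt ?dot_ge0// dotE -!expr2 lerDl sqr_ge0. Qed.

Lemma coord_le_hnorm x i : (i < 2)%N -> `|x 0 (ord3 i)| <= hnorm x.
Proof.
move=> i2; apply: norm_le_sqr; rewrite ?sqrtr_ge0// sqr_hnorm.
by case: i i2 => [|[|]]//= _; rewrite ?lerDl ?lerDr sqr_ge0.
Qed.

Lemma kernel_diag k : kernel_bound k k.*2 = 1.
Proof.
by rewrite /kernel_bound -addnn leq_addr orbT exprD -exprMn -natrM divff// expf_neq0// pnatr_eq0.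
Qed.

(** Scales stop at 2 k because a parabolic ball of radius 2^(-k) has time extent 4^(-k); there the
    kernel equals 1 by [kernel_diag]. *)
Lemma gamma_dyadic Q : 1 <= Q -> exists2 C, 0 < C & forall x k (S : set G),
  (forall i, `|x 0 i| <= 1) -> measurable S ->
  (forall V, S V -> [/\ parabolic_norm (x *m grass_proj_mx V) <= (2 ^+ k)^-1,
     1 <= Q * vert V & 1 <= Q * (1 - vert V)]) ->
  gamma S = 0%E \/ exists2 j, (j <= k.*2)%N &
    (forall i, `|x 0 i| <= 3 * Q / 2 ^+ j) /\ (gamma S <= (C * kernel_bound k j)%:E)%E.
Proof.
move=> Q1; have Q0 : 0 < Q by apply: lt_le_trans Q1.
have p2 k : 0 < 2 ^+ k :> R by rewrite exprn_gt0.
have sq4 k : (2 ^+ k)^-1 ^+ 2 = (4 ^+ k)^-1 :> R by rewrite four_expE exprVn.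
have trivial_scale (x : rV) k (S : set G) C : 0 <= C -> measurable S ->
    (gamma S <= ((C + 1) * kernel_bound k k.*2)%:E)%E.
  move=> C0 mS; apply: (le_trans (probability_le1 gamma mS)).
  by rewrite kernel_diag mulr1 lee_fin lerDr.
have inv_le (N : R) j : (2 ^+ j)^-1 < N -> N^-1 <= 2 ^+ j.
  move=> h; have N0 : 0 < N by apply: lt_trans h; rewrite invr_gt0.
  by rewrite -[leRHS]invrK lef_pV2 ?posrE ?invr_gt0// ltW.
case: hm => [m1|m2].
  have [C C0 HC] := gamma_line hgamma m1 Q1.
  exists (C + 1) => [|x k S x1 mS HS]; first by rewrite addr_gt0.
  right; have [j [jk Nj h]] := dyadic_scale k.*2 (norm_le2 x1).
  exists j => //; split.
    move=> i; apply: (le_trans (coord_le_norm x i)); apply: (le_trans Nj).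
    by rewrite ler_pM2r ?invr_gt0//; lra.
  case: h => [->|h]; first exact: trivial_scale (ltW C0) mS.
  have N0 : 0 < Num.sqrt (dot x x) by apply: lt_trans h; rewrite invr_gt0.
  apply: (le_trans (HC x (2 ^+ k)^-1 S mS _ _ _)).
  - by rewrite invr_gt0.
  - by rewrite sqrtr_gt0 in N0.
  - by move=> V /HS[].
  rewrite lee_fin; apply: ler_pM => //; rewrite ?(ltW C0) ?lerDl//.
  rewrite /kernel_bound m1 eqxx /= sq4 mulrC ler_pM2r ?invr_gt0 ?exprn_gt0//.
  exact: inv_le.
have [C C0 HC] := gamma_plane hgamma m2 Q1.
exists (C + 1) => [|x k S x1 mS HS]; first by rewrite addr_gt0.
(* Bounding the time coordinate of x by its horizontal part takes some V0 in S, which is why an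
   empty S is a separate alternative. *)
have [->|/set0P[V0 SV0]] := eqVneq S set0; first by left; rewrite measure0.
right; have [j [jk Nj h]] := dyadic_scale k.*2 (le_trans (hnorm_le x) (norm_le2 x1)).
exists j => //; split.
  have h01 : hnorm x <= 3 * Q / 2 ^+ j.
    by apply: (le_trans Nj); rewrite ler_pM2r ?invr_gt0//; lra.
  move=> i; case: (ord3E i) => ->.
  - by apply: le_trans h01; apply: coord_le_hnorm.
  - by apply: le_trans h01; apply: coord_le_hnorm.
  have [v [v1 E xP]] := grass_proj_plane m2 V0; have [g1 g2 g3] := HS _ SV0.
  rewrite (vert_direction v1 E) in g3.
  have r0 : 0 < (2 ^+ k)^-1 :> R by rewrite invr_gt0.
  have g4 : parabolic_norm (x *m grass_proj_mx V0) ^+ 2 <= (2 ^+ k)^-1 ^+ 2.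
    by rewrite ler_sqr ?nnegrE ?parabolic_norm_ge0 ?(ltW r0).
  rewrite xP sqr_parabolic_norm !mxE dotE in g4.
  have vv : v 0 (ord3 0) ^+ 2 + v 0 (ord3 1) ^+ 2 + v 0 (ord3 2) ^+ 2 = 1.
    by rewrite -v1 dotE; ring.
  have [_ _ b2] := plane_coordinates r0 Q1 vv g4 g3.
  apply: (le_trans b2); rewrite -/(hnorm x) [3 * Q]mulrC -mulrA ler_pM2l//.
  have : (2 ^+ k)^-1 ^+ 2 <= (2 ^+ j)^-1 :> R.
    rewrite -exprVn -exprM -[(2 ^+ j)^-1]exprVn muln2.
    by apply: ler_wiXn2l => //; rewrite ?invr_ge0 ?invf_le1 ?ler1n.
  move: Nj; move: (2 ^+ j)^-1 => z; lra.
case: h => [->|h]; first exact: trivial_scale (ltW C0) mS.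
have N0 : 0 < hnorm x by apply: lt_trans h; rewrite invr_gt0.
have k1 : (2 ^+ k)^-1 <= 1 :> R by rewrite invf_le1// exprn_ege1 ?ler1n.
have := HC x (2 ^+ k)^-1 S mS; rewrite invr_gt0 => /(_ (p2 k) k1 N0 HS)[H1 H2].
rewrite /kernel_bound m2 /=; case: leqP => kj.
  apply: (le_trans H1); rewrite lee_fin; apply: ler_pM; rewrite ?(ltW C0) ?lerDl//.
    by rewrite divr_ge0 ?sqr_ge0 ?(ltW N0).
  by rewrite sq4 mulrC ler_pM2r ?invr_gt0 ?exprn_gt0//; exact: inv_le.
have rN : (2 ^+ k)^-1 <= hnorm x.
  apply: le_trans (ltW h); rewrite lef_pV2 ?posrE// ler_eXn2l ?ltr1n//; exact: ltnW.
apply: (le_trans (H2 rN)); rewrite lee_fin; apply: ler_pM; rewrite ?(ltW C0) ?lerDl//.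
  by rewrite divr_ge0 ?sqr_ge0// exprn_ge0// invr_ge0 ltW.
rewrite mulrC; apply: ler_pM; rewrite ?invr_ge0 ?sqr_ge0 ?exprn_ge0 ?invr_ge0 ?(ltW (p2 _))//.
  by rewrite four_expE -exprVn ler_sqr ?nnegrE ?invr_ge0 ?(ltW N0) ?(ltW (p2 _))//; exact: inv_le.
by rewrite eight_expE exprVn.
Qed.

Lemma gamma_dyadic_euclid : exists2 C, 0 < C & forall x k (S : set G),
  (forall i, `|x 0 i| <= 1) -> measurable S ->
  (forall V, S V -> dot (x *m grass_proj_mx V) (x *m grass_proj_mx V) <= (2 ^+ k)^-1 ^+ 2) ->
  exists2 j, (j <= k)%N & (forall i, `|x 0 i| <= 2 / 2 ^+ j) /\
    (gamma S <= (C * (2 ^+ j / 2 ^+ k) ^+ m)%:E)%E.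
Proof.
have p2 k : 0 < 2 ^+ k :> R by rewrite exprn_gt0.
suff main : exists2 C, 0 < C & forall x k (S : set G), measurable S -> 0 < dot x x ->
    (forall V, S V -> dot (x *m grass_proj_mx V) (x *m grass_proj_mx V) <= (2 ^+ k)^-1 ^+ 2) ->
    (gamma S <= (C * ((2 ^+ k)^-1 / Num.sqrt (dot x x)) ^+ m)%:E)%E.
  have [C C0 HC] := main; exists (C + 1) => [|x k S x1 mS HS]; first by rewrite addr_gt0.
  have [j [jk Nj h]] := dyadic_scale k (norm_le2 x1); exists j => //; split.
    by move=> i; apply: (le_trans (coord_le_norm x i)).
  case: h => [->|h].
    apply: (le_trans (probability_le1 gamma mS)).
    by rewrite divff ?gt_eqF// expr1n mulr1 lee_fin lerDr ltW.
  have N0 : 0 < Num.sqrt (dot x x) by apply: lt_trans h; rewrite invr_gt0.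
  have x0 : 0 < dot x x by rewrite sqrtr_gt0 in N0.
  apply: (le_trans (HC x k S mS x0 HS)); rewrite lee_fin.
  have q0 : 0 <= (2 ^+ k)^-1 / Num.sqrt (dot x x) by rewrite divr_ge0 ?invr_ge0 ?ltW.
  apply: ler_pM; rewrite ?(ltW C0) ?exprn_ge0 ?lerDl//.
  apply: lerXn2r; rewrite ?nnegrE ?divr_ge0 ?(ltW (p2 _))//.
  rewrite mulrC ler_pM2r ?invr_gt0//.
  by rewrite -[leRHS]invrK lef_pV2 ?posrE ?invr_gt0// ltW.
have normalize x : 0 < dot x x -> dot ((Num.sqrt (dot x x))^-1 *: x) ((Num.sqrt (dot x x))^-1 *: x) = 1.
  move=> x0; rewrite -quad1 quadZ quad1 exprVn sqr_sqrtr ?ltW// mulVf// gt_eqF//.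
case: hm => [m1|m2].
  have [C C0 HC] := gamma_slab hm hgamma; exists C => // x k S mS x0 HS.
  have N0 : 0 < Num.sqrt (dot x x) by rewrite sqrtr_gt0.
  have r0 : 0 < (2 ^+ k)^-1 / Num.sqrt (dot x x) by rewrite divr_gt0// invr_gt0.
  rewrite m1 expr1; apply: le_trans (HC _ _ (normalize x x0) r0).
  apply: le_measure; rewrite ?inE//.
    by apply: measurable_qset; exact: measurable_set_ler.
  move=> V SV; have [v [v1 E xP]] := grass_proj_line m1 V.
  have := HS V SV; rewrite xP dotZl dotZr v1 mulr1 -expr2 => h.
  rewrite /qset /= quadZ E quad_rank1 expr_div_n exprVn mulrC ler_pM2r//.
  by rewrite invr_gt0 exprn_gt0.
have [C C0 HC] := gamma_cap_bound hm hgamma; exists C => // x k S mS x0 HS.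
have N0 : 0 < Num.sqrt (dot x x) by rewrite sqrtr_gt0.
have r0 : 0 < (2 ^+ k)^-1 / Num.sqrt (dot x x) by rewrite divr_gt0// invr_gt0.
rewrite m2; apply: le_trans (HC _ _ (normalize x x0) r0).
apply: le_measure; rewrite ?inE//; first exact: measurable_cap.
move=> V SV; have [v [v1 E xP]] := grass_proj_plane m2 V.
have := HS V SV; rewrite xP.
have -> : dot (x - dot x v *: v) (x - dot x v *: v) = dot x x - dot x v ^+ 2.
  have gen s : dot (x - s *: v) (x - s *: v) = dot x x - 2 * s * dot x v + s ^+ 2 * dot v v.
    by rewrite !dotE !mxE; ring.
  by rewrite gen v1; ring.
move=> h; rewrite /cap /qset /= quadZ E quad_rank1 expr_div_n exprVn sqr_sqrtr ?(ltW x0)//.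
rewrite ler_pdivlMr// mulrBl mul1r mulrAC mulVf ?mul1r// gt_eqF//.
Qed.

End Dyadic.

(** * Maximal inequalities and averages over the Grassmannian *)

Lemma measurable_EFin_indic d (X : measurableType d) (R : realType) (S : set X) :
  measurable S -> measurable_fun setT (fun x => (\1_S x)%:E : \bar R).
Proof. by move=> mS; apply/measurable_EFinP; exact: measurable_indic. Qed.

Section Maximal.
Context d (X : measurableType d) (R : realType).
Variable mu : {measure set X -> \bar R}.
Local Open Scope ereal_scope.

Lemma markov_ge0 (f : X -> \bar R) (a : R) : measurable_fun setT f ->
  (forall x, 0 <= f x) -> (0 < a)%R ->
  mu [set x | a%:E <= f x] <= (a^-1)%:E * \int[mu]_x f x.
Proof.
move=> mf f0 a0; set S := [set x | _].
have mS : measurable S.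
  rewrite -[S]setTI; exact: emeasurable_fun_c_infty.
rewrite -[leLHS]mul1e -(_ : (a^-1)%:E * a%:E = 1); last by rewrite -EFinM mulVf ?gt_eqF.
rewrite -muleA lee_pmul2l ?fin_numE// ?lte_fin ?invr_gt0//.
rewrite -[S]setIT -integral_indic// -ge0_integralZl_EFin ?(ltW a0)//; last first.
  exact: measurable_EFin_indic.
apply: ge0_le_integral => //.
- by move=> x _; rewrite mule_ge0// lee_fin ltW.
- by apply: measurable_funeM; exact: measurable_EFin_indic.
move=> x _; rewrite indicE; case: (boolP (x \in S)) => [|_]; last by rewrite mule0.
by rewrite inE mule1.
Qed.

Lemma geometric_sum_le (z : R) N : (0 < z)%R -> (z < 1)%R ->
  (\sum_(0 <= k < N) z ^+ k <= (1 - z)^-1)%R.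
Proof.
move=> z0 z1; have z10 : (0 < 1 - z)%R by rewrite subr_gt0.
rewrite -(ler_pM2l z10) mulfV ?gt_eqF//.
have -> : ((1 - z) * \sum_(0 <= k < N) z ^+ k = 1 - z ^+ N)%R.
  elim: N => [|N IH]; first by rewrite big_geq// mulr0 expr0 subrr.
  by rewrite big_nat_recr//= mulrDr IH exprS; ring.
by rewrite lerBlDr lerDl exprn_ge0// ltW.
Qed.

Lemma maximal_ineq (f : nat -> X -> \bar R) (C z t : R) :
  (forall k, measurable_fun setT (f k)) -> (forall k x, 0 <= f k x) ->
  (0 < t)%R -> (0 < z)%R -> (z < 1)%R -> (0 <= C)%R ->
  (forall k, \int[mu]_x f k x <= (C * z ^+ k)%:E) ->
  mu (\bigcup_k [set x | t%:E <= f k x]) <= (C / t / (1 - z))%:E.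
Proof.
move=> mf f0 t0 z0 z1 C0 If.
have mS k : measurable [set x | t%:E <= f k x].
  by rewrite -[[set x | _]]setTI; exact: emeasurable_fun_c_infty.
apply: (le_trans (generalized_Boole_inequality mu mS _)); first exact: bigcupT_measurable.
apply: lime_le; first by apply: is_cvg_nneseries.
apply: nearW => N.
apply: (@le_trans _ _ (\sum_(0 <= k < N) (C / t * z ^+ k)%:E)).
  apply: lee_sum => k _; apply: (le_trans (markov_ge0 (mf k) (f0 k) t0)).
  apply: (@le_trans _ _ ((t^-1)%:E * (C * z ^+ k)%:E)).
    by rewrite lee_pmul2l// lte_fin invr_gt0.
  by rewrite -EFinM lee_fin mulrA [(t^-1 * C)%R]mulrC.
rewrite sumEFin lee_fin -mulr_sumr ler_wpM2l ?divr_ge0 ?(ltW t0)//.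
exact: geometric_sum_le.
Qed.

(** After division by z2^k the Markov bounds form a convergent geometric series in z1 / z2. The
    slower rate z2 is the price for a bound valid at all k simultaneously. *)
Lemma maximal_measure (f : nat -> X -> \bar R) (C z1 z2 e : R) :
  (forall k, measurable_fun setT (f k)) -> (forall k x, 0 <= f k x) ->
  (0 < z1)%R -> (z1 < z2)%R -> (0 <= C)%R -> (0 < e)%R ->
  (forall k, \int[mu]_x f k x <= (C * z1 ^+ k)%:E) ->
  exists t : R, exists B, [/\ (0 < t)%R, measurable B, mu B <= e%:E &
    forall x, ~ B x -> forall k, f k x <= (t * z2 ^+ k)%:E].
Proof.
move=> mf f0 z10 z12 C0 e0 If; have z20 : (0 < z2)%R by apply: lt_trans z12.
pose h k x := ((z2 ^+ k)^-1)%:E * f k x.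
have z2k k : (0 < z2 ^+ k)%R by rewrite exprn_gt0.
have mh k : measurable_fun setT (h k) by apply: measurable_funeM.
have h0 k x : 0 <= h k x by rewrite mule_ge0// lee_fin invr_ge0 ltW.
have Ih k : \int[mu]_x h k x <= (C * (z1 / z2) ^+ k)%:E.
  rewrite ge0_integralZl_EFin ?invr_ge0 ?(ltW (z2k k))//.
  apply: (@le_trans _ _ (((z2 ^+ k)^-1)%:E * (C * z1 ^+ k)%:E)).
    by rewrite lee_pmul2l// lte_fin invr_gt0.
  by rewrite -EFinM lee_fin expr_div_n mulrC mulrA.
have q0 : (0 < z1 / z2)%R by rewrite divr_gt0.
have q1 : (z1 / z2 < 1)%R by rewrite ltr_pdivrMr// mul1r.
pose c := (C / (1 - z1 / z2))%R.
have c0 : (0 <= c)%R by rewrite divr_ge0// subr_ge0 ltW.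
pose t := ((c + 1) / e)%R; have t0 : (0 < t)%R by rewrite divr_gt0//; lra.
exists t, (\bigcup_k [set x | t%:E <= h k x]); split=> //.
- apply: bigcupT_measurable => k; rewrite -[[set x | _]]setTI; exact: emeasurable_fun_c_infty.
- apply: (le_trans (maximal_ineq mh h0 t0 q0 q1 C0 Ih)); rewrite lee_fin.
  rewrite mulrAC -/c ler_pdivrMr// /t mulrCA divff ?gt_eqF// mulr1; lra.
- move=> x nB k; have : ~ t%:E <= h k x by move=> ?; apply: nB; exists k.
  move/negP; rewrite -ltNge /h => /ltW hle.
  have := lee_wpmul2l (_ : 0 <= (z2 ^+ k)%:E) hle; rewrite lee_fin (ltW (z2k k)) => /(_ isT).
  by rewrite muleA -!EFinM mulfV ?gt_eqF// mul1e mulrC.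
Qed.

End Maximal.

Section Average.
Context d d' (X : measurableType d) (T : measurableType d') (R : realType).
Variable gamma : probability X R.
Variable tau : {finite_measure set T -> \bar R}.
Local Open Scope ereal_scope.

Definition energy (E : set ((X * T) * T)) V := \int[tau]_u tau (xsection E (V, u)).

Lemma measurable_energy E : measurable E -> measurable_fun setT (energy E).
Proof.
move=> mE; apply: (measurable_fun_fubini_tonelli_F (m2 := tau) (tau \o xsection E)).
- exact: measurable_fun_xsection.
- by move=> p /=.
Qed.

Lemma energy_ge0 E V : 0 <= energy E V.
Proof. exact: integral_ge0. Qed.

Lemma measurable_middle (E : set ((X * T) * T)) u : measurable E ->
  measurable [set p : X * T | E ((p.1, u), p.2)].
Proof.
move=> mE; rewrite -[[set p | _]]setTI.
suff : measurable_fun setT (fun p : X * T => ((p.1, u), p.2)) by move=> /(_ measurableT E mE).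
apply: measurable_fun_pair => //.
apply: measurable_fun_pair => //; exact: measurable_cst.
Qed.

(** By Tonelli the integral over V is taken first. For fixed u the measure of bad V is dominated by
    a step function of w, constant g j on the ball B j u. *)
Lemma average_bound (E : set ((X * T) * T)) n (B : 'I_n -> T -> set T) (g b : 'I_n -> R) :
  measurable E -> (forall j u, measurable (B j u)) -> (forall j, (0 <= g j)%R) ->
  (forall j u, tau (B j u) <= (b j)%:E) ->
  (forall u w, gamma [set V | E ((V, u), w)] <= \sum_(j < n) (g j)%:E * (\1_(B j u) w)%:E) ->
  \int[gamma]_V energy E V <= (\sum_(j < n) g j * b j)%:E * tau setT.
Proof.
move=> mE mB g0 Bb Eg.
have mtE : measurable_fun setT (tau \o xsection E) by exact: measurable_fun_xsection.
rewrite /energy (fubini_tonelli (m1 := gamma) (m2 := tau) (tau \o xsection E) mtE)//=.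
rewrite -integral_cst//; apply: ge0_le_integral => //.
- by move=> u _; apply: integral_ge0.
- exact: (measurable_fun_fubini_tonelli_G (m1 := gamma) _ mtE).
move=> u _; pose Eu := [set p : X * T | E ((p.1, u), p.2)].
have mEu : measurable Eu by exact: measurable_middle.
have -> : \int[gamma]_V tau (xsection E (V, u)) = \int[gamma]_V (tau \o xsection Eu) V.
  by apply: eq_integral => V _ /=; rewrite !xsectionE.
have := indic_fubini_tonelli gamma tau mEu.
rewrite indic_fubini_tonelli_FE// indic_fubini_tonelli_GE// => ->.
apply: (@le_trans _ _ (\int[tau]_w \sum_(j < n) (g j)%:E * (\1_(B j u) w)%:E)).
  apply: ge0_le_integral => //.
  - exact: measurable_fun_ysection.
  - apply: emeasurable_sum => j; apply: measurable_funeM; exact: measurable_EFin_indic.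
  - by move=> w _; rewrite /= ysectionE; exact: Eg.
rewrite ge0_integral_sum//; last 2 first.
- by move=> j; apply: measurable_funeM; exact: measurable_EFin_indic.
- by move=> j p _; rewrite mule_ge0// lee_fin.
rewrite -sumEFin; apply: lee_sum => j _.
rewrite ge0_integralZl_EFin//; last exact: measurable_EFin_indic.
rewrite integral_indic// setIT EFinM lee_wpmul2l ?lee_fin//.
exact: Bb.
Qed.

End Average.

(** * Dimension of projections *)

(** The factor 2 k + 1 is the number of scales j <= 2 k, the logarithm of the energy bound; any
    geometric gain absorbs it. *)
Lemma bernoulli_bound (R : realType) (z : R) : 0 < z -> z < 1 ->
  exists2 c, 0 < c & forall k, (k.*2.+1)%:R * z ^+ k <= c.
Proof.
move=> z0 z1; pose h := z^-1 - 1; have h0 : 0 < h by rewrite subr_gt0 invf_gt1.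
have bern k : 1 + k%:R * h <= z^-1 ^+ k.
  have -> : z^-1 = 1 + h by rewrite /h addrC subrK.
  elim: k => [|k IH]; first by rewrite mul0r addr0 expr0.
  have p : 0 <= 1 + h by rewrite addr_ge0// ltW.
  rewrite exprS; apply: le_trans (ler_wpM2l p IH); rewrite -natr1.
  have : 0 <= k%:R * h * h by rewrite !mulr_ge0// ltW.
  lra.
exists (1 + 2 / h); first by rewrite addr_gt0// divr_gt0.
move=> k; rewrite -ler_pdivlMr ?exprn_gt0// -exprVn.
apply: le_trans (ler_wpM2l _ (bern k)); last by rewrite addr_ge0// divr_ge0// ltW.
have -> : (1 + 2 / h) * (1 + k%:R * h) = 1 + 2 * k%:R + (k%:R * h + 2 / h) by field; rewrite gt_eqF.
rewrite -natr1 -muln2 natrM.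
have : 0 <= k%:R * h by rewrite mulr_ge0// ltW.
have : 0 <= 2 / h by rewrite divr_ge0// ltW.
lra.
Qed.

Lemma exp_small (R : realType) (q e : R) : 0 < q -> q < 1 -> 0 < e -> exists k, q ^+ k < e.
Proof.
move=> q0 q1 e0; have [c c0 H] := bernoulli_bound q0 q1.
exists (Num.bound (c / e)); set k := Num.bound _.
have h : c / e < k%:R by apply: archi_boundP; rewrite divr_ge0 ?ltW.
rewrite ltr_pdivrMr// mulrC in h.
have qk : 0 < q ^+ k by rewrite exprn_gt0.
have h1 : k%:R * q ^+ k <= c.
  apply: le_trans (H k); rewrite ler_pM2r// ler_nat -addnn; lia.
rewrite ltNge; apply/negP => h2.
have := ler_wpM2l (ler0n R k) h2; rewrite mulrC in h.
by move=> h3; have := lt_le_trans h h3; rewrite ltNge h1.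
Qed.

Lemma powR2N_lt (R : realType) (s s' : R) : s < s' -> 2 `^ (- s') < 2 `^ (- s) :> R.
Proof.
move=> ss; have p : 0 < 2 `^ (- s') :> R by rewrite powR_gt0.
have -> : - s = - s' + (s' - s) by lra.
have n20 : 2 != 0 :> R by rewrite pnatr_eq0.
rewrite powRD; last by rewrite n20 implybT.
have : 1 `^ (s' - s) < 2 `^ (s' - s) :> R.
  by apply: gt0_ltr_powR; rewrite ?nnegrE ?subr_gt0 ?ltr1n.
by rewrite powR1 ltr_pMr.
Qed.

Lemma powR2N_lt1 (R : realType) (s : R) : 0 < s -> 2 `^ (- s) < 1 :> R.
Proof. by move=> s0; have := powR2N_lt s0; rewrite oppr0 powRr0. Qed.

(** The condition on x means s <= m + 1. With the right choice of mass bound the product is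
    geometric in j up to parity, with its maximum at j = 2 k if 4 x >= 1 is used, and at j = k
    otherwise; both give x^k. The factor 2 accounts for odd j. *)
Lemma kernel_sum (R : realType) (m : 'I_4) (x : R) k j :
  m = 1%N :> nat \/ m = 2%N :> nat -> 0 < x -> x <= 1 ->
  1 <= x * 2 ^+ m.+1 -> (j <= k.*2)%N ->
  kernel_bound R m k j * x ^+ j./2 <= 2 * x ^+ k \/ kernel_bound R m k j * (2 * x) ^+ j <= 2 * x ^+ k.
Proof.
move=> hm x0 x1 xm jk; rewrite /kernel_bound.
have xk0 k' : 0 < x ^+ k' by rewrite exprn_gt0.
have jk2 : (j./2 <= k)%N by rewrite -(doubleK k) half_leq.
have low : 1 <= 4 * x -> 2 ^+ j / 4 ^+ k * x ^+ j./2 <= 2 * x ^+ k.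
  move=> x4; rewrite mulrAC ler_pdivrMr ?exprn_gt0// -mulrA [x ^+ k * _]mulrC -exprMn.
  apply: (@le_trans _ _ (2 * (4 * x) ^+ j./2)); last first.
    by rewrite ler_pM2l// ler_weXn2l.
  rewrite exprMn mulrA ler_pM2r// four_expE -exprM muln2 -exprS.
  rewrite ler_eXn2l ?ltr1n//; have := odd_double_half j; case: odd => /=; lia.
case: ifP => [mk|/negbT]; last first.
  rewrite negb_or -ltnNge => /andP[m1 jk'].
  have m2 : m = 2%N :> nat by case: hm => // e; rewrite e in m1.
  right; rewrite m2 -(mulr1n 2) in xm.
  have x8 : 1 <= 8 * x by move: xm; rewrite !exprS expr0 !mulr1n; lra.
  rewrite mulrAC -exprMn ler_pdivrMr ?exprn_gt0// -mulrA [x ^+ k * _]mulrC -exprMn.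
  have -> : 4 * (2 * x) = 8 * x by ring.
  apply: (@le_trans _ _ ((8 * x) ^+ k)); first by rewrite ler_weXn2l// ltnW.
  by rewrite ler_peMl ?exprn_ge0 ?ler1n//; lra.
have [x4|x4] := leP 1 (4 * x); first by left; exact: low.
right; case/orP: mk => [/eqP m1|kj].
  by rewrite m1 in xm; exfalso; move: xm; rewrite !exprS expr0; lra.
rewrite mulrAC -exprMn ler_pdivrMr ?exprn_gt0// -mulrA [x ^+ k * _]mulrC -exprMn.
have -> : 2 * (2 * x) = 4 * x by ring.
have x40 : 0 <= 4 * x by lra.
apply: (@le_trans _ _ ((4 * x) ^+ k)); first by rewrite ler_wiXn2l// ltW.
by rewrite ler_peMl ?exprn_ge0 ?ler1n.
Qed.

Lemma dyadic_between (R : realType) (e : R) : 0 < e -> e <= 1 ->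
  exists k, (2 ^+ k.+1)^-1 < e <= (2 ^+ k)^-1.
Proof.
move=> e0 e1; have ex : exists n, (2 ^+ n)^-1 < e := exists_half_exp_lt e0.
case: (ex_minnP ex) => -[|n] h hmin.
  by move: h; rewrite expr0 invr1 ltNge e1.
exists n; rewrite h/=; rewrite leNgt; apply/negP => h'.
by have := hmin n h'; rewrite ltnn.
Qed.

Lemma hnull_bounded (R : realType) (T : Type) (dd : T -> T -> R) (s : R) (B : nat -> set T) (e : R) i :
  (\sum_(k <oo) poweR (diam dd (B k)) s < e%:E)%E -> (poweR (diam dd (B i)) s < e%:E)%E.
Proof.
pose u k := poweR (diam dd (B k)) s.
have u0 k : (0 <= u k)%E by exact: poweR_ge0.
apply: le_lt_trans; rewrite -/(u i).
apply: le_trans (nneseries_lim_ge (u_ := u) (P := xpredT) (m := 0) i.+1 (fun _ _ _ => u0 _)).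
by rewrite big_nat_recr//= leeDr// sume_ge0.
Qed.

Lemma diam_real (R : realType) (T : Type) (dd : T -> T -> R) (s : R) (B : set T) :
  0 < s -> (poweR (diam dd B) s < 1)%E -> exists2 r : R, diam dd B = r%:E & 0 <= r <= 1.
Proof.
move=> s0; have := diam_ge0 dd B; case: (diam dd B) => [r| |] //= r0; last first.
  by rewrite (gt_eqF s0).
rewrite lte_fin => r1; exists r => //; rewrite lee_fin in r0; rewrite r0/=.
rewrite leNgt; apply/negP => r1'; move: r1; rewrite ltNge => /negP; apply.
have : 1 `^ s <= r `^ s by apply: ge0_ler_powR; rewrite ?nnegrE ?(ltW s0) ?(ltW r1').
by rewrite powR1.
Qed.

(* Mass distribution principle. *)
Lemma not_hnull_image d (T : measurableType d) (R : realType) (P : Type) (dd : P -> P -> R)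
    (tau : {finite_measure set T -> \bar R}) (psi : T -> P) (Y : set P) (B : set T) (t sigma s : R) :
  measurable B -> (tau B < tau setT)%E -> (forall u, Y (psi u)) -> 0 <= t ->
  0 < s -> s <= sigma ->
  (forall u k, measurable [set w | dd (psi u) (psi w) <= (2 ^+ k)^-1]) ->
  (forall u, ~ B u -> forall k,
     (tau [set w | (dd (psi u) (psi w) <= (2 ^+ k)^-1)%R] <= (t * (2 `^ (- sigma)) ^+ k)%:E)%E) ->
  ~ hnull dd s Y.
Proof.
move=> mB Blt psiY t0 s0 ssig md small nY.
have sig0 : 0 < sigma by apply: lt_le_trans ssig.
(* From 2^(-k) < 2 r and r <= 1 follows 2^(-sigma k) <= 2^sigma r^s, so K bounds the mass of a
   covering set by its diameter to the power s. *)
pose K := (t * 2 `^ sigma + 1); have K0 : 0 < K by rewrite ltr_wpDl// mulr_ge0// powR_ge0.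
have fT : tau setT \is a fin_num by exact: fin_num_measure.
have fB : tau B \is a fin_num by exact: fin_num_measure.
pose c := fine (tau setT) - fine (tau B).
have c0 : 0 < c by rewrite subr_gt0 -lte_fin !fineK.
(* The bound 1 forces every covering set to have finite diameter at most 1; c / K makes the total
   mass covered less than that of the complement of B. *)
pose e := Num.min 1 (c / K).
have e0 : 0 < e by rewrite lt_min ltr01 divr_gt0.
have [Cv [cov sumC]] := nY e e0.
have /choice[F FP] : forall i, exists F : set T, [/\ measurable F,
    (tau F <= (K%:E * poweR (diam dd (Cv i)) s))%E &
    forall w, ~ B w -> Cv i (psi w) -> F w].
  move=> i; have [[u [nBu Cu]]|no] := pselect (exists u, ~ B u /\ Cv i (psi u)); last first.
    exists set0; split=> //.
      by rewrite measure0 mule_ge0 ?poweR_ge0// lee_fin ltW.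
    by move=> w nBw Cw; apply: no; exists w.
  have lt1 : (poweR (diam dd (Cv i)) s < 1)%E.
    apply: (lt_le_trans (hnull_bounded i sumC)); rewrite lee_fin.
    by rewrite ge_min lexx.
  have [r rE /andP[r0 r1]] := diam_real s0 lt1.
  have inF k : r <= (2 ^+ k)^-1 -> forall w, Cv i (psi w) -> dd (psi u) (psi w) <= (2 ^+ k)^-1.
    by move=> rk w Cw; apply: le_trans rk; rewrite -lee_fin -rE; exact: le_diam.
  (* A set of diameter 0 contributes nothing to the sum, so it must receive mass 0: outside B it
     lies in balls of all radii about one good point. *)
  have [r00|r00] := eqVneq r 0.
    exists (\bigcap_k [set w | dd (psi u) (psi w) <= (2 ^+ k)^-1]); split.
    - by apply: bigcap_measurableType => k _; exact: md.
    - apply: (@le_trans _ _ 0%E); last by rewrite mule_ge0 ?poweR_ge0// lee_fin ltW.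
      apply/lee_addgt0Pr => eps eps0; rewrite add0e.
      have t1 : 0 < t + 1 by rewrite ltr_wpDl.
      have [k hk] := exp_small (powR_gt0 (- sigma) (ltr0n R 2)) (powR2N_lt1 sig0) (divr_gt0 eps0 t1).
      apply: (@le_trans _ _ (tau [set w | dd (psi u) (psi w) <= (2 ^+ k)^-1])).
        apply: le_measure; rewrite ?inE//.
          by apply: bigcap_measurableType => k' _; exact: md.
        exact: bigcap_inf.
      apply: (le_trans (small u nBu k)); rewrite lee_fin.
      move: hk; rewrite ltr_pdivlMr// => /ltW; apply: le_trans; rewrite mulrC ler_wpM2l ?exprn_ge0 ?powR_ge0//.
      by rewrite lerDl.
    - by move=> w nBw Cw k _ /=; apply: inF => //; rewrite r00 invr_ge0 exprn_ge0.
  have rp : 0 < r by rewrite lt_neqAle eq_sym r00.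
  have [k /andP[k1 k2]] := dyadic_between rp r1.
  exists [set w | dd (psi u) (psi w) <= (2 ^+ k)^-1]; split; first exact: md.
    apply: (le_trans (small u nBu k)); rewrite rE poweR_EFin -EFinM lee_fin.
    have h1 : (2 `^ (- sigma)) ^+ k <= 2 `^ sigma * r `^ s.
      rewrite -half_powR.
      apply: (@le_trans _ _ ((2 * r) `^ sigma)).
        apply: ge0_ler_powR; rewrite ?nnegrE ?(ltW sig0) ?exprn_ge0 ?invr_ge0 ?mulr_ge0//.
        by rewrite exprVn; move: k1; rewrite exprS invfM ltr_pdivrMl// => /ltW.
      rewrite powRM// ler_pM2l ?powR_gt0//.
      by apply: ger_powR => //; rewrite rp r1.
    apply: (le_trans (ler_wpM2l t0 h1)); rewrite mulrA ler_wpM2r ?powR_ge0//.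
    by rewrite lerDl.
  by move=> w nBw Cw; exact: inF.
have mF i : measurable (F i) by have [] := FP i.
have le1 : (tau (~` B) <= \sum_(i <oo) tau (F i))%E.
  apply: measure_sigma_subadditive => //; first exact: measurableC.
  move=> w nBw; have [i _ Ci] := cov (psi w) (psiY w).
  by exists i => //; have [_ _] := FP i; exact.
have le2 : (\sum_(i <oo) tau (F i) <= K%:E * \sum_(i <oo) poweR (diam dd (Cv i)) s)%E.
  rewrite -nneseriesZl; last by move=> i _; exact: poweR_ge0.
  by apply: lee_nneseries => // i _; have [] := FP i.
have : (tau (~` B) < c%:E)%E.
  apply: (le_lt_trans le1); apply: (le_lt_trans le2).
  apply: (@lt_le_trans _ _ (K%:E * e%:E)%E).
    by rewrite lte_pmul2l// lte_fin.
  by rewrite -EFinM lee_fin mulrC -ler_pdivlMr// ge_min lexx orbT.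
have := measureDI tau measurableT mB; rewrite setTD setTI => E.
have fBc : tau (~` B) \is a fin_num by apply: fin_num_measure; exact: measurableC.
rewrite -(fineK fBc) lte_fin /c E fineD//.
by rewrite addrK ltxx.
Qed.

Lemma ae_of_small d (X : measurableType d) (R : realType) (mu : {measure set X -> \bar R})
    (P : X -> Prop) :
  (forall e : R, 0 < e -> exists B, [/\ measurable B, (mu B <= e%:E)%E & forall x, ~ B x -> P x]) ->
  {ae mu, forall x, P x}.
Proof.
move=> H; have /choice[B HB] : forall n : nat, exists B, [/\ measurable B,
    (mu B <= ((n.+1%:R : R)^-1)%:E)%E & forall x, ~ B x -> P x].
  by move=> n; apply: H; rewrite invr_gt0.
exists (\bigcap_n B n); split.
- by apply: bigcap_measurableType => n _; have [] := HB n.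
- apply/eqP; rewrite eq_le measure_ge0 andbT; apply/lee_addgt0Pr => e e0; rewrite add0e.
  have [n hn] : exists n : nat, e^-1 < n%:R.
    by exists (Num.bound e^-1); apply: archi_boundP; rewrite invr_ge0 ltW.
  have [mB Bn _] := HB n; apply: (@le_trans _ _ (mu (B n))).
    apply: le_measure; rewrite ?inE//; last exact: bigcap_inf.
    by apply: bigcap_measurableType => k _; have [] := HB k.
  apply: (le_trans Bn); rewrite lee_fin -[leRHS]invrK lef_pV2 ?posrE ?invr_gt0//.
  by apply: (le_trans (ltW hn)); rewrite ler_nat.
- move=> x nPx n _; apply: contrapT => nB; apply: nPx.
  by have [_ _] := HB n; exact.
Qed.

Section Projections.
Variables (R : realType) (m : 'I_4).
Hypothesis hm : m = 1%N :> nat \/ m = 2%N :> nat.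
Variable gamma : probability (grass_borel R m) R.
Hypothesis hgamma : rotation_invariant gamma.
Local Notation G := (grass_borel R m).
Local Notation pdist := (@parabolic_dist R 2).

Lemma orth_projE (V : grassmannian R m) p : orth_proj (val V) p = p *m grass_proj_mx V.
Proof. by []. Qed.

Lemma proj_pdist (V : grassmannian R m) p q :
  pdist (orth_proj (val V) p) (orth_proj (val V) q) = parabolic_norm ((p - q) *m grass_proj_mx V).
Proof. by rewrite /parabolic_dist !orth_projE mulmxBl. Qed.

Section Family.
Context d (T : measurableType d) (phi : T -> 'rV[R]_3).
Hypothesis mphi : forall i, measurable_fun setT (fun u => phi u 0 i).

Definition proj_diff (z : (G * T) * T) : 'rV[R]_3 :=
  (phi z.1.2 - phi z.2) *m grass_proj_mx z.1.1.

Lemma measurable_proj_diff i : measurable_fun setT (fun z => proj_diff z 0 i).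
Proof.
have E z : proj_diff z 0 i =
    \sum_l (phi z.1.2 0 l - phi z.2 0 l) * grass_proj_mx z.1.1 l i.
  by rewrite mxE; apply: eq_bigr => l _; congr (_ * _); rewrite !mxE.
under eq_fun do rewrite E.
apply: measurable_sum => l; apply: measurable_funM.
  apply: measurable_funB.
    exact: (measurableT_comp (mphi l) (measurableT_comp measurable_snd measurable_fst)).
  exact: (measurableT_comp (mphi l) measurable_snd).
exact: (measurableT_comp (measurable_grass_proj l i) (measurableT_comp measurable_fst measurable_fst)).
Qed.

Definition sqr_pnorm (p : 'rV[R]_3) : R :=
  p 0 (ord3 0) ^+ 2 + p 0 (ord3 1) ^+ 2 + `|p 0 (ord3 2)|.

Lemma parabolic_norm_le (p : 'rV[R]_3) r : 0 <= r ->
  (parabolic_norm p <= r) = (sqr_pnorm p <= r ^+ 2).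
Proof. by move=> r0; rewrite /sqr_pnorm -sqr_parabolic_norm ler_sqr ?nnegrE ?parabolic_norm_ge0. Qed.

Lemma measurable_sqr_pnorm : measurable_fun setT (fun z => sqr_pnorm (proj_diff z)).
Proof.
apply: measurable_funD.
  by apply: measurable_funD; apply: measurable_funX; exact: measurable_proj_diff.
exact: (measurableT_comp (@normr_measurable _ _) (measurable_proj_diff _)).
Qed.

Lemma measurable_sqr_norm : measurable_fun setT (fun z => dot (proj_diff z) (proj_diff z)).
Proof.
under eq_fun do rewrite dotE.
by do 2?apply: measurable_funD; apply: measurable_funM; exact: measurable_proj_diff.
Qed.

(** All pairs are discarded when V is within about 1/Q of a degenerate position; for every other V
    the section at V is exactly the set of pairs with close projections. [projection_dim] lets Q run
    through the positive integers. *)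
Definition close_pairs Q k : set ((G * T) * T) := [set z | sqr_pnorm (proj_diff z) <= (2 ^+ k)^-1 ^+ 2]
  `&` [set z | 1 <= Q * vert z.1.1] `&` [set z | 1 <= Q * (1 - vert z.1.1)].

Lemma measurable_close_pairs Q k : measurable (close_pairs Q k).
Proof.
have mv : measurable_fun setT (fun z : (G * T) * T => vert z.1.1).
  apply: (measurableT_comp (f := fun V : G => vert V) _ (measurableT_comp measurable_fst measurable_fst)).
  exact: measurable_quad_dirmx.
apply: measurableI; first apply: measurableI.
- by apply: measurable_set_ler => //; exact: measurable_sqr_pnorm.
- by apply: measurable_set_ler => //; exact: measurable_funM.
- apply: measurable_set_ler => //; apply: measurable_funM => //.
  exact: measurable_funB.
Qed.

End Family.

Lemma section_measurable d d' (X : measurableType d) (T : measurableType d')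
    (E : set ((X * T) * T)) u w : measurable E -> measurable [set V | E ((V, u), w)].
Proof.
move=> mE; rewrite -[[set V | _]]setTI.
suff : measurable_fun setT (fun V : X => ((V, u), w)) by move=> /(_ measurableT E mE).
by apply: measurable_fun_pair => //; apply: measurable_fun_pair.
Qed.

Lemma energy_decay (A : set 'rV[R]_3) (s y Q : R) : 0 < s -> s <= (m.+1)%:R -> 1 <= Q ->
  2 `^ (- s) < y -> borel_set A -> ~ hnull pdist s A ->
  exists (tau : {finite_measure set (measurableTypeR R) -> \bar R}) (phi : R -> 'rV[R]_3),
  [/\ (0 < tau setT)%E, forall u, A (phi u),
    forall i, measurable_fun [set: measurableTypeR R] (fun u => phi u 0 i) &
    exists2 C : R, 0 <= C & forall k,
      (\int[gamma]_V energy tau (close_pairs phi Q k) V <= (C * y ^+ k)%:E)%E].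
Proof.
move=> s0 sm Q1 xy bA nA; pose x : R := 2 `^ (- s).
have x0 : 0 < x by rewrite powR_gt0.
have x1 : x <= 1 by rewrite ltW// powR2N_lt1.
have y0 : 0 < y by apply: lt_trans xy.
have Q0 : 0 < Q by apply: lt_le_trans Q1.
have [tau [phi [tau0 Aphi mphi phi1 bnd]]] := frostman_parabolic s0 bA nA.
exists tau, phi; split=> //.
have xm : 1 <= x * 2 ^+ m.+1.
  rewrite -powR_mulrn// /x.
  have n20 : 2 != 0 :> R by rewrite pnatr_eq0.
  rewrite -powRD; last by rewrite n20 implybT.
  have : 2 `^ 0 <= 2 `^ (- s + m.+1%:R) :> R by apply: ler_powR; rewrite ?ler1n//; lra.
  by rewrite powRr0.
have L0 : 0 < 3 * Q by rewrite mulr_gt0.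
have [C2 C20 boxes] := frostman_boxes x0 x1 bnd L0.
have [C1 C10 HC] := gamma_dyadic hm hgamma Q1.
have z0 : 0 < x / y by rewrite divr_gt0.
have z1 : x / y < 1 by rewrite ltr_pdivrMr// mul1r.
have [c c0 Hc] := bernoulli_bound z0 z1.
have kb0 k j : 0 < kernel_bound R m k j.
  by rewrite /kernel_bound; case: ifP => _; rewrite divr_gt0// exprn_gt0.
have ftau : tau setT \is a fin_num by exact: fin_num_measure.
pose K := 2 * C1 * C2; have K0 : 0 <= K by rewrite !mulr_ge0// ltW.
have t0 : 0 <= fine (tau setT) by rewrite fine_ge0.
exists (K * c * fine (tau setT)); first by rewrite !mulr_ge0// ltW.
move=> k; pose n := k.*2.+1.
pose B (j : 'I_n) u := [set w | forall i, `|phi w 0 i - phi u 0 i| <= 3 * Q / 2 ^+ j].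
pose g (j : 'I_n) := C1 * kernel_bound R m k j.
(* This bound for the mass of B j is chosen so that [g j * b j] does not depend on j; [kernel_sum]
   says that one of the two box bounds is at least as good. *)
pose b (j : 'I_n) := C2 * (2 * x ^+ k) / kernel_bound R m k j.
have mE : measurable (close_pairs (T := measurableTypeR R) phi Q k) := measurable_close_pairs mphi Q k.
have mB j u : measurable (B j u : set (measurableTypeR R)).
  have -> : B j u = \bigcap_(i in [set: 'I_3]) [set w | `|phi w 0 i - phi u 0 i| <= 3 * Q / 2 ^+ j].
    by apply/seteqP; split => w /= h; [move=> i _; exact: h|move=> i; exact: (h i I)].
  apply: fin_bigcap_measurable => [|i _]; first exact: finite_finset.
  apply: measurable_set_ler => //; apply: (measurableT_comp (@normr_measurable _ _)).
  by apply: measurable_funB; [exact: mphi|exact: measurable_cst].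
have := @average_bound _ _ G (measurableTypeR R) R gamma tau _ n B g b mE mB.
move=> /(_ (fun j => mulr_ge0 (ltW C10) (ltW (kb0 k j)))) H.
apply: (le_trans (H _ _)).
- move=> j u; have [h1 h2] := boxes (phi u) j.
  have jk : (j <= k.*2)%N by rewrite -ltnS.
  have [h|h] := kernel_sum hm x0 x1 xm jk.
    apply: (le_trans h2); rewrite lee_fin /b ler_pdivlMr// -mulrA ler_pM2l//.
    by rewrite mulrC.
  apply: (le_trans h1); rewrite lee_fin /b ler_pdivlMr// -mulrA ler_pM2l//.
  by rewrite mulrC.
- move=> u w; set S := [set V | _].
  have mS : measurable S by exact: section_measurable mE.
  have S1 V : S V -> [/\ parabolic_norm ((phi u - phi w) *m grass_proj_mx V) <= (2 ^+ k)^-1,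
      1 <= Q * vert V & 1 <= Q * (1 - vert V)].
    by move=> [[h1 h2] h3]; split=> //; rewrite parabolic_norm_le// invr_ge0 exprn_ge0.
  have xle i : `|(phi u - phi w) 0 i| <= 1 by rewrite !mxE.
  have gpos (j : 'I_n) : (0 <= (g j)%:E * (\1_(B j u) w)%:E)%E.
    by rewrite mule_ge0// lee_fin mulr_ge0 ?(ltW C10) ?(ltW (kb0 _ _)).
  have [->|[j jk [xj gS]]] := HC _ k S xle mS S1; first exact: sume_ge0.
  have jn : (j < n)%N by rewrite ltnS.
  rewrite (bigD1 (Ordinal jn))//= -[leLHS]adde0 leeD//; last exact: sume_ge0.
  rewrite indicE mem_set ?mule1// => i /=.
  by have := xj i; rewrite !mxE distrC.
have -> : \sum_(j < n) g j * b j = K * (n%:R * x ^+ k).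
  rewrite (eq_bigr (fun=> K * x ^+ k)) => [|j _].
    by rewrite sumr_const card_ord -[_ *+ _]mulr_natr; ring.
  by rewrite /g /b /K; field; rewrite gt_eqF.
rewrite -(fineK ftau) -EFinM lee_fin [leRHS]mulrAC ler_wpM2r//.
rewrite -[leRHS]mulrA ler_wpM2l//.
rewrite -ler_pdivrMr ?exprn_gt0// -mulrA -expr_div_n; exact: Hc.
Qed.

Lemma projection_not_hnull (A : set 'rV[R]_3) (s sigma Q : R) :
  0 < sigma -> sigma < s -> s <= (m.+1)%:R -> 1 <= Q -> borel_set A -> ~ hnull pdist s A ->
  {ae gamma, forall V : G, 1 <= Q * vert V -> 1 <= Q * (1 - vert V) ->
    forall s', 0 < s' -> s' <= sigma -> ~ hnull pdist s' (orth_proj (val V) @` A)}.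
Proof.
move=> sig0 sigs sm Q1 bA nA; have s0 : 0 < s by apply: lt_trans sigs.
(* Three losses of exponent: from s to s1 for the number of scales, from s1 to s2 for uniformity in
   k at almost every V, and from s2 to sigma for uniformity in k at most points u. *)
pose s1 := (sigma + 2 * s) / 3; pose s2 := (2 * sigma + s) / 3.
have h1 : s1 < s by rewrite /s1; lra.
have h2 : s2 < s1 by rewrite /s1 /s2; lra.
have h3 : sigma < s2 by rewrite /s2; lra.
have [tau [phi [tau0 Aphi mphi [C C0 IE]]]] :=
  energy_decay s0 sm Q1 (powR2N_lt h1) bA nA.
pose E k := close_pairs (T := measurableTypeR R) phi Q k.
have mE k : measurable (E k) := measurable_close_pairs mphi Q k.
apply: ae_of_small => e e0.
have [t [B [t0 mB Be HB]]] := maximal_measure (fun k => measurable_energy tau (mE k))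
  (fun k V => energy_ge0 tau (E k) V) (powR_gt0 (- s1) (ltr0n R 2)) (powR2N_lt h2) C0 e0 IE.
exists B; split=> // V nBV q1 q2 s' s'0 s'sig.
have ftau : tau setT \is a fin_num by exact: fin_num_measure.
(* The points u where the decay fails are allowed half of the mass; the mass distribution principle
   only needs the rest to be positive. *)
have c0 : 0 < fine (tau setT) / 2.
  by rewrite divr_gt0// fine_gt0// tau0 ltey_eq ftau.
have mf k : measurable_fun setT (fun u : measurableTypeR R => tau (xsection (E k) (V, u))).
  have /measurable_fun_pair2 := measurable_fun_xsection tau (mE k).
  exact.
have [t' [B' [t'0 mB' B'e HB']]] := maximal_measure mf (fun k u => measure_ge0 _ _)
  (powR_gt0 (- s2) (ltr0n R 2)) (powR2N_lt h3) (ltW t0) c0 (HB V nBV).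
have secE u k : [set w | pdist (orth_proj (val V) (phi u)) (orth_proj (val V) (phi w)) <= (2 ^+ k)^-1]
    = xsection (E k) (V, u).
  rewrite xsectionE; apply/seteqP; split => w /=; rewrite proj_pdist.
    by rewrite parabolic_norm_le ?invr_ge0 ?exprn_ge0//.
  by move=> [[]]; rewrite parabolic_norm_le// invr_ge0 exprn_ge0.
apply: (@not_hnull_image _ (measurableTypeR R) R _ pdist tau
  (fun u => orth_proj (val V) (phi u)) _ B' t' sigma s') => //.
- apply: (le_lt_trans B'e); rewrite -[ltRHS]fineK// lte_fin ltr_pdivrMr//.
  by move: c0; lra.
- by move=> u; exists (phi u).
- exact: ltW.
- by move=> u k; rewrite secE; exact: measurable_xsection.
- by move=> u nB k; rewrite secE; exact: HB'.
Qed.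

End Projections.

(** * Positivity of the measure of projections *)

(** Markov at a single k costs no rate. The points bad at every k >= K form a set of measure at most
    e, and these sets increase with K, so their union also has measure at most e; off it there are
    infinitely many good k. *)
Lemma often_measure d (X : measurableType d) (R : realType) (mu : {measure set X -> \bar R})
    (f : nat -> X -> \bar R) (C z e : R) :
  (forall k, measurable_fun setT (f k)) -> (forall k x, (0 <= f k x)%E) ->
  0 < z -> 0 <= C -> 0 < e -> (forall k, (\int[mu]_x f k x <= (C * z ^+ k)%:E)%E) ->
  exists t : R, exists B, [/\ 0 < t, measurable B, (mu B <= e%:E)%E &
    forall x, ~ B x -> forall K, exists2 k, (K <= k)%N & (f k x <= (t * z ^+ k)%:E)%E].
Proof.
move=> mf f0 z0 C0 e0 If; pose t := (C + 1) / e.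
have t0 : 0 < t by rewrite divr_gt0// ltr_wpDl.
have zk k : 0 < z ^+ k by rewrite exprn_gt0.
pose S k := [set x | ((t * z ^+ k)%:E <= f k x)%E].
have mS k : measurable (S k) by rewrite -[S k]setTI; exact: emeasurable_fun_c_infty.
pose F K := \bigcap_(k in [set k | (K <= k)%N]) S k.
have mF K : measurable (F K) by apply: bigcap_measurableType => k _; exact: mS.
have muF K : (mu (F K) <= e%:E)%E.
  apply: (@le_trans _ _ (mu (S K))).
    apply: le_measure; rewrite ?inE//; apply: bigcap_inf => /=; exact: leqnn.
  apply: (le_trans (markov_ge0 mu (mf K) (f0 K) (mulr_gt0 t0 (zk K)))).
  apply: (@le_trans _ _ (((t * z ^+ K)^-1)%:E * (C * z ^+ K)%:E)%E).
    by rewrite lee_pmul2l// lte_fin invr_gt0 mulr_gt0.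
  rewrite -EFinM lee_fin mulrC ler_pdivrMr; last by rewrite mulr_gt0.
  rewrite mulrA ler_pM2r//.
  by rewrite /t mulrC divfK ?gt_eqF// lerDl.
exists t, (\bigcup_K F K); split=> //.
- by apply: bigcupT_measurable.
- have nF : nondecreasing_seq F.
    move=> K K' KK'; apply/subsetPset => x Fx k K'k; apply: Fx; exact: leq_trans K'k.
  have cv := nondecreasing_cvg_mu (mu := mu) mF (bigcupT_measurable _ mF) nF.
  rewrite -(cvg_lim _ cv)//; apply: lime_le; first by apply/cvg_ex; exists (mu (\bigcup_n F n)).
  by apply: nearW => K; exact: muF.
- move=> x nB K; apply: contrapT => no; apply: nB; exists K => // k Kk.
  rewrite /S /= leNgt; apply/negP => lt; apply: no; exists k => //; exact: ltW.
Qed.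

(** Controls the volume added to a box by its boundary cells, linearly in the mesh x. The error is
    additive, so that boxes with some sides 0 are covered as well. *)
Lemma prod_perturb (R : realType) (s : seq R) : (forall c, c \in s -> 0 <= c) ->
  exists2 K, 0 <= K & forall x, 0 <= x <= 1 ->
    \prod_(c <- s) (c + x) <= \prod_(c <- s) c + K * x.
Proof.
elim: s => [|c s IH] s0.
  by exists 0 => // x _; rewrite !big_nil mul0r addr0.
have [|K K0 HK] := IH; first by move=> a sa; apply: s0; rewrite inE sa orbT.
have c0 : 0 <= c by apply: s0; rewrite mem_head.
have P0 : 0 <= \prod_(c <- s) c.
  rewrite big_seq; apply: prodr_ge0 => a sa; apply: s0; by rewrite inE sa orbT.
exists (c * K + \prod_(c <- s) c + K); first by rewrite !addr_ge0// mulr_ge0.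
move=> x /andP[x0 x1]; rewrite !big_cons.
have cx : 0 <= c + x by rewrite addr_ge0.
apply: (le_trans (ler_wpM2l cx (HK x _))); first by rewrite x0.
move: (\prod_(c <- s) c) P0 => P P0.
have : K * x * x <= K * x by rewrite ler_piMr// mulr_ge0.
lra.
Qed.

(** The condition on x means s > m + 1, and the ratio w is sqrt(4 x) for lines and 8 x for planes.
    Being strictly below 1, it makes the sum over all scales bounded, with no logarithm. *)
Lemma kernel_sum_euclid (R : realType) (m : 'I_4) (x : R) :
  m = 1%N :> nat \/ m = 2%N :> nat -> 0 < x -> x * 2 ^+ m.+1 < 1 ->
  exists C w : R, [/\ 0 < C, 0 < w, w < 1 & forall j,
    (2 ^+ j) ^+ m * (if m == 1%N :> nat then x ^+ j./2 else (2 * x) ^+ j) <= C * w ^+ j].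
Proof.
move=> hm x0; case: hm => -> /=.
  rewrite !exprS expr0 mulr1 => x4.
  pose w := Num.sqrt (4 * x); have x40 : 0 < 4 * x by rewrite mulr_gt0.
  have w0 : 0 < w by rewrite sqrtr_gt0.
  have w2 : w ^+ 2 = 4 * x by rewrite sqr_sqrtr// ltW.
  have w1 : w < 1.
    by rewrite -(@ltr_pXn2r _ 2)// ?nnegrE ?(ltW w0)// w2 expr1n; lra.
  exists (2 / w), w; split=> //; first by rewrite divr_gt0.
  move=> j; have E (y : R) : y ^+ j = y ^+ odd j * (y ^+ 2) ^+ j./2.
    by rewrite -exprM mul2n -exprD odd_double_half.
  rewrite (E 2) (E w) w2 (_ : 2 ^+ 2 = 4); last by rewrite expr2; ring.
  rewrite [(4 * x) ^+ _]exprMn !mulrA.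
  do 2 (apply: ler_wpM2r; first by rewrite exprn_ge0// ltW).
  case: (odd j); rewrite ?expr1 ?expr0; first by rewrite divfK// gt_eqF.
  by rewrite mulr1 ler_pdivlMr// mul1r; lra.
rewrite !exprS expr0 mulr1 => x8.
exists 1, (8 * x); split=> //; [by rewrite mulr_gt0|by lra|].
by move=> j; rewrite mul1r -exprM mulnC exprM -exprMn ?expr2; apply: lerXn2r; rewrite ?nnegrE; nra.
Qed.

Section Positivity.
Variables (R : realType) (m : 'I_4).
Hypothesis hm : m = 1%N :> nat \/ m = 2%N :> nat.
Variable gamma : probability (grass_borel R m) R.
Hypothesis hgamma : rotation_invariant gamma.
Local Notation G := (grass_borel R m).
Local Notation pdist := (@parabolic_dist R 2).

Definition euclid_pairs (phi : R -> 'rV[R]_3) k : set ((G * measurableTypeR R) * measurableTypeR R) :=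
  [set z | dot (proj_diff phi z) (proj_diff phi z) <= (2 ^+ k)^-1 ^+ 2].

Lemma measurable_euclid_pairs (phi : R -> 'rV[R]_3) k :
  (forall i, measurable_fun [set: measurableTypeR R] (fun u => phi u 0 i)) ->
  measurable (euclid_pairs phi k).
Proof. by move=> mphi; apply: measurable_set_ler => //; exact: measurable_sqr_norm. Qed.

Lemma energy_decay_euclid (A : set 'rV[R]_3) (s : R) : (m.+1)%:R < s ->
  borel_set A -> ~ hnull pdist s A ->
  exists (tau : {finite_measure set (measurableTypeR R) -> \bar R}) (phi : R -> 'rV[R]_3),
  [/\ (0 < tau setT)%E, forall u, A (phi u),
    forall i, measurable_fun [set: measurableTypeR R] (fun u => phi u 0 i) &
    exists2 C : R, 0 <= C & forall k,
      (\int[gamma]_V energy tau (euclid_pairs phi k) V <= (C * ((2 ^+ m)^-1) ^+ k)%:E)%E].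
Proof.
move=> ms bA nA; have s0 : 0 < s by apply: le_lt_trans ms.
pose x : R := 2 `^ (- s).
have x0 : 0 < x by rewrite powR_gt0.
have x1 : x <= 1 by rewrite ltW// powR2N_lt1.
have [tau [phi [tau0 Aphi mphi phi1 bnd]]] := frostman_parabolic s0 bA nA.
exists tau, phi; split=> //.
have xm : x * 2 ^+ m.+1 < 1.
  rewrite -powR_mulrn// /x.
  have n20 : 2 != 0 :> R by rewrite pnatr_eq0.
  rewrite -powRD; last by rewrite n20 implybT.
  by rewrite -[- s + _]opprK; apply: powR2N_lt1; lra.
have [C2 C20 boxes] := frostman_boxes x0 x1 bnd (ltr0n R 2).
have [C1 C10 HC] := gamma_dyadic_euclid hm hgamma.
have [C3 [w [C30 w0 w1 ks]]] := kernel_sum_euclid hm x0 xm.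
have ftau : tau setT \is a fin_num by exact: fin_num_measure.
have t0 : 0 <= fine (tau setT) by rewrite fine_ge0.
have K0 : 0 <= C1 * C2 * C3 / (1 - w) by rewrite divr_ge0 ?subr_ge0 ?(ltW w1)// !mulr_ge0// ltW.
exists (C1 * C2 * C3 / (1 - w) * fine (tau setT)); first by rewrite mulr_ge0.
move=> k; pose n := k.+1.
pose B (j : 'I_n) u := [set w | forall i, `|phi w 0 i - phi u 0 i| <= 2 / 2 ^+ j].
pose g (j : 'I_n) := C1 * (2 ^+ j / 2 ^+ k) ^+ m.
pose be j := if m == 1%N :> nat then x ^+ j./2 else (2 * x) ^+ j.
pose b (j : 'I_n) := C2 * be j.
have mE : measurable (euclid_pairs phi k) := measurable_euclid_pairs k mphi.
have mB j u : measurable (B j u : set (measurableTypeR R)).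
  have -> : B j u = \bigcap_(i in [set: 'I_3]) [set w | `|phi w 0 i - phi u 0 i| <= 2 / 2 ^+ j].
    by apply/seteqP; split => v /= h; [move=> i _; exact: h|move=> i; exact: (h i I)].
  apply: fin_bigcap_measurable => [|i _]; first exact: finite_finset.
  apply: measurable_set_ler => //; apply: (measurableT_comp (@normr_measurable _ _)).
  by apply: measurable_funB; [exact: mphi|exact: measurable_cst].
have g0 j : 0 <= g j by rewrite mulr_ge0 ?(ltW C10)// exprn_ge0// divr_ge0// exprn_ge0.
have := @average_bound _ _ G (measurableTypeR R) R gamma tau _ n B g b mE mB g0.
move=> H; apply: (le_trans (H _ _)).
- move=> j u; have [h1 h2] := boxes (phi u) j.
  by rewrite /b /be; case: ifP => _.
- move=> u v; set S := [set V | _].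
  have mS : measurable S by exact: section_measurable mE.
  have xle i : `|(phi u - phi v) 0 i| <= 1 by rewrite !mxE.
  have [|j jk [xj gS]] := HC _ k S xle mS; first by [].
  have jn : (j < n)%N by rewrite ltnS.
  rewrite (bigD1 (Ordinal jn))//= -[leLHS]adde0 leeD//; last first.
    by apply: sume_ge0 => i _; rewrite mule_ge0// lee_fin.
  rewrite indicE mem_set ?mule1// => i /=.
  by have := xj i; rewrite !mxE distrC.
have zk : 0 <= ((2 ^+ m)^-1 : R) ^+ k by rewrite exprn_ge0// invr_ge0 exprn_ge0.
rewrite -(fineK ftau) -EFinM lee_fin [leRHS]mulrAC ler_wpM2r//.
have -> : \sum_(j < n) g j * b j = C1 * C2 * ((2 ^+ m)^-1) ^+ k *
    \sum_(0 <= j < n) (2 ^+ j) ^+ m * be j.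
  rewrite big_mkord mulr_sumr; apply: eq_bigr => j _.
  rewrite /g /b expr_div_n exprVn -!exprM [(k * m)%N]mulnC; ring.
rewrite [leRHS]mulrAC -![_ * C3]mulrA -[leRHS]mulrA -!mulrA.
do 2 (rewrite ler_pM2l//); rewrite mulrCA ler_wpM2l//.
apply: (@le_trans _ _ (\sum_(0 <= j < n) C3 * w ^+ j)); first by apply: ler_sum => j _; exact: ks.
by rewrite -mulr_sumr ler_pM2l//; exact: geometric_sum_le.
Qed.

End Positivity.

(** * Box covers and lower bounds for volume *)

Section Cells.
Context d (T : measurableType d) (R : realType) (m : nat).
Variable tau : {finite_measure set T -> \bar R}.
Variable c : T -> 'rV[R]_m.
Hypothesis mc : forall i, measurable_fun setT (fun u => c u 0 i).

Definition near_set k u := [set w | \sum_i (c u 0 i - c w 0 i) ^+ 2 <= (2 ^+ k)^-1 ^+ 2].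

Definition box_set (a b : 'rV[R]_m) := [set u | forall i, a 0 i <= c u 0 i <= b 0 i].

Lemma measurable_box_set a b : measurable (box_set a b).
Proof.
have -> : box_set a b =
    \bigcap_(i in [set: 'I_m]) ([set u | a 0 i <= c u 0 i] `&` [set u | c u 0 i <= b 0 i]).
  apply/seteqP; split => u /= h; first by move=> i _; apply/andP; exact: h.
  by move=> i; apply/andP; exact: (h i I).
apply: fin_bigcap_measurable => [|i _]; first exact: finite_finset.
by apply: measurableI; apply: measurable_set_ler.
Qed.

(* The box is cut into cells of side 2^(-k-1), so small that each cell is contained
   in [near_set k u] for all of its points u. *)
Lemma measure_box_cells (a b : 'rV[R]_m) (S : set T) (k : nat) (y : R) :
  (m <= 4)%N -> (forall i, a 0 i <= b 0 i) -> measurable S -> 0 <= y ->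
  (forall u, S u -> (tau (near_set k u) <= y%:E)%E) ->
  (tau (S `&` box_set a b) <= (\prod_i (2 ^+ k.+1 * (b 0 i - a 0 i) + 1) * y)%:E)%E.
Proof.
move=> m4 ab mS y0 Sy; have p0 : 0 < 2 ^+ k.+1 :> R by rewrite exprn_gt0.
pose q (u : T) i := 2 ^+ k.+1 * (c u 0 i - a 0 i).
pose n i := Num.trunc (2 ^+ k.+1 * (b 0 i - a 0 i)).
have nle i : (n i)%:R <= 2 ^+ k.+1 * (b 0 i - a 0 i).
  have : 0 <= 2 ^+ k.+1 * (b 0 i - a 0 i) by rewrite mulr_ge0 ?subr_ge0// ltW.
  by move/truncn_itv => /andP[].
pose F (f : {dffun forall i : 'I_m, 'I_(n i).+1}) :=
  S `&` [set u | forall i, (f i)%:R <= q u i <= (f i).+1%:R].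
have mF f : measurable (F f).
  apply: measurableI => //.
  have -> : [set u | forall i, (f i)%:R <= q u i <= (f i).+1%:R] = \bigcap_(i in [set: 'I_m])
      ([set u | (f i)%:R <= q u i] `&` [set u | q u i <= (f i).+1%:R]).
    apply/seteqP; split => u /= h; first by move=> i _; apply/andP; exact: h.
    by move=> i; apply/andP; exact: (h i I).
  have mq i : measurable_fun setT (fun u => q u i).
    by apply: measurable_funM => //; apply: measurable_funB.
  apply: fin_bigcap_measurable => [|i _]; first exact: finite_finset.
  by apply: measurableI; apply: measurable_set_ler.
have Fy f : (tau (F f) <= y%:E)%E.
  have [->|/set0P[u [Su hu]]] := eqVneq (F f) set0; first by rewrite measure0 lee_fin.
  apply: le_trans (Sy u Su); apply: le_measure; rewrite ?inE//.
    apply: measurable_set_ler => //; apply: measurable_sum => i; apply: measurable_funX.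
    by apply: measurable_funB.
  move=> w [_ hw] /=.
  have sq i : (c u 0 i - c w 0 i) ^+ 2 <= (2 ^+ k.+1)^-1 ^+ 2.
    have := hu i; have := hw i; rewrite /q => /andP[w1 w2] /andP[u1 u2].
    rewrite exprVn -[leRHS]mul1r ler_pdivlMr ?exprn_gt0// -exprMn.
    have h1 : (c u 0 i - c w 0 i) * 2 ^+ k.+1 <= 1.
      by move: u2 w1; rewrite -natr1; lra.
    have h2 : - 1 <= (c u 0 i - c w 0 i) * 2 ^+ k.+1.
      by move: u1 w2; rewrite -natr1; lra.
    move: ((c u 0 i - c w 0 i) * _) h1 h2 => z h1 h2; nra.
  apply: (le_trans (ler_sum _ (fun i _ => sq i))).
  (* Two points of a cell are at squared distance at most m 4^(-k-1), which is at most 4^(-k)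
     because m <= 4. *)
  rewrite sumr_const card_ord [2 ^+ k.+1]exprS invfM exprMn -[_ *+ m]mulr_natl mulrA ler_piMl//.
  have m4' : m%:R <= 4 :> R by rewrite ler_nat.
  by rewrite exprVn ler_pdivrMr ?exprn_gt0// mul1r expr2; lra.
apply: (le_trans (measure_cover_le (F := F) _ mF Fy _)).
- by apply: measurableI => //; exact: measurable_box_set.
- move=> u [Su bu].
  have q0 i : 0 <= q u i by rewrite mulr_ge0 ?(ltW p0)// subr_ge0; have /andP[] := bu i.
  have qn i : (Num.trunc (q u i) < (n i).+1)%N.
    rewrite ltnS; apply: le_truncn; rewrite ler_pM2l//.
    by have /andP[_ ?] := bu i; rewrite lerD2r.
  exists [ffun i => Ordinal (qn i)]; split=> // i; rewrite ffunE /=.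
  by have /andP[-> /ltW] := truncn_itv (q0 i).
rewrite lee_fin ler_wpM2r// card_dep_ffun foldrE big_map big_enum natr_prod.
by apply: ler_prod => i _; rewrite card_ord ler0n/= -natr1 lerD2r; exact: nle.
Qed.

(** The order of choices matters: finitely many boxes carrying half of the mass are fixed first,
    then K so large that their boundary cells are negligible, and only then a good scale k >= K. The
    bound e depends on none of these, hence bounds the outer measure. *)
Lemma cells_positive t : (m <= 4)%N -> (0 < tau setT)%E -> 0 < t ->
  (forall K, exists2 k, (K <= k)%N &
    (\int[tau]_u tau (near_set k u) <= (t * ((2 ^+ m)^-1) ^+ k)%:E)%E) ->
  exists2 e : R, 0 < e & forall a b : nat -> 'rV[R]_m, (forall k i, a k 0 i <= b k 0 i) ->
    (forall u, exists k, box_set (a k) (b k) u) ->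
    (e%:E <= \sum_(k <oo) (\prod_(i < m) (b k 0 i - a k 0 i))%:E)%E.
Proof.
move=> m4 tau0 t0 H.
have ftau : tau setT \is a fin_num by exact: fin_num_measure.
pose M := fine (tau setT).
have M0 : 0 < M by rewrite fine_gt0// tau0 ltey_eq ftau.
(* Of the mass M / 2 carried by the chosen boxes, Markov leaves at most M / 4 on bad points by the
   choice of [kap]; the volume term and the boundary term each stay below M / 8, a contradiction.
   The factor 2^m in e comes from the cells having side 2^(-k-1). *)
pose kap := 4 * t / M; have kap0 : 0 < kap by rewrite divr_gt0// mulr_gt0.
pose e := M / 8 / kap / 2 ^+ m.
have pm : 0 < 2 ^+ m :> R by rewrite exprn_gt0.
have e0 : 0 < e by exact: divr_gt0 (divr_gt0 (divr_gt0 M0 _) kap0) pm.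
exists e => [//|a b ab cov]; rewrite leNgt; apply/negP => lt.
pose D k := box_set (a k) (b k).
have mD k : measurable (D k) by exact: measurable_box_set.
have vol0 k : 0 <= \prod_(i < m) (b k 0 i - a k 0 i).
  by apply: prodr_ge0 => i _; rewrite subr_ge0.
have [n Mn] : exists n, ((M / 2)%:E <= tau (\big[setU/set0]_(i < n) D i))%E.
  apply: contrapT => no.
  have UT : \bigcup_n \big[setU/set0]_(i < n.+1) D i = setT.
    by rewrite bigcup_bigsetU_bigcup; apply/seteqP; split => // u _; have [k ?] := cov u; exists k.
  have mU n : measurable (\big[setU/set0]_(i < n) D i) by exact: bigsetU_measurable.
  have nU : nondecreasing_seq (fun n => \big[setU/set0]_(i < n.+1) D i).
    move=> n n' nn'; apply/subsetPset; exact: subset_bigsetU.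
  have cv := nondecreasing_cvg_mu (mu := tau) (fun n => mU n.+1) (bigcupT_measurable _ (fun n => mU n.+1)) nU.
  have : (tau setT <= (M / 2)%:E)%E.
    rewrite -UT -(cvg_lim _ cv)//; apply: lime_le; first by apply/cvg_ex; eexists; exact: cv.
    by apply: nearW => k; rewrite leNgt; apply/negP => /ltW h; apply: no; exists k.+1.
  rewrite -(fineK ftau) lee_fin -/M; lra.
have /choice[Kn HK] : forall i : nat, exists Ki : R, 0 <= Ki /\ forall x, 0 <= x <= 1 ->
    \prod_(j < m) (2 * (b i 0 j - a i 0 j) + x) <=
    2 ^+ m * \prod_(j < m) (b i 0 j - a i 0 j) + Ki * x.
  move=> i; have [|Ki Ki0 h] := @prod_perturb R [seq 2 * (b i 0 j - a i 0 j) | j <- index_enum 'I_m].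
    by move=> _ /mapP[j _ ->]; rewrite mulr_ge0// subr_ge0.
  exists Ki; split=> // x /h; rewrite !big_map/=.
  by rewrite [X in _ <= X + _ -> _]big_split/= prodr_const card_ord.
pose S := \sum_(0 <= i < n) Kn i.
have S0 : 0 <= S by apply: sumr_ge0 => i _; have [] := HK i.
have volS : \sum_(0 <= i < n) \prod_(j < m) (b i 0 j - a i 0 j) < e.
  rewrite -lte_fin -sumEFin; apply: le_lt_trans lt.
  by apply: nneseries_lim_ge => k _; rewrite lee_fin.
have kS : 0 <= kap * S := mulr_ge0 (ltW kap0) S0.
have kS1 : 0 < kap * S + 1 by rewrite ltr_wpDl.
have [K HKs] : exists K, kap * S * (2 ^+ K)^-1 < M / 8.
  have [|K hK] := @exists_half_exp_lt R (M / 8 / (kap * S + 1)).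
    by rewrite divr_gt0// divr_gt0.
  exists K; move: hK; rewrite ltr_pdivlMr//; apply: le_lt_trans.
  by rewrite mulrC ler_wpM2l ?invr_ge0 ?exprn_ge0// lerDl.
have [k Kk Ik] := H K; pose z : R := (2 ^+ m)^-1.
have z0 : 0 < z by rewrite invr_gt0.
have zk : 0 < z ^+ k by rewrite exprn_gt0.
have kz : 0 < kap * z ^+ k by rewrite mulr_gt0.
pose h u := tau (near_set k u).
have mh : measurable_fun setT h.
  pose E := [set p : T * T | \sum_i (c p.1 0 i - c p.2 0 i) ^+ 2 <= (2 ^+ k)^-1 ^+ 2].
  have mE : measurable E.
    apply: measurable_set_ler => //; apply: measurable_sum => i; apply: measurable_funX.
    apply: measurable_funB; first exact: (measurableT_comp (mc i) measurable_fst).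
    exact: (measurableT_comp (mc i) measurable_snd).
  have := measurable_fun_xsection tau mE; congr (measurable_fun _ _).
  by apply/funext => u; rewrite /= xsectionE.
pose Bad := [set u | ((kap * z ^+ k)%:E <= h u)%E].
have mB : measurable Bad by rewrite -[Bad]setTI; exact: emeasurable_fun_c_infty.
have tB : (tau Bad <= (M / 4)%:E)%E.
  apply: (le_trans (markov_ge0 tau mh (fun=> measure_ge0 _ _) kz)).
  apply: (@le_trans _ _ (((kap * z ^+ k)^-1)%:E * (t * z ^+ k)%:E)%E).
    by rewrite lee_pmul2l// lte_fin invr_gt0.
  rewrite -EFinM lee_fin mulrC ler_pdivrMr//.
  have -> : M / 4 * (kap * z ^+ k) = t * z ^+ k; last by [].
  by rewrite /kap; field; rewrite gt_eqF.
pose S' := ~` Bad.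
have mS' : measurable S' by exact: measurableC.
have half : (0 <= (2 ^+ k)^-1 :> R) && ((2 ^+ k)^-1 <= 1 :> R).
  by rewrite invr_ge0 exprn_ge0//= invf_le1 ?exprn_gt0// exprn_ege1// ler1n.
have cell i : (tau (S' `&` D i) <=
    (kap * (2 ^+ m * \prod_(j < m) (b i 0 j - a i 0 j) + Kn i * (2 ^+ k)^-1))%:E)%E.
  apply: (le_trans (measure_box_cells (k := k) m4 (ab i) mS' (ltW kz) _)).
    by move=> u /negP; rewrite -ltNge => /ltW.
  rewrite lee_fin mulrCA ler_pM2l//; have [_ /(_ _ half)] := HK i; apply: le_trans.
  have -> : z ^+ k = \prod_(j < m) (2 ^+ k)^-1.
    by rewrite prodr_const card_ord /z !exprVn -!exprM mulnC.
  rewrite -big_split/=; apply: ler_prod => j _; rewrite exprS.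
  have p0 : 0 < 2 ^+ k :> R by rewrite exprn_gt0.
  have bj : 0 <= b i 0 j - a i 0 j by rewrite subr_ge0.
  rewrite divr_ge0 ?addr_ge0 ?mulr_ge0 ?(ltW p0)//=.
  by rewrite le_eqVlt; apply/orP; left; apply/eqP; field; rewrite gt_eqF.
have total : (tau (\big[setU/set0]_(i < n) (S' `&` D i)) <=
    (kap * (2 ^+ m * \sum_(0 <= i < n) \prod_(j < m) (b i 0 j - a i 0 j) + S * (2 ^+ k)^-1))%:E)%E.
  apply: (le_trans (le_mu_bigsetU tau (fun i _ => measurableI _ _ mS' (mD i)))).
  apply: (le_trans (lee_sum _ (fun (i : 'I_n) _ => cell i))).
  by rewrite sumEFin lee_fin -mulr_sumr big_split/= -mulr_sumr -mulr_suml /S !big_mkord.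
have mU' : measurable (\big[setU/set0]_(i < n) (S' `&` D i)).
  by apply: bigsetU_measurable => i _; exact: measurableI.
have : ((M / 2)%:E <= (M / 4)%:E + (kap * (2 ^+ m * \sum_(0 <= i < n)
    \prod_(j < m) (b i 0 j - a i 0 j) + S * (2 ^+ k)^-1))%:E)%E.
  apply: (le_trans Mn); apply: le_trans (leeD tB total).
  apply: le_trans (measureU2 _ mB mU'); apply: le_measure; rewrite ?inE.
  - exact: bigsetU_measurable.
  - exact: measurableU.
  move=> u; rewrite -bigcup_mkord => -[i /= ni Du].
  case: (pselect (Bad u)) => [?|?]; [by left|right].
  by rewrite -(bigcup_mkord n (fun i => S' `&` D i)); exists i.
rewrite -EFinD lee_fin.
have h1 : kap * (2 ^+ m * \sum_(0 <= i < n) \prod_(j < m) (b i 0 j - a i 0 j)) < M / 8.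
  have -> : M / 8 = kap * (2 ^+ m * e).
    by rewrite /e; field; rewrite ?gt_eqF.
  by rewrite !ltr_pM2l.
have h2 : kap * (S * (2 ^+ k)^-1) <= kap * S * (2 ^+ K)^-1.
  rewrite mulrA; apply: ler_wpM2l => //.
  rewrite lef_pV2 ?posrE ?exprn_gt0//.
  by rewrite ler_weXn2l// ler1n.
rewrite mulrDr; lra.
Qed.

End Cells.

(** * Passage to almost every subspace *)

Section MainTheorem.
Variables (R : realType) (m : 'I_4).
Hypothesis hm : m = 1%N :> nat \/ m = 2%N :> nat.
Variable gamma : probability (grass_borel R m) R.
Hypothesis hgamma : rotation_invariant gamma.
Local Notation G := (grass_borel R m).
Local Notation pdist := (@parabolic_dist R 2).

Lemma projection_positive (A : set 'rV[R]_3) (s : R) : (m.+1)%:R < s ->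
  borel_set A -> ~ hnull pdist s A ->
  {ae gamma, forall V : G, (0 < lebesgue_on V (orth_proj (val V) @` A))%E}.
Proof.
move=> ms bA nA.
have [tau [phi [tau0 Aphi mphi [C C0 IE]]]] := energy_decay_euclid hm hgamma ms bA nA.
pose E k := euclid_pairs (m := m) phi k.
have mE k : measurable (E k) := measurable_euclid_pairs k mphi.
apply: ae_of_small => e e0.
have z0 : 0 < (2 ^+ m)^-1 :> R by rewrite invr_gt0 exprn_gt0.
have [t [B [t0 mB Be HB]]] := often_measure (fun k => measurable_energy tau (mE k))
  (fun k V => energy_ge0 tau (E k) V) z0 C0 e0 IE.
exists B; split=> // V nBV; rewrite /lebesgue_on.
have := getPex (orthonormal_frame_ex V); set F := get _ => -[FF FV].
have PE : grass_proj_mx V = F^T *m F.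
  by apply: orth_proj_frame => //; apply/eqP; exact: (valP (V : grassmannian R m)).
pose c (u : measurableTypeR R) : 'rV[R]_m := phi u *m F^T.
have mc i : measurable_fun setT (fun u => c u 0 i).
  have cE u : c u 0 i = \sum_l phi u 0 l * F i l.
    by rewrite mxE; apply: eq_bigr => l _; rewrite mxE.
  under eq_fun do rewrite cE.
  by apply: measurable_sum => l; apply: measurable_funM => //; exact: mphi.
(* Coordinates in an orthonormal frame preserve lengths, so the energy at V is the one of [c] in
   R^m, where boxes are measured. *)
have diffE u w : dot (proj_diff phi (V, u, w)) (proj_diff phi (V, u, w)) =
    \sum_i (c u 0 i - c w 0 i) ^+ 2.
  rewrite /dot /proj_diff /= PE mulmxA mulmxBl -/(c u) -/(c w) trmx_mul -mulmxA (mulmxA F) FF.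
  by rewrite mul1mx mxE; apply: eq_bigr => i _; rewrite !mxE expr2.
have secE k u : near_set c k u = xsection (E k) (V, u).
  rewrite xsectionE; apply/seteqP; split => w; rewrite /= /E /euclid_pairs /near_set /=;
    by rewrite diffE.
have m4 : (m <= 4)%N by rewrite ltnW.
have often K : exists2 k, (K <= k)%N &
    (\int[tau]_u tau (near_set c k u) <= (t * ((2 ^+ m)^-1) ^+ k)%:E)%E.
  have [k Kk h] := HB V nBV K; exists k => //; apply: le_trans h.
  by rewrite /energy le_eqVlt; apply/orP; left; apply/eqP/eq_integral => u _; rewrite secE.
have [e' e'0 He'] := cells_positive mc m4 tau0 t0 often.
apply: (@lt_le_trans _ _ e'%:E); first by rewrite lte_fin.
apply: le_ereal_inf_tmp => _ [a [b [ab cov ->]]]; apply: He' => // u.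
have [|k _ ck] := cov (c u); last by exists k.
exists (phi u) => //.
by rewrite orth_projE PE mulmxA.
Qed.

(** The degenerate positions lie in slabs and caps about the time axis, of arbitrarily small radius
    and so of arbitrarily small measure. *)
Lemma vert_ae : {ae gamma, forall V : G, 0 < vert V /\ vert V < 1}.
Proof.
have [C1 C10 H1] := gamma_slab hm hgamma; have [C2 C20 H2] := gamma_cap_bound hm hgamma.
pose e3 : 'rV[R]_3 := vec3 0 0 1.
have e31 : dot e3 e3 = 1 by rewrite dotE !vec3E !mulr0 !add0r mulr1.
apply: ae_of_small => e e0.
pose rho := Num.min 1 (e / (C1 + C2)).
have C0 : 0 < C1 + C2 by rewrite addr_gt0.
have r0 : 0 < rho by rewrite lt_min ltr01 divr_gt0.
have r1 : rho <= 1 by rewrite ge_min lexx.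
have re : rho * (C1 + C2) <= e by rewrite -ler_pdivlMr// ge_min lexx orbT.
have mle : measurable [set x : R | x <= rho ^+ 2] by exact: measurable_set_ler.
exists (qset e3 [set x | x <= rho ^+ 2] `|` cap e3 rho); split.
- by apply: measurableU; [exact: measurable_qset|exact: measurable_cap].
- apply: (le_trans (measureU2 gamma (measurable_qset _ mle) (measurable_cap _ _))).
  apply: (le_trans (leeD (H1 e3 rho e31 r0) (H2 e3 rho e31 r0))).
  rewrite -EFinD lee_fin; have : rho ^+ 2 <= rho by rewrite expr2 ler_piMr// ltW.
  nra.
- move=> V /not_orP[/negP h1 /negP h2].
  have h3 : rho ^+ 2 < vert V by rewrite ltNge.
  have h4 : rho ^+ 2 < 1 - vert V by rewrite ltNge.
  have : 0 < rho ^+ 2 by rewrite exprn_gt0.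
  by split; lra.
Qed.

Lemma parabolic_dim_ge0 (B : set 'rV[R]_3) : (0 <= parabolic_dim B)%E.
Proof. by apply: le_ereal_inf_tmp => _ [s [s0 _] <-]; rewrite lee_fin ltW. Qed.

Lemma not_hnull_lt_dim (B : set 'rV[R]_3) (s : R) : 0 < s ->
  (s%:E < parabolic_dim B)%E -> ~ hnull pdist s B.
Proof.
move=> s0 sB nB; move: sB; rewrite ltNge => /negP; apply.
by apply: ereal_inf_lbound; exists s.
Qed.

Lemma projection_dim (A : set 'rV[R]_3) : borel_set A ->
  (parabolic_dim A <= (m.+1)%:R%:E)%E ->
  {ae gamma, forall V : G, (parabolic_dim A <= parabolic_dim (orth_proj (val V) @` A))%E}.
Proof.
move=> bA; have := parabolic_dim_ge0 A; rewrite le_eqVlt => /orP[/eqP <- _|].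
  by apply: aeW => V; exact: parabolic_dim_ge0.
case E : (parabolic_dim A) => [r| |]//; rewrite lte_fin lee_fin => r0 rm.
(* Exponents increasing to r; n + 2 keeps the first one positive. The midpoint s n lies strictly
   between sig n and r, so A is not null for it. Countably many n and q then give a single null set
   of V. *)
pose sig n := r * (1 - (n.+2%:R)^-1); pose s n := (sig n + r) / 2.
have n1 n : (n.+2%:R)^-1 < 1 :> R by rewrite invf_lt1 ?ltr0n// ltr1n.
have sig0 n : 0 < sig n by rewrite mulr_gt0// subr_gt0.
have sigr n : sig n < r.
  by rewrite gtr_pMr// ltrBlDr ltrDl invr_gt0.
have main n q : {ae gamma, forall V : G, 1 <= q.+1%:R * vert V -> 1 <= q.+1%:R * (1 - vert V) ->
    forall s', 0 < s' -> s' <= sig n -> ~ hnull pdist s' (orth_proj (val V) @` A)}.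
  have h := sigr n; have h0 := sig0 n.
  apply: (@projection_not_hnull _ _ hm _ hgamma A (s n)) => //.
  - by rewrite /s; lra.
  - by apply: le_trans rm; rewrite /s; lra.
  - by rewrite ler1n.
  - by apply: not_hnull_lt_dim; rewrite ?E ?lte_fin /s; lra.
have /ae_foralln H : forall n, {ae gamma, forall V : G, forall q, 1 <= q.+1%:R * vert V ->
    1 <= q.+1%:R * (1 - vert V) ->
    forall s', 0 < s' -> s' <= sig n -> ~ hnull pdist s' (orth_proj (val V) @` A)}.
  by move=> n; apply/ae_foralln => q; exact: main.
apply: filterS2 H vert_ae => V HV [v0 v1]; apply: le_ereal_inf_tmp => _ [s' [s'0 ns'] <-].
rewrite leNgt lte_fin; apply/negP => s'r.
pose x := Num.min (vert V) (1 - vert V).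
have x0 : 0 < x by rewrite lt_min v0 subr_gt0.
have [q hq] : exists q, 1 <= q.+1%:R * x.
  exists (Num.bound x^-1); rewrite -ler_pdivrMr// mul1r.
  have := archi_boundP (ltW (_ : 0 < x^-1)); rewrite invr_gt0 => /(_ x0) /ltW h.
  by apply: (le_trans h); rewrite ler_nat.
have [n hn] : exists n, s' <= sig n.
  exists (Num.bound (r / (r - s'))).
  have d0 : 0 < r - s' by rewrite subr_gt0.
  have := archi_boundP (ltW (divr_gt0 r0 d0)); set N := Num.bound _ => h.
  have N2 : 0 < N.+2%:R :> R by rewrite ltr0n.
  have : r / N.+2%:R <= r - s'.
    rewrite ler_pdivrMr// mulrC -ler_pdivrMr//; apply: (le_trans (ltW h)); rewrite ler_nat.
    by rewrite -addn2 leq_addr.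
  by rewrite -/N /sig mulrBr mulr1 !lerBrDr addrC.
apply: (HV n q _ _ s') => //; apply: (le_trans hq); rewrite ler_pM2l ?ltr0n// ge_min lexx ?orbT//.
Qed.

End MainTheorem.

Theorem theorem1p2 (R : realType) (m : 'I_4) (hm : m = 1%N :> nat \/ m = 2%N :> nat)
    (gamma : probability (grass_borel R m) R) (hgamma : rotation_invariant gamma)
    (A : set 'rV[R]_3) (hA : borel_set A) :
  ((parabolic_dim A <= (m.+1)%:R%:E)%E ->
    {ae gamma, forall V : grassmannian R m,
      (parabolic_dim A <= parabolic_dim (orth_proj (val V) @` A))%E}) /\
  (((m.+1)%:R%:E < parabolic_dim A)%E ->
    {ae gamma, forall V : grassmannian R m,
      (0 < lebesgue_on V (orth_proj (val V) @` A))%E}).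
Proof.
split; first exact: projection_dim.
case E : (parabolic_dim A) => [r| |]// mr.
  have h : (m.+1)%:R < r by rewrite -lte_fin.
  have m0 : 0 < (m.+1)%:R :> R by rewrite ltr0n.
  apply: (projection_positive hm hgamma (s := ((m.+1)%:R + r) / 2)) => //; first lra.
  by apply: not_hnull_lt_dim; rewrite ?E ?lte_fin; lra.
(* The case of infinite dimension, where any finite exponent above m + 1 serves. *)
apply: (projection_positive hm hgamma (s := (m.+1)%:R + 1)) => //; first by rewrite ltrDl.
by apply: not_hnull_lt_dim; rewrite ?E ?ltry// addr_gt0.
Qed.
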